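(* Let $m,l\in\mathbb{R}$ and let $M^3_{m,l}$ be the BCV 3-space with metric $g=\frac{dx^2+dy^2}{[1+m(x^2+y^2)]^2}+\left[dz+\frac{l}{2}\,\frac{y\,dx-x\,dy}{1+m(x^2+y^2)}\right]^2$. Let $(N^2,h)$ be a Riemannian surface and let $\pi:M^3_{m,l}\to(N^2,h)$ be a harmonic Riemannian submersion. Then $(N^2,h)$ has constant Gauss curvature $K^N=4m$. Furthermore, locally and up to equivalence, $\pi$ is the map $$\left(\mathbb{R}^3,\ \tfrac{dx^2+dy^2}{[1+m(x^2+y^2)]^2}+\left[dz+\tfrac{l}{2}\tfrac{y\,dx-x\,dy}{1+m(x^2+y^2)}\right]^2\right)\to\left(\mathbb{R}^2,\ \tfrac{dx^2+dy^2}{[1+m(x^2+y^2)]^2}\right),\qquad (x,y,z)\mapsto(x,y).$$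
   Context: All manifolds and maps are smooth. A Riemannian submersion $\pi:(M,g)\to(N,h)$ is a surjective submersion such that $d\pi_p$ restricted to $(\ker d\pi_p)^\perp$ is a linear isometry onto $T_{\pi(p)}N$ for every $p$. A map $\varphi$ between Riemannian manifolds is harmonic if its tension field $\tau(\varphi)=\mathrm{Trace}_g\nabla d\varphi$ vanishes identically; a harmonic Riemannian submersion is a Riemannian submersion that is a harmonic map. BCV spaces: for $m,l\in\mathbb{R}$, $M^3_{m,l}$ denotes $\mathbb{R}^3$ with coordinates $(x,y,z)$ and the metric $g$ given in the claim; when $m<0$ both $\mathbb{R}^3$ and the target $\mathbb{R}^2$ are understood to be restricted to the region where $1+m(x^2+y^2)>0$. ''Locally and up to equivalence, $\pi$ is the map $\pi_0$'' means: every point of the domain of $\pi$ has an open neighbourhood $U$ for which there are an isometry $\Phi$ from $U$ onto an open subset of the domain of $\pi_0$ and an isometry $\Psi$ from $\pi(U)$ onto an open subset of the target of $\pi_0$ with $\Psi\circ\pi|_U=\pi_0\circ\Phi$. *)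

(* Defs.v *)
From HB Require Import structures.
From mathcomp Require Import all_boot all_order all_algebra.
From mathcomp Require Import all_classical all_reals all_analysis.

Set Implicit Arguments.
Unset Strict Implicit.
Unset Printing Implicit Defensive.

Import Order.TTheory GRing.Theory Num.Theory.
Import numFieldNormedType.Exports.
Local Open Scope classical_set_scope.
Local Open Scope ring_scope.

Section Calculus.
Context {R : realType} {n : nat}.

(* Meaningful for [U] open. *)
Fixpoint Ck {V : normedModType R} (k : nat) (U : set 'rV[R]_n)
    (f : 'rV[R]_n -> V) : Prop :=
  if k is k'.+1 then
    (forall x, U x -> differentiable f x) /\
    (forall i : 'I_n, Ck k' U (fun x => 'D_(delta_mx 0 i) f x))
  else forall x, U x -> {for x, continuous f}.

Definition smooth {V : normedModType R} (U : set 'rV[R]_n)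
    (f : 'rV[R]_n -> V) : Prop := forall k, Ck k U f.

Definition pd (i : 'I_n) (f : 'rV[R]_n -> R) (x : 'rV[R]_n) : R :=
  'D_(delta_mx 0 i) f x.

Definition ip (G : 'M[R]_n) (v w : 'rV[R]_n) : R := (v *m G *m w^T) 0 0.

(* Gamma^k_{ij} of the metric with component matrix [G]. *)
Definition christoffel (G : 'rV[R]_n -> 'M[R]_n) (k i j : 'I_n)
    (x : 'rV[R]_n) : R :=
  2^-1 * \sum_(l < n) invmx (G x) k l *
    (pd i (fun y => G y j l) x + pd j (fun y => G y i l) x
     - pd l (fun y => G y i j) x).

(* The component along d_l of R(d_i, d_j) d_k, where
   R(X, Y) = [nabla_X, nabla_Y] - nabla_[X, Y]. *)
Definition riemann (G : 'rV[R]_n -> 'M[R]_n) (l k i j : 'I_n)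
    (x : 'rV[R]_n) : R :=
  pd i (christoffel G l j k) x - pd j (christoffel G l i k) x
  + \sum_(s < n) (christoffel G s j k x * christoffel G l i s x
                  - christoffel G s i k x * christoffel G l j s x).

End Calculus.

(* <R(d_0, d_1) d_1, d_0> / det G; the value is 1 on the unit sphere. *)
Definition gauss_curvature {R : realType} (G : 'rV[R]_2 -> 'M[R]_2)
    (x : 'rV[R]_2) : R :=
  (\sum_(l < 2) riemann G l 1 0 1 x * G x l 0) / \det (G x).

(* Components of nabla d F for F : (R^n, G) -> (R^k, H). *)
Definition second_fund_form {R : realType} {n k : nat}
    (G : 'rV[R]_n -> 'M[R]_n) (H : 'rV[R]_k -> 'M[R]_k)
    (F : 'rV[R]_n -> 'rV[R]_k) (c : 'I_k) (i j : 'I_n) (x : 'rV[R]_n) : R :=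
  pd i (pd j (fun y => F y 0 c)) x
  - \sum_(l < n) christoffel G l i j x * pd l (fun y => F y 0 c) x
  + \sum_(a < k) \sum_(b < k) christoffel H c a b (F x)
      * pd i (fun y => F y 0 a) x * pd j (fun y => F y 0 b) x.

Definition tension {R : realType} {n k : nat}
    (G : 'rV[R]_n -> 'M[R]_n) (H : 'rV[R]_k -> 'M[R]_k)
    (F : 'rV[R]_n -> 'rV[R]_k) (x : 'rV[R]_n) : 'rV[R]_k :=
  \row_c \sum_(i < n) \sum_(j < n)
    invmx (G x) i j * second_fund_form G H F c i j x.

(* The underlying space is the subset [supp] of a topological space (so that
   open regions of R^n are covered as well as abstract manifolds, for which
   [supp] is the whole type).  [cinv i] is the inverse of the chart [cmap i],
   and its values outside [cmap i @` cdom i] are irrelevant; [met i x] is the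
   matrix of components of the metric at the point of coordinates [x]. *)
Record atlas_data (R : realType) (n : nat) := AtlasData {
  pt : topologicalType;
  supp : set pt;
  idx : Type;
  cdom : idx -> set pt;
  cmap : idx -> pt -> 'rV[R]_n;
  cinv : idx -> 'rV[R]_n -> pt;
  met : idx -> 'rV[R]_n -> 'M[R]_n
}.
Arguments supp {R n} _.

Section Maps.
Context {R : realType} {n k : nat}.
Variables (M : atlas_data R n) (N : atlas_data R k).

(* Expression of [f] in the charts [i] and [j], and its domain when [f] is
   restricted to [U]. *)
Definition loc (f : pt M -> pt N) (i : idx M) (j : idx N) :
  'rV[R]_n -> 'rV[R]_k := fun x => cmap j (f (cinv i x)).

Definition locdom (U : set (pt M)) (f : pt M -> pt N) (i : idx M) (j : idx N) :
  set 'rV[R]_n := cmap i @` (U `&` cdom i `&` f @^-1` (cdom j)).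

Definition smooth_map (U : set (pt M)) (f : pt M -> pt N) : Prop :=
  [/\ f @` U `<=` supp N,
      forall p, U p -> {for p, continuous f} &
      forall i j, smooth (locdom U f i j) (loc f i j)].

Definition metric_preserving (U : set (pt M)) (f : pt M -> pt N) : Prop :=
  forall i j x, locdom U f i j x -> forall v w : 'rV[R]_n,
    ip (met j (loc f i j x)) ('d (loc f i j) x v) ('d (loc f i j) x w)
    = ip (met i x) v w.

Definition riemannian_submersion (f : pt M -> pt N) : Prop :=
  [/\ smooth_map (supp M) f,
      f @` supp M = supp N &
      forall i j x, locdom (supp M) f i j x ->
        let df : 'rV[R]_n -> 'rV[R]_k := 'd (loc f i j) x in
        let horizontal v := forall u, df u = 0 -> ip (met i x) u v = 0 in
        (forall w, exists v, df v = w) /\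
        (forall v w, horizontal v -> horizontal w ->
           ip (met j (loc f i j x)) (df v) (df w) = ip (met i x) v w)].

Definition harmonic_map (f : pt M -> pt N) : Prop :=
  smooth_map (supp M) f /\
  forall i j x, locdom (supp M) f i j x ->
    tension (met i) (met j) (loc f i j) x = 0.

End Maps.

Record riemannian_manifold {R : realType} {n : nat} (M : atlas_data R n) :
    Prop := {
  rm_hausdorff : hausdorff_space (pt M);
  rm_countable : @second_countable (pt M);
  rm_open : open (supp M);
  rm_cover : \bigcup_(i in [set: idx M]) cdom i = supp M;
  rm_cdom : forall i : idx M, open (cdom i);
  rm_cimg : forall i : idx M, open (cmap i @` cdom i);
  rm_cancel : forall (i : idx M) p, cdom i p -> cinv i (cmap i p) = p;
  rm_cmap : forall (i : idx M) p, cdom i p -> {for p, continuous (cmap i)};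
  rm_cinv : forall (i : idx M) x, (cmap i @` cdom i) x ->
    {for x, continuous (cinv i)};
  (* Read in charts, [id] is the change of charts; [rm_met_change] is the
     transformation law of a covariant 2-tensor. *)
  rm_change : smooth_map (supp M) (id : pt M -> pt M);
  rm_met_change : metric_preserving (supp M) (id : pt M -> pt M);
  rm_met_smooth : forall i : idx M, smooth (cmap i @` cdom i) (met i);
  rm_met_sym : forall (i : idx M) x, (cmap i @` cdom i) x ->
    (met i x)^T = met i x;
  rm_met_pos : forall (i : idx M) x, (cmap i @` cdom i) x ->
    forall v, v != 0 -> 0 < ip (met i x) v v
}.

Definition is_isometry {R : realType} {n : nat} (M N : atlas_data R n)
    (U : set (pt M)) (V : set (pt N)) (f : pt M -> pt N) : Prop :=
  [/\ open U /\ U `<=` supp M,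
      open V /\ V `<=` supp N,
      smooth_map U f /\ f @` U = V,
      exists g : pt N -> pt M,
        [/\ smooth_map V g, g @` V = U & forall p, U p -> g (f p) = p] &
      metric_preserving U f].

Definition locally_equivalent {R : realType} {n k : nat}
    (M M0 : atlas_data R n) (N N0 : atlas_data R k)
    (f : pt M -> pt N) (f0 : pt M0 -> pt N0) : Prop :=
  forall p, supp M p ->
  exists (U : set (pt M)) (V : set (pt M0)) (W : set (pt N0))
         (Phi : pt M -> pt M0) (Psi : pt N -> pt N0),
    [/\ U p,
        is_isometry U V Phi,
        is_isometry (f @` U) W Psi &
        forall q, U q -> Psi (f q) = f0 (Phi q)].

Definition constant_gauss_curvature {R : realType} (N : atlas_data R 2)
    (K : R) : Prop :=
  forall (j : idx N) x, (cmap j @` cdom j) x -> gauss_curvature (met j) x = K.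

Definition open_region {R : realType} {n : nat} (U : set 'rV[R]_n)
    (G : 'rV[R]_n -> 'M[R]_n) : atlas_data R n :=
  @AtlasData R n 'rV[R]_n U unit (fun=> U) (fun=> id) (fun=> id) (fun=> G).

Section BCV.
Context {R : realType}.
Variables m l : R.

Definition bcv_factor (x y : R) : R := 1 + m * (x ^+ 2 + y ^+ 2).

(* The components of the 1-form dz + l/2 (y dx - x dy) / (1 + m (x^2+y^2)). *)
Definition bcv_form (p : 'rV[R]_3) : 'rV[R]_3 :=
  let x := p 0 0 in let y := p 0 1 in
  let F := bcv_factor x y in
  \row_i [:: l / 2 * (y / F); - (l / 2 * (x / F)); 1]`_i.

(* [pid_mx 2] is the matrix of dx^2 + dy^2 on R^3. *)
Definition bcv_metric (p : 'rV[R]_3) : 'M[R]_3 :=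
  (bcv_factor (p 0 0) (p 0 1) ^+ 2)^-1 *: pid_mx 2
  + (bcv_form p)^T *m bcv_form p.

Definition base_metric (q : 'rV[R]_2) : 'M[R]_2 :=
  (bcv_factor (q 0 0) (q 0 1) ^+ 2)^-1 *: 1%:M.

(* The region 1 + m (x^2+y^2) > 0 is the whole space when 0 <= m. *)
Definition bcv : atlas_data R 3 :=
  open_region [set p | 0 < bcv_factor (p 0 0) (p 0 1)] bcv_metric.

Definition bcv_base : atlas_data R 2 :=
  open_region [set q | 0 < bcv_factor (q 0 0) (q 0 1)] base_metric.

Definition bcv_proj : pt bcv -> pt bcv_base :=
  fun p : 'rV[R]_3 => \row_(i < 2) [:: p 0 0; p 0 1]`_i.

End BCV.

(* Main.v *)
Require Import Defs.
From HB Require Import structures.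
From mathcomp Require Import all_boot all_order all_algebra.
From mathcomp Require Import all_classical all_reals all_analysis.
From mathcomp Require Import ring lra.

Set Implicit Arguments.
Unset Strict Implicit.
Unset Printing Implicit Defensive.

Import Order.TTheory GRing.Theory Num.Theory.
Import numFieldNormedType.Exports.
Local Open Scope classical_set_scope.
Local Open Scope ring_scope.

(* On the BCV space use the orthonormal frame E1 = f d/dx - (l/2) y d/dz,
   E2 = f d/dy + (l/2) x d/dz, E3 = d/dz with f = 1 + m (x^2 + y^2). If V is a unit vertical
   field of a harmonic Riemannian submersion, then harmonicity says that the fibres are
   geodesics, and nabla_X V = sigma V x X for some function sigma. Put s = sigma + l/2. The
   commutators of the frame force s (s - l) = 0, s constant, and (l^2 - 4m) V to be a
   multiple of d/dz. Hence either V = +-d/dz; or l = m = 0, and V is a constant field of R^3; or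
   l^2 = 4m > 0, and then the metric is locally a round 3-sphere on which V is tangent to a
   left or a right Hopf fibration, i.e. V at P is B P with B a constant complex structure of
   R^4. In each case an isometry Phi takes V to a multiple of d/dz: the identity, a rotation,
   or stereographic projection followed by an adapted choice of axes. In the new coordinates
   the submersion only depends on (x, y), and factors through a local isometry from the base
   metric to N; it is inverted by the inverse function theorem, and transports the curvature
   4m. *)

(** * Differential calculus on R^n *)

(** For a Riemannian submersion nabla d pi vanishes on pairs of horizontal vectors, so the tension
    field is nabla d pi (V, V) = - d pi (nabla_V V); this is why harmonicity concerns the fibres
    alone. The inner products of horizontal gradients are constant along the fibres, so a geodesic V
    has skew covariant derivative; a skew endomorphism of a 3-space that kills V is a multiple of
    the cross product with V. This gives a closed first-order system for V and sigma, whose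
    integrability conditions come from the commutators of the frame: the curvature tensor of the BCV
    metric is never computed. The shift by l/2 is normalised so that V = d/dz has s = 0; when l <> 0
    the other root s = l can occur only if l^2 = 4m, and belongs to the opposite family of Hopf
    fibrations. All work takes place near one point and inside one chart of N, on balls where fields
    with zero derivative are constant. Each geometric identity is isolated as a pointwise algebraic
    one, in which derivatives are indeterminates bound by the relations that calculus provides. *)

Section Differentiability.
Context {R : realType} {V W : normedModType R}.
Implicit Types (f g : V -> W) (x v : V).

Lemma differentiable_near f x : differentiable f x ->
  forall e, 0 < e -> \forall h \near 0, `|f (h + x) - f x - 'd f x h| <= e * `|h|.
Proof.
move=> /diff_locallyP[_ /eqaddoP H] e e0; have := H e e0.
apply: filterS => h /=; by rewrite !fctE /= opprD addrA.
Qed.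

Lemma differentiable_epsP f x (L : {linear V -> W}) : continuous L ->
  (forall e, 0 < e -> \forall h \near 0, `|f (h + x) - f x - L h| <= e * `|h|) ->
  differentiable f x /\ 'd f x = L :> (V -> W).
Proof.
move=> Lc H.
have E : f \o shift x = cst (f x) + L +o_ 0 id.
  apply: eqaddoE; apply/eqaddoP => e e0; apply: filterS (H e e0) => h /=.
  by rewrite !fctE /= opprD addrA.
have dE := diff_unique Lc E.
split => //; apply/diff_locallyP; rewrite dE; split => //.
Qed.

Lemma near_differentiable f g x : (\near x, f x = g x) ->
  differentiable f x -> differentiable g x.
Proof.
move=> fg df.
suff [] : differentiable g x /\ 'd g x = 'd f x :> (V -> W) by [].
apply: differentiable_epsP; first exact: diff_continuous.
move=> e e0; have H := differentiable_near df e0.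
have H2 : \forall h \near 0, f (h + x) = g (h + x).
  by move: fg; rewrite (near_shift 0) /= ; apply: filterS => h /=; rewrite subr0.
near=> h; rewrite -(nbhs_singleton fg) -(near H2 h)//; exact: (near H h).
Unshelve. all: by end_near. Qed.

End Differentiability.

Lemma differentiable_id {R : realType} {V : normedModType R} (x : V) :
  differentiable (fun y : V => y) x.
Proof. exact: (@ex_diff _ _ _ _ _ _ _ (is_diff_id x)). Qed.

Section Smooth.
Context {R : realType} {n : nat}.
Implicit Types (U : set 'rV[R]_n) (x v : 'rV[R]_n).

Lemma near_of_open {T : Type} U (f g : 'rV[R]_n -> T) x : open U -> U x ->
  (forall y, U y -> f y = g y) -> \near x, f x = g x.
Proof. by move=> oU Ux fg; apply: filterS (open_nbhs_nbhs (conj oU Ux)). Qed.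

Lemma derive_basis {V : normedModType R} (f : 'rV[R]_n -> V) x v :
  differentiable f x -> 'D_v f x = \sum_i v 0 i *: 'D_(delta_mx 0 i) f x.
Proof.
move=> df; rewrite deriveE// {1}[v]row_sum_delta linear_sum.
by apply: eq_bigr => i _; rewrite linearZ deriveE.
Qed.

Lemma derive_pd (f : 'rV[R]_n -> R) x v :
  differentiable f x -> 'D_v f x = \sum_i v 0 i * pd i f x.
Proof. exact: derive_basis. Qed.

Lemma eq_Ck {V : normedModType R} k U (f g : 'rV[R]_n -> V) : open U ->
  (forall y, U y -> f y = g y) -> Ck k U f -> Ck k U g.
Proof.
move=> oU; elim: k f g => [|k IH] f g fg /=.
  move=> cf x Ux; rewrite /prop_for /continuous_at -(fg x Ux).
  have E := @near_eq_cvg _ _ (nbhs x) _ _ _ (near_of_open oU Ux fg).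
  exact: cvg_trans (E _) (cf x Ux).
move=> [df Df]; split=> [x Ux|i].
  by apply: near_differentiable (near_of_open oU Ux fg) (df x Ux).
apply: IH (Df i) => y Uy.
exact: near_eq_derive (near_of_open oU Uy fg).
Qed.

Lemma Ck_le {V : normedModType R} k U (f : 'rV[R]_n -> V) : Ck k.+1 U f -> Ck k U f.
Proof.
elim: k f => [|k IH] f /= [df Df].
  by move=> x Ux; apply: differentiable_continuous; exact: df.
by split=> // i; apply: IH; exact: Df.
Qed.

Lemma Ck_sub {V : normedModType R} k U U' (f : 'rV[R]_n -> V) : U' `<=` U ->
  Ck k U f -> Ck k U' f.
Proof.
move=> UU'; elim: k f => [|k IH] f /=; first by move=> H x /UU'/H.
by move=> [df Df]; split=> [x /UU'/df//|i]; exact: IH.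
Qed.

Lemma smooth_sub {V : normedModType R} U U' (f : 'rV[R]_n -> V) : U' `<=` U ->
  smooth U f -> smooth U' f.
Proof. by move=> UU' sf k; exact: Ck_sub (sf k). Qed.

Lemma eq_smooth {V : normedModType R} U (f g : 'rV[R]_n -> V) : open U ->
  (forall y, U y -> f y = g y) -> smooth U f -> smooth U g.
Proof. by move=> oU fg sf k; exact: eq_Ck (sf k). Qed.

Lemma smooth_differentiable {V : normedModType R} U (f : 'rV[R]_n -> V) x :
  smooth U f -> U x -> differentiable f x.
Proof. by move=> /(_ 1%N)[+ _]; apply. Qed.

Lemma smooth_derive {V : normedModType R} U (f : 'rV[R]_n -> V) i :
  smooth U f -> smooth U ('D_(delta_mx 0 i) f).
Proof. by move=> sf k; have [_] := sf k.+1; apply. Qed.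

Lemma smooth_pd U (f : 'rV[R]_n -> R) i : smooth U f -> smooth U (pd i f).
Proof. exact: smooth_derive. Qed.

(** For functions whose derivatives are expressed through the function itself, such as a reciprocal,
    a square root or an inverse map: regularity of order k of the function gives order k of its
    derivatives, hence order k + 1. *)
Lemma smooth_bootstrap {V : normedModType R} U (f : 'rV[R]_n -> V) :
  (forall x, U x -> differentiable f x) ->
  (forall k, Ck k U f -> forall i, Ck k U ('D_(delta_mx 0 i) f)) -> smooth U f.
Proof.
move=> df H; elim=> [|k IH] /=; last by split=> //; exact: H.
by move=> x Ux; apply: differentiable_continuous; exact: df.
Qed.

Lemma Ck_cst {V : normedModType R} k U (c : V) : Ck k U (fun=> c).
Proof.
elim: k c => [|k IH] c /=; first by move=> x _; exact: cst_continuous.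
split=> [x _|i]; first exact: differentiable_cst.
by rewrite (_ : 'D__ _ = fun=> 0)// funeqE => x; exact: derive_cst.
Qed.

Lemma CkD {V : normedModType R} k U (f g : 'rV[R]_n -> V) : open U ->
  Ck k U f -> Ck k U g -> Ck k U (fun x => f x + g x).
Proof.
move=> oU; elim: k f g => [|k IH] f g /=.
  move=> cf cg x Ux; have Hf : f @ nbhs x --> f x := cf x Ux.
  have Hg : g @ nbhs x --> g x := cg x Ux.
  exact: (cvgD Hf Hg).
move=> [df Df] [dg Dg]; split=> [x Ux|i].
  by apply: (differentiableD (df x Ux) (dg x Ux)).
apply: (eq_Ck oU) (IH _ _ (Df i) (Dg i)) => x Ux.
by rewrite [RHS](deriveD (f := f) (g := g)) //; apply: diff_derivable; [exact: df|exact: dg].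
Qed.

Lemma derive_scalel {V : normedModType R} (f : 'rV[R]_n -> R) (c : V) x v :
  differentiable f x -> 'D_v (fun y => f y *: c) x = 'D_v f x *: c.
Proof.
move=> df; rewrite !deriveE//; last exact: differentiableZl.
by rewrite diffZl.
Qed.

Lemma CkZl {V : normedModType R} k U (f : 'rV[R]_n -> R) (c : V) : open U ->
  Ck k U f -> Ck k U (fun x => f x *: c).
Proof.
move=> oU; elim: k f => [|k IH] f /=.
  move=> cf x Ux; have H : f @ nbhs x --> f x := cf x Ux.
  exact: (cvgZr_tmp H).
move=> [df Df]; split=> [x Ux|i]; first exact: differentiableZl (df x Ux).
by apply: (eq_Ck oU) (IH _ (Df i)) => x Ux; rewrite derive_scalel//; exact: df.
Qed.

Lemma Ck_sum {V : normedModType R} k U (I : Type) (r : seq I) (P : pred I)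
    (f : I -> 'rV[R]_n -> V) : open U ->
  (forall i, Ck k U (f i)) -> Ck k U (fun x => \sum_(i <- r | P i) f i x).
Proof.
move=> oU H; elim: r => [|i r IH].
  by apply: (eq_Ck oU) (Ck_cst k U 0) => x _; rewrite big_nil.
case Pi : (P i); last by apply: (eq_Ck oU) IH => x _; rewrite big_cons Pi.
by apply: (eq_Ck oU) (CkD oU (H i) IH) => x _; rewrite big_cons Pi.
Qed.

Lemma CkM k U (f g : 'rV[R]_n -> R) : open U ->
  Ck k U f -> Ck k U g -> Ck k U (fun x => f x * g x).
Proof.
move=> oU; elim: k f g => [|k IH] f g.
  move=> cf cg x Ux; have Hf : f @ nbhs x --> f x := cf x Ux.
  have Hg : g @ nbhs x --> g x := cg x Ux.
  exact: (cvgM Hf Hg).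
move=> Cf Cg; have [df Df] := Cf; have [dg Dg] := Cg; split=> [x Ux|i].
  by apply: (differentiableM (df x Ux) (dg x Ux)).
apply: (eq_Ck oU) (CkD oU (IH _ _ (Ck_le Cf) (Dg i)) (IH _ _ (Ck_le Cg) (Df i))) => x Ux.
by rewrite [RHS](deriveM (f := f) (g := g)) //; apply: diff_derivable; [exact: df|exact: dg].
Qed.

Lemma differentiable_entry {p q} (f : 'rV[R]_n -> 'M[R]_(p, q)) x i j :
  differentiable f x -> differentiable (fun x => f x i j) x.
Proof. by move=> df; exact: (differentiable_comp df (differentiable_coord _ i j)). Qed.

Lemma derive_entry {p q} (f : 'rV[R]_n -> 'M[R]_(p, q)) x v i j :
  differentiable f x -> 'D_v (fun x => f x i j) x = ('D_v f x) i j.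
Proof. by move=> df; rewrite derive_mx ?mxE//; exact: diff_derivable. Qed.

Lemma diff_entry {p q} (f : 'rV[R]_n -> 'M[R]_(p, q)) x v i j :
  differentiable f x -> ('d f x v) i j = \sum_a v 0 a * pd a (fun x => f x i j) x.
Proof.
move=> df; rewrite -deriveE// -derive_entry// derive_pd//.
exact: differentiable_entry.
Qed.

Lemma Ck_entry {p q} k U (f : 'rV[R]_n -> 'M[R]_(p, q)) i j : open U ->
  Ck k U f -> Ck k U (fun x => f x i j).
Proof.
move=> oU; elim: k f => [|k IH] f /=.
  by move=> cf x Ux; exact: (continuous_comp (cf x Ux) (@coord_continuous _ _ _ i j _)).
move=> [df Df]; split=> [x Ux|a]; first exact: differentiable_entry (df x Ux).
apply: (eq_Ck oU) (IH _ (Df a)) => x Ux.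
by rewrite derive_entry//; exact: df.
Qed.

Lemma Ck_mx {p q} k U (f : 'rV[R]_n -> 'M[R]_(p, q)) : open U ->
  (forall i j, Ck k U (fun x => f x i j)) -> Ck k U f.
Proof.
move=> oU H; have : Ck k U (fun x => \sum_i \sum_j f x i j *: delta_mx i j).
  by apply: Ck_sum => // i; apply: Ck_sum => // j; apply: CkZl.
by apply: eq_Ck => // x _; rewrite -matrix_sum_delta.
Qed.

Lemma smooth_entry {p q} U (f : 'rV[R]_n -> 'M[R]_(p, q)) i j : open U ->
  smooth U f -> smooth U (fun x => f x i j).
Proof. by move=> oU sf k; exact: Ck_entry. Qed.

Lemma smooth_mx {p q} U (f : 'rV[R]_n -> 'M[R]_(p, q)) : open U ->
  (forall i j, smooth U (fun x => f x i j)) -> smooth U f.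
Proof. by move=> oU sf k; apply: Ck_mx => // i j; exact: sf. Qed.

Lemma smooth_cst {V : normedModType R} U (c : V) : smooth U (fun=> c).
Proof. by move=> k; exact: Ck_cst. Qed.

Lemma smoothD U (f g : 'rV[R]_n -> R) : open U ->
  smooth U f -> smooth U g -> smooth U (fun x => f x + g x).
Proof. by move=> oU sf sg k; exact: CkD. Qed.

Lemma smoothM U (f g : 'rV[R]_n -> R) : open U ->
  smooth U f -> smooth U g -> smooth U (fun x => f x * g x).
Proof. by move=> oU sf sg k; exact: CkM. Qed.

Lemma smoothN U (f : 'rV[R]_n -> R) : open U ->
  smooth U f -> smooth U (fun x => - f x).
Proof.
move=> oU sf; apply: (@eq_smooth _ _ (fun x => -1 * f x)) => //.
  by move=> y _; rewrite mulN1r.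
by apply: smoothM => //; exact: smooth_cst.
Qed.

Lemma smoothB U (f g : 'rV[R]_n -> R) : open U ->
  smooth U f -> smooth U g -> smooth U (fun x => f x - g x).
Proof. by move=> oU sf sg; apply: smoothD => //; exact: smoothN. Qed.

Lemma smoothX U (f : 'rV[R]_n -> R) k : open U ->
  smooth U f -> smooth U (fun x => f x ^+ k).
Proof.
move=> oU sf; elim: k => [|k IH]; first exact: smooth_cst.
apply: (@eq_smooth _ _ (fun x => f x * f x ^+ k)) => //; last exact: smoothM.
by move=> y _; rewrite exprS.
Qed.

Lemma smooth_sum U (I : Type) (r : seq I) (P : pred I) (f : I -> 'rV[R]_n -> R) :
  open U -> (forall i, smooth U (f i)) ->
  smooth U (fun x => \sum_(i <- r | P i) f i x).
Proof. by move=> oU sf k; apply: Ck_sum => // i; exact: sf. Qed.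

Lemma smooth_prod U (I : Type) (r : seq I) (P : pred I) (f : I -> 'rV[R]_n -> R) :
  open U -> (forall i, smooth U (f i)) ->
  smooth U (fun x => \prod_(i <- r | P i) f i x).
Proof.
move=> oU sf; elim: r => [|i r IH].
  by apply: (eq_smooth oU) (smooth_cst U (1 : R)) => x _; rewrite big_nil.
case Pi : (P i); last by apply: (eq_smooth oU) IH => x _; rewrite big_cons Pi.
by apply: (eq_smooth oU) (smoothM oU (sf i) IH) => x _; rewrite big_cons Pi.
Qed.

Lemma is_derive_coord {p q} (M v : 'M[R]_(p, q)) i j :
  is_derive M v (fun y : 'M[R]_(p, q) => y i j) (v i j).
Proof.
have dc : differentiable (fun y : 'M[R]_(p, q) => y i j) M.
  exact: differentiable_coord.
apply: DeriveDef; first exact: diff_derivable.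
rewrite deriveE//.
have lc : linear (fun y : 'M[R]_(p, q) => y i j : R).
  by move=> a y z; rewrite !mxE.
pose h := GRing.isLinear.Build _ _ _ _ _ lc.
pose L : {linear 'M[R]_(p, q) -> R} := HB.pack (fun y : 'M[R]_(p, q) => y i j : R) h.
by rewrite (diff_lin (f := L)) //; exact: coord_continuous.
Qed.

Lemma smooth_coord U i : open U -> smooth U (fun x : 'rV[R]_n => x 0 i).
Proof.
move=> oU; apply: smooth_bootstrap => [x _|k _ j]; first exact: differentiable_coord.
apply: (eq_Ck oU) (Ck_cst k U (delta_mx 0 j 0 i : R)) => x _.
by have [_ ->] := is_derive_coord x (delta_mx 0 j) 0 i.
Qed.

Lemma smoothV U (f : 'rV[R]_n -> R) : open U -> (forall x, U x -> f x != 0) ->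
  smooth U f -> smooth U (fun x => (f x)^-1).
Proof.
move=> oU f0 sf; apply: smooth_bootstrap => [x Ux|k H i].
  by apply: differentiableV; [exact: smooth_differentiable sf Ux|exact: f0].
have H2 := CkM oU (CkM oU (CkM oU H H) (Ck_cst k U (-1 : R))) (smooth_pd i sf k).
apply: (eq_Ck oU) H2 => x Ux.
rewrite deriveV ?f0//; last exact: diff_derivable (smooth_differentiable sf Ux).
by rewrite /pd -expr2 exprVn mulrN1.
Qed.

Lemma smooth_div U (f g : 'rV[R]_n -> R) : open U -> (forall x, U x -> g x != 0) ->
  smooth U f -> smooth U g -> smooth U (fun x => f x / g x).
Proof. by move=> oU g0 sf sg; apply: smoothM => //; exact: smoothV. Qed.

Lemma derive_comp1 (g : R -> R) (f : 'rV[R]_n -> R) x v dg :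
  differentiable f x -> is_derive (f x) 1 g dg ->
  differentiable (fun y => g (f y)) x /\ 'D_v (fun y => g (f y)) x = dg * 'D_v f x.
Proof.
move=> df Hg; have dgd : differentiable g (f x).
  by apply/derivable1_diffP; exact: ex_derive.
have dgf : differentiable (fun y => g (f y)) x by exact: (differentiable_comp df dgd).
split => //; rewrite deriveE//.
have -> : 'd (fun y => g (f y)) x v = 'd g (f x) ('d f x v).
  by have := diff_comp df dgd; rewrite /comp => ->.
rewrite -(deriveE _ df) -['D_v f x]mulr1.
have -> : 'd g (f x) ('D_v f x *: 1) = 'D_v f x *: 'd g (f x) 1 by exact: linearZ.
by rewrite -(deriveE _ dgd) derive_val [LHS]mulrC mulr1.
Qed.

Lemma smooth_sqrt U (f : 'rV[R]_n -> R) : open U -> (forall x, U x -> 0 < f x) ->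
  smooth U f -> smooth U (fun x => Num.sqrt (f x)).
Proof.
move=> oU f0 sf.
have D x v : U x -> differentiable (fun y => Num.sqrt (f y)) x /\
   'D_v (fun y => Num.sqrt (f y)) x = (2 * Num.sqrt (f x))^-1 * 'D_v f x.
  move=> Ux; apply: derive_comp1; first exact: smooth_differentiable sf Ux.
  exact: is_derive1_sqrt (f0 x Ux).
apply: smooth_bootstrap => [x Ux|k H i]; first by have [] := D x 0 Ux.
(* The derivative 1 / (2 sqrt f) is rewritten as sqrt f / (2 f), so that the regularity already
   known for sqrt f can be used. *)
have E x : U x -> (2 * f x)^-1 * Num.sqrt (f x) * pd i f x =
     'D_(delta_mx 0 i) (fun y => Num.sqrt (f y)) x.
  move=> Ux; have [_ ->] := D x (delta_mx 0 i) Ux; congr (_ * _).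
  have s0 : 0 < Num.sqrt (f x) by rewrite sqrtr_gt0 f0.
  rewrite -{1}(@sqr_sqrtr _ (f x)) ?ltW ?f0//; field.
  by rewrite gt_eqF.
apply: (eq_Ck oU) E _; apply: CkM => //; last exact: smooth_pd.
apply: CkM => //; apply: smoothV => //.
  by move=> x Ux; rewrite mulf_neq0 ?pnatr_eq0// gt_eqF ?f0.
by apply: smoothM => //; exact: smooth_cst.
Qed.

Lemma smooth_atan U (f : 'rV[R]_n -> R) : open U ->
  smooth U f -> smooth U (fun x => atan (f x)).
Proof.
move=> oU sf.
have D x v : U x -> differentiable (fun y => atan (f y)) x /\
   'D_v (fun y => atan (f y)) x = (1 + f x ^+ 2)^-1 * 'D_v f x.
  move=> Ux; apply: derive_comp1; first exact: smooth_differentiable sf Ux.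
apply: smooth_bootstrap => [x Ux|k H i]; first by have [] := D x 0 Ux.
apply: (eq_Ck oU) (_ : Ck k U (fun x => (1 + f x ^+ 2)^-1 * pd i f x)).
  by move=> x Ux; have [_ ->] := D x (delta_mx 0 i) Ux.
apply: CkM => //; last exact: smooth_pd.
apply: smoothV => // [x _|]; first by rewrite gt_eqF// ltr_pwDl// sqr_ge0.
apply: smoothD => //; [exact: smooth_cst|exact: smoothX].
Qed.

Lemma smooth_cos_sin U (f : 'rV[R]_n -> R) : open U -> smooth U f ->
  smooth U (fun x => cos (f x)) /\ smooth U (fun x => sin (f x)).
Proof.
move=> oU sf.
have Dc x v : U x -> differentiable (fun y => cos (f y)) x /\
   'D_v (fun y => cos (f y)) x = - sin (f x) * 'D_v f x.
  by move=> Ux; apply: derive_comp1; first exact: smooth_differentiable sf Ux.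
have Ds x v : U x -> differentiable (fun y => sin (f y)) x /\
   'D_v (fun y => sin (f y)) x = cos (f x) * 'D_v f x.
  by move=> Ux; apply: derive_comp1; first exact: smooth_differentiable sf Ux.
(* Cosine and sine are each other's derivatives up to sign, so the induction treats both at once. *)
suff H k : Ck k U (fun x => cos (f x)) /\ Ck k U (fun x => sin (f x)).
  by split=> k; have [] := H k.
elim: k => [|k [IHc IHs]].
  split=> x Ux; apply: differentiable_continuous.
    by have [] := Dc x 0 Ux.
  by have [] := Ds x 0 Ux.
split; split => [x Ux|i].
- by have [] := Dc x 0 Ux.
- have H := CkM oU (CkM oU (Ck_cst k U (-1 : R)) IHs) (smooth_pd i sf k).
  apply: (eq_Ck oU) H => x Ux; have [_ ->] := Dc x (delta_mx 0 i) Ux.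
  by rewrite mulN1r.
- by have [] := Ds x 0 Ux.
- have H := CkM oU IHc (smooth_pd i sf k).
  by apply: (eq_Ck oU) H => x Ux; have [_ ->] := Ds x (delta_mx 0 i) Ux.
Qed.

End Smooth.

Section Composition.
Context {R : realType} {n k : nat}.
Implicit Types (F : 'rV[R]_n -> 'rV[R]_k) (x v : 'rV[R]_n).

Lemma derive_compose {V : normedModType R} F (g : 'rV[R]_k -> V) x v :
  differentiable F x -> differentiable g (F x) ->
  differentiable (fun y => g (F y)) x /\
  'D_v (fun y => g (F y)) x = 'd g (F x) ('d F x v).
Proof.
move=> dF dg; have dgF : differentiable (fun y => g (F y)) x.
  exact: (differentiable_comp dF dg).
split => //; rewrite deriveE//.
by have := diff_comp dF dg; rewrite /comp => ->.
Qed.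

Lemma pd_compose F (g : 'rV[R]_k -> R) x i :
  differentiable F x -> differentiable g (F x) ->
  pd i (fun y => g (F y)) x = \sum_a pd a g (F x) * pd i (fun y => F y 0 a) x.
Proof.
move=> dF dg; have [_] := derive_compose (delta_mx 0 i) dF dg.
rewrite /pd => ->; rewrite -deriveE// derive_pd//.
by apply: eq_bigr => a _; rewrite mulrC -deriveE// derive_entry.
Qed.

Lemma Ck_compose j U W F (g : 'rV[R]_k -> R) : open U ->
  (forall x, U x -> W (F x)) -> Ck j U F -> Ck j W g -> Ck j U (fun x => g (F x)).
Proof.
move=> oU FW; elim: j g => [|j IH] g CF Cg.
  by move=> x Ux; exact: continuous_comp (CF x Ux) (Cg _ (FW x Ux)).
have [dF _] := CF; have [dg Dg] := Cg; split=> [x Ux|i].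
  by have [] := derive_compose 0 (dF x Ux) (dg _ (FW x Ux)).
apply: (eq_Ck oU)
  (_ : Ck j U (fun x => \sum_a pd a g (F x) * pd i (fun y => F y 0 a) x)).
  move=> x Ux; rewrite -pd_compose//; last exact: dg _ (FW x Ux).
  exact: dF.
apply: Ck_sum => // a; apply: CkM => //; first by apply: IH (Ck_le CF) (Dg a).
by have [_ +] := Ck_entry 0 a oU CF; apply.
Qed.

Lemma smooth_compose U W F (g : 'rV[R]_k -> R) : open U ->
  (forall x, U x -> W (F x)) -> smooth U F -> smooth W g ->
  smooth U (fun x => g (F x)).
Proof. by move=> oU FW sF sg j; exact: Ck_compose FW (sF j) (sg j). Qed.

End Composition.

Lemma smooth_compose_mx {R : realType} {n k p q : nat} (U : set 'rV[R]_n)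
    (W : set 'rV[R]_k) (F : 'rV[R]_n -> 'rV[R]_k) (g : 'rV[R]_k -> 'M[R]_(p, q)) :
  open U -> open W -> (forall x, U x -> W (F x)) -> smooth U F -> smooth W g ->
  smooth U (fun x => g (F x)).
Proof.
move=> oU oW FW sF sg; apply: smooth_mx => // i j.
apply: (smooth_compose (g := fun y => g y i j)) FW sF _ => //.
exact: smooth_entry.
Qed.

Section MeanValue.
Context {R : realType} {n : nat}.
Implicit Types (f : 'rV[R]_n -> R) (x v : 'rV[R]_n).

Lemma le_mx_norm {p q} (M : 'M[R]_(p, q)) e : 0 <= e ->
  (forall i j, `|M i j| <= e) -> `|M| <= e.
Proof.
move=> e0 H; rewrite [leLHS]/Num.Def.normr/= mx_normrE.
by apply: bigmax_le => // -[i j] _; exact: H.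
Qed.

Lemma mx_entry_le {p q} (M : 'M[R]_(p, q)) i j : `|M i j| <= `|M|.
Proof.
rewrite [leRHS]/Num.Def.normr/= mx_normrE.
exact: (le_bigmax _ (fun ij : 'I_p * 'I_q => `|M ij.1 ij.2|) (i, j)).
Qed.

Lemma is_derive_line f x v (t : R) : differentiable f (x + t *: v) ->
  is_derive t 1 (fun s : R => f (x + s *: v)) ('D_v f (x + t *: v)).
Proof.
move=> df; pose L (s : R) : 'rV[R]_n := x + s *: v.
have dL : differentiable L t.
  apply: differentiableD; first exact: differentiable_cst.
  exact: (differentiableZl v (@differentiable_id _ _ t)).
have dLt : 'd L t 1 = v.
  rewrite -deriveE// /L deriveD//.
    rewrite derive_cst add0r deriveE; last first.
      exact: (differentiableZl v (@differentiable_id _ _ t)).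
    by rewrite diffZl//= diff_val scale1r.
  exact/diff_derivable/(differentiableZl v (@differentiable_id _ _ t)).
have dfL : differentiable (f \o L) t by exact: differentiable_comp.
apply: DeriveDef; first exact: diff_derivable.
by rewrite (deriveE (f := f \o L))// diff_comp//= dLt -deriveE.
Qed.

Lemma mean_value_line f x v :
  (forall t : R, 0 <= t <= 1 -> differentiable f (x + t *: v)) ->
  exists2 c, 0 < c < 1 & f (x + v) - f x = 'D_v f (x + c *: v).
Proof.
move=> df.
have H (t : R) : t \in `]0, 1[%R ->
    is_derive t 1 (fun s : R => f (x + s *: v)) ('D_v f (x + t *: v)).
  by rewrite in_itv/= => /andP[t0 t1]; apply/is_derive_line/df; rewrite !ltW.
have [|c] := MVT (@ltr01 R) H.
  apply: derivable_within_continuous => t; rewrite in_itv/= => t01.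
  by apply: ex_derive; exact: is_derive_line (df t t01).
rewrite in_itv/= => c01 E; exists c => //.
by move: E; rewrite scale1r scale0r addr0 subr0 mulr1.
Qed.

Lemma constant_on_line f x v :
  (forall t : R, 0 <= t <= 1 -> differentiable f (x + t *: v)) ->
  (forall t : R, 0 <= t <= 1 -> 'D_v f (x + t *: v) = 0) -> f (x + v) = f x.
Proof.
move=> df D0; have [c /andP[c0 c1] E] := mean_value_line df.
by apply/subr0_eq; rewrite E D0// !ltW.
Qed.

Lemma convex_ball (p x y : 'rV[R]_n) r t : 0 <= t <= 1 -> ball p r x -> ball p r y ->
  ball p r (x + t *: (y - x)).
Proof.
rewrite -!ball_normE /= => /andP[t0 t1] px py.
have -> : p - (x + t *: (y - x)) = (1 - t) *: (p - x) + t *: (p - y).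
  by apply/rowP => i; rewrite !mxE; ring.
apply: le_lt_trans (ler_normD _ _) _; rewrite !normrZ (ger0_norm t0) ger0_norm ?subr_ge0//.
have [->|t0'] := eqVneq t 0; first by rewrite mul0r addr0 subr0 mul1r.
have : t * `|p - y| < t * r by rewrite ltr_pM2l// lt_def t0' t0.
have : (1 - t) * `|p - x| <= (1 - t) * r by rewrite ler_wpM2l ?subr_ge0// ltW.
lra.
Qed.

Lemma constant_on_ball f (p : 'rV[R]_n) r y : ball p r y ->
  (forall x, ball p r x -> differentiable f x /\ forall i, pd i f x = 0) -> f y = f p.
Proof.
move=> py H; have r0 : 0 < r.
  by move: py; rewrite -ball_normE /=; apply: le_lt_trans.
have B (t : R) : 0 <= t <= 1 -> ball p r (p + t *: (y - p)).
  by move=> t01; apply: convex_ball => //; exact: ballxx.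
rewrite -{1}[y](subrK p) addrC; apply: constant_on_line => t /B/H[df pd0] //.
by rewrite derive_pd// big1// => i _; rewrite pd0 mulr0.
Qed.

Lemma normr_delta_mx_le i : `|delta_mx 0 i : 'rV[R]_n| <= 1.
Proof.
by apply: le_mx_norm => // a b; rewrite mxE; case: (_ && _); rewrite ?normr1 ?normr0.
Qed.

(** The mean value theorem is applied along e_i to y -> f (y + d e_j) - f y, then along e_j to
    [pd i f]. The factor 2 in the bound accounts for the two displacements of length at most d. *)
Lemma second_difference f U x d i j : smooth U f -> open U -> 0 < d ->
  (forall y, `|x - y| <= 2 * d -> U y) ->
  exists2 y, `|x - y| <= 2 * d &
    f (x + d *: delta_mx 0 i + d *: delta_mx 0 j) - f (x + d *: delta_mx 0 i)
    - (f (x + d *: delta_mx 0 j) - f x) = d ^+ 2 * pd j (pd i f) y.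
Proof.
move=> sf oU d0 BU; set ei := delta_mx 0 i; set ej := delta_mx 0 j.
have bnd (s t : R) : 0 <= s <= 1 -> 0 <= t <= 1 ->
    `|x - (x + s *: (d *: ei) + t *: (d *: ej))| <= 2 * d.
  move=> /andP[s0 s1] /andP[t0 t1].
  rewrite -addrA opprD addrA subrr sub0r normrN.
  apply: le_trans (ler_normD _ _) _; rewrite !normrZ !ger0_norm// ?(ltW d0)//.
  have ? : s * (d * `|ei|) <= d.
    rewrite -[leRHS]mul1r; apply: ler_pM => //; first by rewrite mulr_ge0 // ltW.
    by rewrite -[leRHS]mulr1 ler_wpM2l ?(ltW d0)// normr_delta_mx_le.
  have ? : t * (d * `|ej|) <= d.
    rewrite -[leRHS]mul1r; apply: ler_pM => //; first by rewrite mulr_ge0 // ltW.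
    by rewrite -[leRHS]mulr1 ler_wpM2l ?(ltW d0)// normr_delta_mx_le.
  lra.
have z01 : 0 <= (0 : R) <= 1 by rewrite lexx ler01.
have o01 : 0 <= (1 : R) <= 1 by rewrite lexx ler01.
pose F y := f (y + d *: ej) - f y.
have dF (s : R) : 0 <= s <= 1 -> [/\ differentiable f (x + s *: (d *: ei) + d *: ej),
     differentiable f (x + s *: (d *: ei)),
     differentiable (fun y => f (y + d *: ej)) (x + s *: (d *: ei)) &
     'D_ei (fun y => f (y + d *: ej)) (x + s *: (d *: ei)) =
      'D_ei f (x + s *: (d *: ei) + d *: ej)].
  move=> s01; have Ux1 : U (x + s *: (d *: ei) + d *: ej).
    by apply: BU; have := bnd _ _ s01 o01; rewrite scale1r.
  have Ux0 : U (x + s *: (d *: ei)).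
    by apply: BU; have := bnd _ _ s01 z01; rewrite scale0r addr0.
  have d1 := smooth_differentiable sf Ux1; have d2 := smooth_differentiable sf Ux0.
  have dsh : differentiable (fun y : 'rV[R]_n => y + d *: ej) (x + s *: (d *: ei)).
    by apply: differentiableD; [exact: differentiable_id|exact: differentiable_cst].
  have [d3 E] := derive_compose ei dsh d1.
  have E2 : 'D_ei (fun y : 'rV[R]_n => y + d *: ej) (x + s *: (d *: ei)) = ei.
    rewrite deriveD; [|exact: derivable_id|exact: derivable_cst].
    by rewrite derive_cst addr0 derive_id.
  by split => //; rewrite E -(deriveE _ dsh) E2 -(deriveE _ d1).
have DF (s : R) : 0 <= s <= 1 -> differentiable F (x + s *: (d *: ei)) /\
    'D_(d *: ei) F (x + s *: (d *: ei)) =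
      d * (pd i f (x + s *: (d *: ei) + d *: ej) - pd i f (x + s *: (d *: ei))).
  move=> /dF[d1 d2 d3 E].
  have dFs : differentiable F (x + s *: (d *: ei)) by exact: differentiableB d3 d2.
  split => //; rewrite (deriveE _ dFs) linearZ -(deriveE _ dFs) /=; congr (_ *: _).
  rewrite /F deriveB; [|exact: diff_derivable|exact: diff_derivable].
  by rewrite E.
have [|c /andP[c0 c1] E] := @mean_value_line F x (d *: ei).
  by move=> t t01; have [] := DF t t01.
have c01 : 0 <= c <= 1 by rewrite !ltW.
have [_ E2] := DF c c01.
have [|c' /andP[c'0 c'1] E3] := @mean_value_line (pd i f) (x + c *: (d *: ei)) (d *: ej).
  move=> t t01; apply: smooth_differentiable (smooth_pd i sf) _.
  exact/BU/bnd.
have c'01 : 0 <= c' <= 1 by rewrite !ltW.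
exists (x + c *: (d *: ei) + c' *: (d *: ej)); first exact: bnd.
rewrite -/(F _) -/(F _) E E2 E3 deriveE; last first.
  by apply: smooth_differentiable (smooth_pd i sf) _; exact/BU/bnd.
rewrite linearZ -deriveE; last first.
  by apply: smooth_differentiable (smooth_pd i sf) _; exact/BU/bnd.
by rewrite /= expr2 -mulrA.
Qed.

(** The second difference is symmetric in i and j, so each mixed derivative takes one common value
    at some point close to x; continuity of both at x concludes. *)
Lemma pd_comm U f x i j : open U -> U x -> smooth U f ->
  pd i (pd j f) x = pd j (pd i f) x.
Proof.
move=> oU Ux sf; apply/eqP; rewrite -subr_eq0 -normr_le0; apply/ler_addgt0Pr => e e0.
rewrite add0r; have e20 : 0 < e / 2 by rewrite divr_gt0.
have C a b : \forall y \near x, `|pd a (pd b f) x - pd a (pd b f) y| < e / 2.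
  have dd : differentiable (pd a (pd b f)) x.
    by apply: smooth_differentiable Ux; do 2 apply: smooth_pd.
  have := differentiable_continuous dd.
  by move=> /cvgrPdist_lt/(_ _ e20).
have nU : nbhs x U by exact: open_nbhs_nbhs.
have [r /= r0 rB] := (nbhs_ballP _ _).1 (filterI nU (filterI (C i j) (C j i))).
have r40 : 0 < r / 4 by rewrite divr_gt0.
have B y : `|x - y| <= 2 * (r / 4) -> ball x r y.
  by move=> H; rewrite -ball_normE /=; apply: le_lt_trans H _; move: (r0); lra.
have BU y : `|x - y| <= 2 * (r / 4) -> U y by move=> /B/rB[].
have [y /B/rB[_ [_ yj]] Ey] := second_difference i j sf oU r40 BU.
have [z /B/rB[_ [zi _]] Ez] := second_difference j i sf oU r40 BU.
have E : pd j (pd i f) y = pd i (pd j f) z.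
  have r2 : (r / 4) ^+ 2 != 0 by rewrite expf_neq0// gt_eqF.
  apply: (mulfI r2); apply: (eq_trans (esym Ey)); apply: (eq_trans _ Ez).
  rewrite (addrAC x (_ *: delta_mx 0 j)).
  by move: (f _) (f _) (f _) (f _) => a b c d; ring.
move: yj zi; rewrite -E.
move: (pd j (pd i f) y) (pd i (pd j f) x) (pd j (pd i f) x) => c a b bc ac.
apply: le_trans (ler_distD c a b) _; rewrite [leRHS]splitr.
by apply/ltW/ltrD; [exact: ac|rewrite distrC; exact: bc].
Qed.

End MeanValue.

(** * The inverse function theorem *)

Section InverseFunction.
Context {R : realType} {n : nat}.
Implicit Types (F : 'rV[R]_n -> 'rV[R]_n) (x v : 'rV[R]_n).

Definition jac {k} (F : 'rV[R]_n -> 'rV[R]_k) x : 'M[R]_(n, k) :=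
  \matrix_(i, j) pd i (fun y => F y 0 j) x.

Lemma diff_jac {k} (F : 'rV[R]_n -> 'rV[R]_k) x v :
  differentiable F x -> 'd F x v = v *m jac F x.
Proof.
move=> dF; apply/rowP => j; rewrite diff_entry// mxE.
by apply: eq_bigr => i _; rewrite mxE.
Qed.

Lemma mulmx_norm_bound p q (A : 'M[R]_(p, q)) :
  exists2 C, 0 < C & forall w : 'rV[R]_p, `|w *m A| <= C * `|w|.
Proof.
have S0 : 0 <= \sum_i \sum_j `|A i j| by apply: sumr_ge0 => i _; apply: sumr_ge0.
exists (1 + \sum_i \sum_j `|A i j|); first by rewrite ltr_pwDl.
move=> w; apply: le_mx_norm => [|i j]; first by rewrite mulr_ge0// addr_ge0.
rewrite ord1 mxE; apply: le_trans (ler_norm_sum _ _ _) _.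
apply: (@le_trans _ _ (\sum_i `|w| * `|A i j|)).
  by apply: ler_sum => k _; rewrite normrM ler_wpM2r// mx_entry_le.
rewrite -mulr_sumr mulrC ler_wpM2r//.
rewrite -[leLHS]add0r lerD//; apply: ler_sum => k _.
by rewrite (bigD1 j)//= lerDl sumr_ge0.
Qed.

Lemma mulmxr_continuous p q (A : 'M[R]_(p, q)) :
  continuous (mulmxr A : 'rV[R]_p -> 'rV[R]_q).
Proof.
apply: bounded_linear_continuous; have [C C0 HC] := mulmx_norm_bound A.
apply/linear_boundedP; exists C; split; first by rewrite gtr0_real.
by move=> r Cr x /=; apply: le_trans (HC x) _; rewrite ler_wpM2r// ltW.
Qed.

Lemma smooth_det {m} (U : set 'rV[R]_n) (M : 'rV[R]_n -> 'M[R]_m) : open U ->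
  (forall i j, smooth U (fun x => M x i j)) -> smooth U (fun x => \det (M x)).
Proof.
move=> oU sM; apply: smooth_sum => // s; apply: smoothM => //; first exact: smooth_cst.
by apply: smooth_prod => // i.
Qed.

Lemma smooth_invmx {m} (U : set 'rV[R]_n) (M : 'rV[R]_n -> 'M[R]_m) : open U ->
  (forall x, U x -> \det (M x) != 0) ->
  (forall i j, smooth U (fun x => M x i j)) ->
  forall i j, smooth U (fun x => invmx (M x) i j).
Proof.
move=> oU d0 sM i j.
apply: (eq_smooth (f := fun x => (\det (M x))^-1 * ((-1) ^+ (j + i) *
  \det (row' j (col' i (M x)))))) => //.
  by move=> x Ux; rewrite /invmx unitmxE unitfE d0// !mxE.
apply: smoothM => //; first by apply: smoothV => //; exact: smooth_det.
apply: smoothM => //; first exact: smooth_cst.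
apply: smooth_det => // a b.
apply: eq_smooth (sM (lift j a) (lift i b)) => // x _.
by rewrite !mxE.
Qed.

Lemma smooth_jac {k} (U : set 'rV[R]_n) (F : 'rV[R]_n -> 'rV[R]_k) i j : open U ->
  smooth U F -> smooth U (fun x => jac F x i j).
Proof.
move=> oU sF; apply: eq_smooth (smooth_pd i (smooth_entry 0 j oU sF)) => // x _.
by rewrite mxE.
Qed.

(* On a small ball [F] is a perturbation, with Lipschitz constant 1/2, of the
   linear map [jac F p]. *)
Lemma lipschitz_perturbation U F p : open U -> U p -> smooth U F ->
  \det (jac F p) != 0 ->
  exists2 r, 0 < r & [/\ forall x, ball p r x -> U x,
    forall x, ball p r x -> \det (jac F x) != 0 &
    forall x y, ball p r x -> ball p r y ->
     `|(y - F y *m invmx (jac F p)) - (x - F x *m invmx (jac F p))|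
       <= 2^-1 * `|y - x|].
Proof.
move=> oU Up sF dJ; set A := invmx (jac F p).
pose H c (x : 'rV[R]_n) : R := x 0 c - \sum_k F x 0 k * A k c.
have sH c : smooth U (H c).
  apply: smoothB => //; first exact: smooth_coord.
  apply: smooth_sum => // k; apply: smoothM => //; last exact: smooth_cst.
  exact: smooth_entry.
have pdH i c x : U x -> pd i (H c) x = (1%:M - jac F x *m A) i c.
  move=> Ux; have dF k : differentiable (fun x => F x 0 k) x.
    by apply: differentiable_entry; exact: smooth_differentiable sF Ux.
  have dFA k : differentiable (fun x => F x 0 k * A k c) x.
    by apply: (differentiableM (dF k)); exact: differentiable_cst.
  rewrite /pd /H.
  have -> : (fun x => x 0 c - \sum_k F x 0 k * A k c) =
    (fun x : 'rV[R]_n => x 0 c) - \sum_k (fun x => F x 0 k * A k c).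
    by apply/funext => y; rewrite fctE fct_sumE.
  rewrite deriveB; last 2 first.
  - by have [] := is_derive_coord x (delta_mx 0 i) 0 c.
  - by apply: derivable_sum => k; exact: diff_derivable.
  rewrite derive_sum; last by move=> k; exact: diff_derivable.
  have [_ ->] := is_derive_coord x (delta_mx 0 i) 0 c.
  rewrite !mxE eqxx /= eq_sym; congr (_ - _).
  apply: eq_bigr => k _; rewrite mxE (deriveM (f := fun x => F x 0 k)); last 2 first.
  - exact: diff_derivable.
  - exact: derivable_cst.
  by rewrite derive_cst scaler0 add0r [LHS]mulrC.
(* In the sup norm, n partial derivatives bounded by q give the Lipschitz constant n q <= 1/2;
   [n.+1] keeps the denominator nonzero when n = 0. *)
pose q : R := (2 * n.+1%:R)^-1.
have q0 : 0 < q by rewrite invr_gt0 mulr_gt0// ltr0n.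
have nearC i c : \forall x \near p, `|pd i (H c) x| <= q.
  have := differentiable_continuous (smooth_differentiable (smooth_pd i (sH c)) Up).
  move=> /cvgrPdist_le/(_ _ q0); apply: filterS => x.
  rewrite (pdH i c p Up) mulmxV ?unitmxE ?unitfE//.
  by rewrite subrr mxE sub0r normrN.
have nearD : \forall x \near p, \det (jac F x) != 0.
  have sd : smooth U (fun x => \det (jac F x)).
    by apply: smooth_det => // i j; exact: smooth_jac.
  have := differentiable_continuous (smooth_differentiable sd Up).
  move=> /cvgrPdist_lt/(_ `|\det (jac F p)|); rewrite normr_gt0 => /(_ dJ).
  apply: filterS => x; apply: contraTneq => ->.
  by rewrite subr0 ltxx.
have : \forall x \near p, [/\ U x, \det (jac F x) != 0 &
    forall i c, `|pd i (H c) x| <= q].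
  near=> x; split.
  - by near: x; exact: open_nbhs_nbhs.
  - by near: x.
  - move=> i c; move: i c; near: x; apply: filter_forall => i.
    by apply: filter_forall => c; exact: nearC.
move=> /nbhs_ballP[r /= r0 rB]; exists r => //; split.
- by move=> x /rB[].
- by move=> x /rB[].
move=> x y px py; apply: le_mx_norm; first by rewrite mulr_ge0.
move=> i c; rewrite ord1 {i}.
have -> : (y - F y *m A - (x - F x *m A)) 0 c = H c (x + (y - x)) - H c x.
  have -> : x + (y - x) = y by rewrite addrC subrK.
  by rewrite /H !mxE; congr (_ - _ - (_ - _)).
have B (t : R) : 0 <= t <= 1 -> ball p r (x + t *: (y - x)).
  by move=> t01; exact: convex_ball.
have [|t /andP[t0 t1] ->] := @mean_value_line _ _ (H c) x (y - x).
  by move=> t /B/rB[Ux _ _]; exact: smooth_differentiable (sH c) Ux.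
have /rB[Ut _ Bt] : ball p r (x + t *: (y - x)) by apply: B; rewrite !ltW.
rewrite derive_pd; last exact: smooth_differentiable (sH c) Ut.
apply: le_trans (ler_norm_sum _ _ _) _.
apply: (@le_trans _ _ (\sum_(i < n) `|y - x| * q)).
  by apply: ler_sum => i _; rewrite normrM ler_pM// mx_entry_le.
rewrite sumr_const card_ord -[leLHS]mulr_natr.
have -> : `|y - x| * q * n%:R = 2^-1 * `|y - x| * (n%:R / n.+1%:R).
  have : n.+1%:R != 0 :> R by rewrite pnatr_eq0.
  by rewrite /q; move: (n.+1%:R) (n%:R) => a b a0; field.
rewrite -[leRHS]mulr1 ler_wpM2l ?mulr_ge0 ?invr_ge0//.
by rewrite ler_pdivrMr ?ltr0n// mul1r ler_nat.
Unshelve. all: by end_near. Qed.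

(** On the ball of [lipschitz_perturbation], [F] is injective with a Lipschitz inverse, its image is
    open by the contraction principle, and the derivative of the inverse is the inverse Jacobian at
    the preimage. Smoothness of the inverse then follows by bootstrapping. *)
Theorem inverse_function U F p : open U -> U p -> smooth U F ->
  \det (jac F p) != 0 ->
  exists D, [/\ open D, D p, D `<=` U, open (F @` D) &
    exists G, smooth (F @` D) G /\ forall x, D x -> G (F x) = x].
Proof.
move=> oU Up sF dJ.
have [r r0 [rU rJ rL]] := lipschitz_perturbation oU Up sF dJ.
set A := invmx (jac F p) in rL.
have [C C0 HC] := mulmx_norm_bound A.
pose B := ball p r.
(* |y - x| is at most |y - x| / 2 plus C |F y - F x|: the inverse will be Lipschitz with constant 2
   C. *)
have FB x y : B x -> B y -> `|y - x| <= 2 * C * `|F y - F x|.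
  move=> Bx By; have := rL x y Bx By.
  have -> : y - F y *m A - (x - F x *m A) = (y - x) - (F y - F x) *m A.
    rewrite mulmxBl; move: (F y *m A) (F x *m A) => a b.
    by apply/rowP => i; rewrite !mxE; ring.
  move=> H; have := HC (F y - F x).
  have : `|y - x| <= `|y - x - (F y - F x) *m A| + `|(F y - F x) *m A|.
    by rewrite -{1}[y - x](subrK ((F y - F x) *m A)) ler_normD.
  have K (a b c k : R) : a <= b + c -> b <= 2^-1 * a -> c <= k -> a <= 2 * k by lra.
  by move=> H1 H2; rewrite -mulrA; exact: K H1 H H2.
have Finj x y : B x -> B y -> F x = F y -> x = y.
  move=> Bx By E; apply/eqP; rewrite eq_sym -subr_eq0 -normr_le0.
  by have := FB x y Bx By; rewrite E subrr normr0 mulr0.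
have oFB : open (F @` B).
  rewrite openE => _ [x0 Bx0 <-]; rewrite /interior.
  have /nbhs_ballP[e /= e0 eB] : nbhs x0 B by apply: open_nbhs_nbhs; split => //; exact: ball_open.
  pose rho := e / 2; have rho0 : 0 < rho by rewrite divr_gt0.
  have cB x : `|x0 - x| <= rho -> B x.
    move=> H; apply: eB; rewrite -ball_normE /=; apply: le_lt_trans H _.
    by rewrite /rho ltr_pdivrMr// ltr_pMr// ltr1n.
  apply/nbhs_ballP; exists (rho / (2 * C)); first by rewrite /= divr_gt0// mulr_gt0.
  move=> y; rewrite -ball_normE /= => yx.
  pose S := [set x | `|x0 - x| <= rho].
  (* Newton iteration with the Jacobian frozen at p. Its fixed points solve F x = y because [A] is
     invertible; the radius rho / (2 C) for y makes [T] preserve the closed ball [S]. *)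
  pose T x := x - F x *m A + y *m A.
  have TS : set_fun S S T.
    move=> x Sx; rewrite /S /=.
    have := rL x x0 (cB _ Sx) Bx0; have := HC (F x0 - y).
    have -> : x0 - T x = (x0 - F x0 *m A - (x - F x *m A)) + (F x0 - y) *m A.
      by apply/rowP => i; rewrite /T mulmxBl !mxE; move: (\sum__ _) (\sum__ _) (\sum__ _) => *; ring.
    move=> H1 H2; apply: le_trans (ler_normD _ _) _.
    move: Sx yx; rewrite /S /= ltr_pdivlMr ?mulr_gt0// => Sx yx.
    have K (a b c d k k' : R) : b <= 2^-1 * a -> c <= C * d -> d * (2 * C) < k -> a <= k ->
      b + c <= k by lra.
    exact: K H2 H1 yx Sx.
  pose T' : {fun S >-> S} := HB.pack T (isFun.Build _ _ S S T TS).
  have ctr : is_contraction T'.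
    exists (2^-1)%:nng; split; first by rewrite /= invf_lt1// ltr1n.
    move=> [u v] [/= Su Sv]; have := rL v u (cB _ Sv) (cB _ Su).
    have -> // : T u - T v = u - F u *m A - (v - F v *m A).
    rewrite /T; move: (F u *m A) (F v *m A) (y *m A) => a b c.
    by apply/rowP => i; rewrite !mxE; ring.
  have cS : closed S.
    have -> : S = closed_ball x0 rho by rewrite closed_ballE.
    exact: closed_ball_closed.
  pose X : completeNormedModType R := HB.pack 'rV[R]_n.
  have [|x Sx xE] := @banach_fixed_point R X S T' ctr cS.
    by exists x0; rewrite /S /= subrr normr0 ltW.
  exists x; first exact: cB.
  have : (y - F x) *m A *m jac F p = 0.
    have -> : (y - F x) *m A = T x - x.
      rewrite /T mulmxBl; move: (F x *m A) (y *m A) => a b.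
      by apply/rowP => i; rewrite !mxE; ring.
    by have -> : T x = x by []; rewrite subrr mul0mx.
  rewrite -mulmxA mulVmx ?unitmxE ?unitfE// mulmx1 => /eqP.
  by rewrite subr_eq0 => /eqP.
(* [p] is only the default value outside the image of the ball. *)
pose G y := xget p [set x | B x /\ F x = y].
have GF x : B x -> G (F x) = x.
  move=> Bx; rewrite /G; case: xgetP => [z _ [Bz E]|/(_ x)]; first exact: Finj E.
  by case; split.
have Bp : B p by exact: ballxx.
have dG x : B x -> differentiable G (F x) /\
    'd G (F x) = mulmxr (invmx (jac F x)) :> ('rV[R]_n -> 'rV[R]_n).
  move=> Bx; set A0 := invmx _; apply: differentiable_epsP.
    exact: mulmxr_continuous.
  move=> e e0; have [C1 C10 HC1] := mulmx_norm_bound A0.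
  (* C1 bounds the inverse Jacobian at x, and 2 C is the Lipschitz constant of [G]; the two factors
     reappear when the error of [F] is converted into that of [G]. *)
  have e'0 : 0 < e / (C1 * (2 * C)) by rewrite divr_gt0// !mulr_gt0.
  have dF := smooth_differentiable sF (rU x Bx).
  have /nbhs_ballP[d /= d0 dE] := differentiable_near dF e'0.
  have d'0 : 0 < d / (2 * C) by rewrite divr_gt0// mulr_gt0.
  have nFB : \forall h \near (0 : 'rV[R]_n), (F @` B) (h + F x).
    have : \forall y \near F x, (F @` B) y.
      by apply: open_nbhs_nbhs; split => //; exists x.
    by rewrite (near_shift 0) /=; apply: filterS => h; rewrite /= subr0.
  have nd : \forall h \near (0 : 'rV[R]_n), `|h| < d / (2 * C).
    exact: nbhs0_lt.
  near=> h; have [|z Bz zE] := near nFB h; first by [].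
  have hd : `|h| < d / (2 * C) by near: h; exact: nd.
  have hE : h = F z - F x by rewrite zE addrK.
  have zx := FB x z Bx Bz.
  rewrite -zE GF// GF// hE.
  have zd : `|z - x| < d.
    apply: le_lt_trans zx _; rewrite -hE mulrC -ltr_pdivlMr// mulr_gt0//.
  have := dE (z - x); rewrite -ball_normE /= sub0r normrN subrK => /(_ zd).
  rewrite diff_jac// => H.
  have -> : z - x - mulmxr A0 (F z - F x) =
      - ((F z - F x - (z - x) *m jac F x) *m A0).
    rewrite [in RHS]mulmxBl -[X in _ = - (_ - X)]mulmxA mulmxV; last first.
      by rewrite unitmxE unitfE rJ.
    by rewrite mulmx1 opprB.
  rewrite normrN; apply: le_trans (HC1 _) _.
  have -> : e * `|F z - F x| = C1 * (e / (C1 * (2 * C)) * (2 * C * `|F z - F x|)).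
    by field; rewrite !gt_eqF.
  apply: ler_wpM2l; first exact: ltW.
  by apply: le_trans H _; apply: ler_wpM2l => //; exact: ltW.
exists B; split => //; first exact: ball_open.
exists G; split => //.
apply: smooth_bootstrap => [_ [x Bx <-]|k CG i]; first by have [] := dG x Bx.
(* The derivative of [G] is a smooth function of [G] itself, which closes the bootstrap. *)
apply: (eq_Ck oFB (f := fun y => row i (invmx (jac F (G y))))).
  move=> _ [x Bx <-]; have [d1 d2] := dG x Bx.
  by rewrite deriveE// d2 /= GF// rowE.
apply: Ck_mx => // a b.
apply: (eq_Ck oFB (f := fun y => invmx (jac F (G y)) i b)).
  by move=> y _; rewrite mxE.
have oB : open B by exact: ball_open.
apply: (Ck_compose (g := fun x => invmx (jac F x) i b) oFB (W := B)) CG _.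
  by move=> _ [x Bx <-]; rewrite GF.
move: k; apply: smooth_invmx => // c e.
by apply: smooth_jac => //; exact: smooth_sub sF.
Unshelve. all: by end_near. Qed.

End InverseFunction.

(** * Small sums, rules of differentiation and tensor identities *)

Section Sums.
Context {V : nmodType}.

Lemma sum2E (f : 'I_2 -> V) : \sum_i f i = f 0 + f 1.
Proof. by rewrite !big_ord_recl big_ord0 addr0; congr (f _ + f _); apply: val_inj. Qed.

Lemma sum3E (f : 'I_3 -> V) : \sum_i f i = f 0 + f 1 + f 2.
Proof.
rewrite !big_ord_recl big_ord0 addr0 addrA.
by congr (f _ + f _ + f _); apply: val_inj.
Qed.

End Sums.

Lemma ord2P (P : 'I_2 -> Prop) : P 0 -> P 1 -> forall i, P i.
Proof.
move=> P0 P1 [[|[|//]] H].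
- by rewrite (_ : Ordinal H = 0)//; exact: val_inj.
- by rewrite (_ : Ordinal H = 1)//; exact: val_inj.
Qed.

Lemma ord3P (P : 'I_3 -> Prop) : P 0 -> P 1 -> P 2 -> forall i, P i.
Proof.
move=> P0 P1 P2 [[|[|[|//]]] H].
- by rewrite (_ : Ordinal H = 0)//; exact: val_inj.
- by rewrite (_ : Ordinal H = 1)//; exact: val_inj.
- by rewrite (_ : Ordinal H = 2)//; exact: val_inj.
Qed.

Lemma det2E {R : comNzRingType} (M : 'M[R]_2) :
  \det M = M 0 0 * M 1 1 - M 0 1 * M 1 0.
Proof.
rewrite (expand_det_row _ 0) sum2E /cofactor !det_mx11 !mxE /= expr0 expr1 mul1r.
have -> : lift 0 0 = 1 :> 'I_2 by exact: val_inj.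
have -> : lift 1 0 = 0 :> 'I_2 by exact: val_inj.
by rewrite mulN1r mulrN.
Qed.

Section DeriveRules.
Context {R : realType} {V : normedModType R}.
Implicit Types (f g : V -> R) (x v : V).

Lemma derive_rule f x v d d' : is_derive x v f d -> d = d' -> 'D_v f x = d'.
Proof. by move=> [_ ->]. Qed.

Lemma derive_rule_eq f x v d d' : is_derive x v f d -> d = d' -> is_derive x v f d'.
Proof. by move=> H <-. Qed.

Lemma derive_rule_leaf f x v : differentiable f x -> is_derive x v f ('D_v f x).
Proof. by move=> df; apply: DeriveDef => //; exact: diff_derivable. Qed.

Lemma derive_rule_cst (c : R) x v : is_derive x v (fun=> c) 0.
Proof. exact: is_derive_cst. Qed.

Lemma derive_ruleD f g x v df dg : is_derive x v f df -> is_derive x v g dg ->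
  is_derive x v (fun y => f y + g y) (df + dg).
Proof. by move=> ? ?; exact: (is_deriveD (f := f) (g := g)). Qed.

Lemma derive_ruleN f x v df : is_derive x v f df ->
  is_derive x v (fun y => - f y) (- df).
Proof. by move=> ?; exact: (is_deriveN (f := f)). Qed.

Lemma derive_ruleM f g x v df dg : is_derive x v f df -> is_derive x v g dg ->
  is_derive x v (fun y => f y * g y) (f x * dg + g x * df).
Proof. by move=> ? ?; exact: (is_deriveM (f := f) (g := g)). Qed.

Lemma derive_ruleX f n x v df : is_derive x v f df ->
  is_derive x v (fun y => f y ^+ n) (n%:R * f x ^+ n.-1 * df).
Proof.
move=> ?; rewrite (_ : (fun _ => _) = f ^+ n); first exact: is_deriveX.
by apply/funext => y; rewrite exprfctE.
Qed.

Lemma derive_ruleV f x v df : f x != 0 -> is_derive x v f df ->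
  is_derive x v (fun y => (f y)^-1) (- (f x) ^- 2 * df).
Proof.
move=> f0 [df1 <-]; apply: DeriveDef; first exact: derivableV.
exact: deriveV.
Qed.

Lemma derive_rule_sum (I : Type) (r : seq I) (h : I -> V -> R) (dh : I -> R) x v :
  (forall i, is_derive x v (h i) (dh i)) ->
  is_derive x v (fun y => \sum_(i <- r) h i y) (\sum_(i <- r) dh i).
Proof.
move=> H; elim: r => [|i r IH].
  rewrite big_nil (_ : (fun _ => _) = fun=> 0); first exact: derive_rule_cst.
  by apply/funext => y; rewrite big_nil.
rewrite big_cons (_ : (fun _ => _) = fun y => h i y + \sum_(j <- r) h j y).
  exact: derive_ruleD.
by apply/funext => y; rewrite big_cons.
Qed.

End DeriveRules.

Ltac derive_solve := repeat first
  [ apply: derive_rule_cst | apply: is_derive_coord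
  | apply: derive_ruleD | apply: derive_ruleM | apply: derive_ruleN
  | apply: derive_ruleX | apply: derive_ruleV
  | apply: derive_rule_leaf ].

(** [F1], [F2], [F3] stand for the partial derivatives of a map, [A] and [B] for the Christoffel
    symbols of source and target, [dA] and [dB] for their derivatives. The first hypothesis says
    that the second fundamental form vanishes; its derivative, antisymmetrised in the two
    derivations 0 and 1, is the transformation law of the curvature. In dimension 2 this is the only
    pair of indices, whence the Jacobian determinant on the right. *)
Lemma isometry_curvature_algebra {R : comRingType} (F1 : 'I_2 -> 'I_2 -> R)
   (F2 : 'I_2 -> 'I_2 -> 'I_2 -> R) (F3 : 'I_2 -> 'I_2 -> 'I_2 -> 'I_2 -> R)
   (A B : 'I_2 -> 'I_2 -> 'I_2 -> R) (dA dB : 'I_2 -> 'I_2 -> 'I_2 -> 'I_2 -> R) :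
   (forall i j c, F2 i j c = \sum_l A l i j * F1 l c
      - \sum_a \sum_b B c a b * F1 i a * F1 j b) ->
   (forall l i j, A l i j = A l j i) -> (forall l i j, B l i j = B l j i) ->
   (forall k i j c, F3 k i j c = \sum_l (dA k l i j * F1 l c + A l i j * F2 k l c)
     - \sum_a \sum_b ((\sum_d dB d c a b * F1 k d) * F1 i a * F1 j b
         + B c a b * (F2 k i a * F1 j b + F1 i a * F2 k j b))) ->
   (forall i c, F3 0 1 i c = F3 1 0 i c) ->
   forall k c,
   \sum_l (dA 0 l 1 k - dA 1 l 0 k + \sum_s (A s 1 k * A l 0 s - A s 0 k * A l 1 s))
     * F1 l c =
   (\sum_a (dB 0 c 1 a - dB 1 c 0 a + \sum_s (B s 1 a * B c 0 s - B s 0 a * B c 1 s))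
     * F1 k a) * (F1 0 0 * F1 1 1 - F1 0 1 * F1 1 0).
Proof.
move=> HF2 sA sB HF3 H3 k c.
suff E : forall k c, \sum_l (dA 0 l 1 k - dA 1 l 0 k
     + \sum_s (A s 1 k * A l 0 s - A s 0 k * A l 1 s)) * F1 l c -
   (\sum_a (dB 0 c 1 a - dB 1 c 0 a + \sum_s (B s 1 a * B c 0 s - B s 0 a * B c 1 s))
     * F1 k a) * (F1 0 0 * F1 1 1 - F1 0 1 * F1 1 0) = F3 0 1 k c - F3 1 0 k c.
  by apply/subr0_eq; rewrite E H3 subrr.
have s1 : forall l, A l 1 0 = A l 0 1 by [].
have s2 : forall l, B l 1 0 = B l 0 1 by [].
by apply: ord2P; apply: ord2P; rewrite !HF3 !sum2E !HF2 !sum2E !s1 !s2; ring.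
Qed.

Lemma mul2_eq0 {R : idomainType} (M : 'I_2 -> 'I_2 -> R) (u : 'I_2 -> R) :
  M 0 0 * M 1 1 - M 0 1 * M 1 0 != 0 ->
  (forall i, \sum_j M i j * u j = 0) -> forall j, u j = 0.
Proof.
move=> d H; have := H 0; have := H 1; rewrite !sum2E => H1 H0.
apply: ord2P; apply: (mulfI d); rewrite mulr0.
  by transitivity (M 1 1 * (M 0 0 * u 0 + M 0 1 * u 1) - M 0 1 * (M 1 0 * u 0 + M 1 1 * u 1));
    [ring|rewrite H0 H1; ring].
by transitivity (M 0 0 * (M 1 0 * u 0 + M 1 1 * u 1) - M 1 0 * (M 0 0 * u 0 + M 0 1 * u 1));
    [ring|rewrite H0 H1; ring].
Qed.

(** The derivatives of g = F^* h, combined as in Koszul's formula, determine the second derivatives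
    of F. The difference [T] of the two sides is killed after lowering its index with h and pulling
    it back by [F1], both of which are invertible; what is left is a linear identity in the
    derivatives of h. *)
Lemma isometry_christoffel_algebra {R : fieldType} (g h : 'I_2 -> 'I_2 -> R)
  (dg dh A B F2 : 'I_2 -> 'I_2 -> 'I_2 -> R) (F1 : 'I_2 -> 'I_2 -> R) :
  (forall l k, g l k = \sum_a \sum_b F1 l a * F1 k b * h a b) ->
  (forall i j l, dg i j l = \sum_a \sum_b (F2 i j a * F1 l b * h a b
      + F1 j a * F2 i l b * h a b + F1 j a * F1 l b * \sum_d dh d a b * F1 i d)) ->
  (forall l i j, \sum_k g l k * A k i j = 2^-1 * (dg i j l + dg j i l - dg l i j)) ->
  (forall l i j, \sum_k h l k * B k i j = 2^-1 * (dh i j l + dh j i l - dh l i j)) ->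
  (forall i j, h i j = h j i) -> (forall d i j, dh d i j = dh d j i) ->
  (forall i j c, F2 i j c = F2 j i c) ->
  F1 0 0 * F1 1 1 - F1 0 1 * F1 1 0 != 0 -> h 0 0 * h 1 1 - h 0 1 * h 1 0 != 0 ->
  2 != 0 :> R ->
  forall i j c, F2 i j c = \sum_l A l i j * F1 l c
      - \sum_a \sum_b B c a b * F1 i a * F1 j b.
Proof.
move=> gE dgE HA HB sh sdh sF dF dh0 t0 i j c.
pose T c := F2 i j c - (\sum_l A l i j * F1 l c - \sum_a \sum_b B c a b * F1 i a * F1 j b).
suff T0 : forall c, T c = 0 by apply/subr0_eq; exact: T0.
apply: (mul2_eq0 dh0); apply: (mul2_eq0 dF) => l.
pose bl l i j := 2^-1 * (dh i j l + dh j i l - dh l i j).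
have HB' m i' j' : bl m i' j' = h m 0 * B 0 i' j' + h m 1 * B 1 i' j'.
  by rewrite /bl -HB sum2E.
transitivity (\sum_b F1 l b * (\sum_c h b c * F2 i j c)
  - \sum_k g l k * A k i j
  + \sum_b F1 l b * \sum_a \sum_d bl b a d * F1 i a * F1 j d).
  by rewrite /T !sum2E !HB' !gE !sum2E; ring.
rewrite HA !dgE !sum2E !(sF j i) !(sF l i) !(sF l j) /bl (sh 1 0) !(sdh _ 1 0).
by field.
Qed.

(** * Isometries preserve the curvature *)

Section Christoffel.
Context {R : realType} {n : nat}.
Variables (U : set 'rV[R]_n) (G : 'rV[R]_n -> 'M[R]_n).
Hypothesis oU : open U.
Hypothesis sG : forall i j, smooth U (fun x => G x i j).
Hypothesis dG : forall x, U x -> \det (G x) != 0.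
Hypothesis symG : forall x i j, U x -> G x i j = G x j i.

Lemma christoffel_lower l i j x : U x ->
  \sum_k G x l k * christoffel G k i j x =
  2^-1 * (pd i (fun y => G y j l) x + pd j (fun y => G y i l) x
          - pd l (fun y => G y i j) x).
Proof.
move=> Ux; pose w : 'cV[R]_n := \col_l (pd i (fun y => G y j l) x
  + pd j (fun y => G y i l) x - pd l (fun y => G y i j) x).
have -> : \sum_k G x l k * christoffel G k i j x
   = 2^-1 * (G x *m (invmx (G x) *m w)) l 0.
  rewrite mxE mulr_sumr; apply: eq_bigr => k _.
  rewrite /christoffel mulrCA; congr (_ * (_ * _)); rewrite mxE.
  by apply: eq_bigr => k' _; rewrite [in RHS]mxE.
by rewrite mulKVmx ?unitmxE ?unitfE ?dG// mxE.
Qed.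

Lemma smooth_christoffel k i j : smooth U (christoffel G k i j).
Proof.
apply: smoothM => //; first exact: smooth_cst.
apply: smooth_sum => // l; apply: smoothM => //; first exact: smooth_invmx.
by apply: smoothB => //; [apply: smoothD => //|]; exact: smooth_pd.
Qed.

Lemma pd_metric_sym l i j x : U x ->
  pd l (fun y => G y i j) x = pd l (fun y => G y j i) x.
Proof.
move=> Ux; apply: near_eq_derive; apply: near_of_open oU Ux _ => y Uy.
exact: symG.
Qed.

Lemma christoffel_sym k i j x : U x -> christoffel G k i j x = christoffel G k j i x.
Proof.
move=> Ux; rewrite /christoffel; congr (_ * _); apply: eq_bigr => l _.
by rewrite (pd_metric_sym l i j Ux) (addrC (pd i _ x)).
Qed.

End Christoffel.

Section LocalIsometry.
Context {R : realType}.
Variables (U W : set 'rV[R]_2) (G H : 'rV[R]_2 -> 'M[R]_2) (F : 'rV[R]_2 -> 'rV[R]_2).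
Hypotheses (oU : open U) (oW : open W) (UW : forall x, U x -> W (F x)).
Hypothesis sF : smooth U F.
Hypothesis sG : forall i j, smooth U (fun x => G x i j).
Hypothesis sH : forall i j, smooth W (fun x => H x i j).
Hypothesis dG : forall x, U x -> \det (G x) != 0.
Hypothesis symH : forall x i j, W x -> H x i j = H x j i.
Hypothesis dH : forall x, W x -> \det (H x) != 0.
Hypothesis iso : forall x, U x -> G x = jac F x *m H (F x) *m (jac F x)^T.

Let f c y := F y 0 c.
Let F1 x i c := pd i (f c) x.
Let F2 x i j c := pd i (pd j (f c)) x.

Let sf c : smooth U (f c). Proof. exact: smooth_entry. Qed.

Let det_jac x : U x -> F1 x 0 0 * F1 x 1 1 - F1 x 0 1 * F1 x 1 0 != 0.
Proof.
move=> Ux; have := dG Ux; rewrite iso// !det_mulmx det_tr.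
by apply: contraNneq; rewrite det2E !mxE => ->; rewrite mul0r mul0r.
Qed.

Let symG x i j : U x -> G x i j = G x j i.
Proof.
move=> Ux; rewrite iso// -[in LHS](trmxK (_ *m _ *m _)) mxE !trmx_mul trmxK mulmxA.
congr ((_ *m _ *m _) _ _); apply/matrixP => a b; rewrite mxE symH//; exact: UW.
Qed.

Let GE x : U x -> forall l k, G x l k = \sum_a \sum_b F1 x l a * F1 x k b * H (F x) a b.
Proof.
move=> Ux l k; rewrite iso// !mxE !sum2E !mxE !sum2E !mxE.
rewrite -!/(f _) -!/(F1 _ _ _).
by move: (F1 x) (H (F x)) => a b; ring.
Qed.

Let diff_F x : U x -> differentiable F x.
Proof. by move=> Ux; exact: smooth_differentiable sF Ux. Qed.

Let pd_comp_F (u : 'rV[R]_2 -> R) i x : smooth W u -> U x ->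
  is_derive x (delta_mx 0 i) (fun y => u (F y)) (\sum_d pd d u (F x) * F1 x i d).
Proof.
move=> su Ux; have du := smooth_differentiable su (UW Ux).
rewrite -(pd_compose i (diff_F Ux) du); apply: derive_rule_leaf.
by have [] := derive_compose 0 (diff_F Ux) du.
Qed.

Let dF1 i j c x : U x -> is_derive x (delta_mx 0 i) (fun y => F1 y j c) (F2 x i j c).
Proof.
move=> Ux; apply: derive_rule_leaf.
by apply: smooth_differentiable Ux; apply: smooth_pd; exact: sf.
Qed.

Lemma isometry_christoffel x i j c : U x ->
  F2 x i j c = \sum_l christoffel G l i j x * F1 x l c
    - \sum_a \sum_b christoffel H c a b (F x) * F1 x i a * F1 x j b.
Proof.
move=> Ux; pose dg i j l := pd i (fun y => G y j l) x.
pose dh i j l := pd i (fun y => H y j l) (F x).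
apply: (isometry_christoffel_algebra (g := G x) (h := H (F x)) (dg := dg) (dh := dh)
  (F1 := F1 x) (F2 := F2 x) (A := fun l i j => christoffel G l i j x)
  (B := fun l i j => christoffel H l i j (F x))).
- exact: GE.
- move=> {}i {}j l; rewrite /dg.
  transitivity (pd i (fun y => \sum_a \sum_b F1 y j a * F1 y l b * H (F y) a b) x).
    by apply: near_eq_derive; apply: near_of_open oU Ux _ => y Uy; exact: GE.
  apply: derive_rule.
    apply: derive_rule_sum => a; apply: derive_rule_sum => b.
    apply: derive_ruleM; first by apply: derive_ruleM; exact: dF1.
    exact: (pd_comp_F i (sH a b) Ux).
  apply: eq_bigr => a _; apply: eq_bigr => b _; rewrite /dh.
  by set S := \sum_d _; clearbody S; move: (F1 x) (F2 x) (H (F x)) => u v w; ring.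
- by move=> l {}i {}j; exact: (christoffel_lower dG).
- by move=> l {}i {}j; exact: (christoffel_lower dH _ _ _ (UW Ux)).
- by move=> {}i {}j; apply: symH; exact: UW.
- by move=> d {}i {}j; apply: (pd_metric_sym oW symH); exact: UW.
- by move=> {}i {}j {}c; exact: (pd_comm i j oU Ux (sf c)).
- exact: det_jac.
- by have := dH (UW Ux); rewrite det2E.
- by rewrite pnatr_eq0.
Qed.

Lemma isometry_riemann x k c : U x ->
  \sum_l riemann G l k 0 1 x * F1 x l c =
  (\sum_a riemann H c a 0 1 (F x) * F1 x k a)
    * (F1 x 0 0 * F1 x 1 1 - F1 x 0 1 * F1 x 1 0).
Proof.
move=> Ux.
apply: (isometry_curvature_algebra (F2 := F2 x)
   (F3 := fun k i j c => pd k (fun y => F2 y i j c) x) (A := fun l i j => christoffel G l i j x)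
   (B := fun l i j => christoffel H l i j (F x))
   (dA := fun k l i j => pd k (christoffel G l i j) x)
   (dB := fun k l i j => pd k (christoffel H l i j) (F x))).
- by move=> i j {}c; exact: isometry_christoffel.
- by move=> l i j; exact: (christoffel_sym oU symG).
- by move=> l i j; apply: (christoffel_sym oW symH); exact: UW.
all: swap 1 2.
  by move=> i {}c; apply: pd_comm oU Ux _; exact: smooth_pd (sf c).
move=> k' i' j' {}c.
transitivity (pd k' (fun y => \sum_l christoffel G l i' j' y * F1 y l c
    + - \sum_a \sum_b christoffel H c a b (F y) * F1 y i' a * F1 y j' b) x).
  apply: near_eq_derive; apply: near_of_open oU Ux _ => y Uy.
  exact: isometry_christoffel.
apply: derive_rule.
  apply: derive_ruleD.
    apply: derive_rule_sum => l; apply: derive_ruleM; last exact: dF1.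
    apply: derive_rule_leaf; exact: smooth_differentiable (smooth_christoffel oU sG dG l i' j') Ux.
  apply: derive_ruleN; apply: derive_rule_sum => a; apply: derive_rule_sum => b.
  apply: derive_ruleM; last exact: dF1.
  apply: derive_ruleM; last exact: dF1.
  exact: (pd_comp_F k' (smooth_christoffel oW sH dH c a b) Ux).
congr (_ - _); apply: eq_bigr => a _; first by rewrite [LHS]addrC [X in X + _ = _]mulrC.
apply: eq_bigr => b _.
set S := \sum_d _; clearbody S.
by move: (F1 x) (F2 x) (christoffel H c a b (F x)) => u v w; ring.
Qed.

(** The whole curvature tensor is assumed to have the constant-curvature shape on the source, since
    the tensor, unlike the single contraction in [gauss_curvature], has a simple transformation law.
    [Z], the deviation from that shape on the target, is killed by the invertible Jacobian. *)
Lemma isometry_gauss_curvature x K : U x ->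
  (forall l k, riemann G l k 0 1 x
     = K * ((l == 0)%:R * G x 1 k - (l == 1)%:R * G x 0 k)) ->
  gauss_curvature H (F x) = K.
Proof.
move=> Ux HK.
have sHx : H (F x) 1 0 = H (F x) 0 1 by apply: symH; exact: UW.
pose J := F1 x 0 0 * F1 x 1 1 - F1 x 0 1 * F1 x 1 0.
pose Z c a := riemann H c a 0 1 (F x)
   - K * ((c == 0)%:R * H (F x) 1 a - (c == 1)%:R * H (F x) 0 a).
have Z0 c a : Z c a = 0.
  move: a; apply: (mul2_eq0 (det_jac Ux)) => k; apply: (mulIf (det_jac Ux)).
  rewrite mul0r.
  transitivity ((\sum_a riemann H c a 0 1 (F x) * F1 x k a) * J
    - K * (\sum_a F1 x k a * ((c == 0)%:R * H (F x) 1 a - (c == 1)%:R * H (F x) 0 a)) * J).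
    by rewrite /Z -/J !sum2E; move: (F1 x) (riemann H) (H (F x)) J => a r h j; ring.
  rewrite -isometry_riemann// !sum2E !HK !(GE Ux) !sum2E /J.
  move: c; apply: ord2P; rewrite !eqxx /= !sHx; move: (F1 x) (H (F x)) => a h; ring.
have RE c a : riemann H c a 0 1 (F x) =
     K * ((c == 0)%:R * H (F x) 1 a - (c == 1)%:R * H (F x) 0 a).
  by apply/subr0_eq; exact: Z0.
have := dH (UW Ux); rewrite /gauss_curvature det2E sum2E !RE !eqxx /= !sHx.
by move: (H (F x)) => h d; field.
Qed.

End LocalIsometry.

(** * Curvature of the base metric *)

Section BaseCurvature.
Context {R : realType}.
Variable m : R.

Lemma open_bcv_region n (i j : 'I_n) :
  open [set q : 'rV[R]_n | 0 < bcv_factor m (q 0 i) (q 0 j)].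
Proof.
pose u (q : 'rV[R]_n) := bcv_factor m (q 0 i) (q 0 j).
have su : smooth setT u.
  apply: smoothD; [exact: openT|exact: smooth_cst|].
  apply: smoothM; [exact: openT|exact: smooth_cst|].
  by apply: smoothD; [exact: openT| |]; apply: smoothX; first exact: openT;
    [exact: smooth_coord openT|exact: openT|exact: smooth_coord openT].
have cu : continuous u by move=> x; exact: su 0%N x I.
by apply: (open_comp (f := u) (D := [set y | 0 < y])) => [x _|]; [exact: cu|exact: open_gt].
Qed.

Lemma smooth_bcv_factor n (i j : 'I_n) (U : set 'rV[R]_n) : open U ->
  smooth U (fun q => bcv_factor m (q 0 i) (q 0 j)).
Proof.
move=> oU; apply: smoothD => //; first exact: smooth_cst.
apply: smoothM => //; first exact: smooth_cst.
by apply: smoothD => //; apply: smoothX => //; exact: smooth_coord.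
Qed.

Let D := [set q : 'rV[R]_2 | 0 < bcv_factor m (q 0 0) (q 0 1)].
Let f (q : 'rV[R]_2) := bcv_factor m (q 0 0) (q 0 1).

Let f_neq0 q : D q -> f q != 0. Proof. by move=> /lt0r_neq0. Qed.

Lemma base_metricE q i j : base_metric m q i j = (f q ^+ 2)^-1 * (i == j)%:R.
Proof. by rewrite !mxE. Qed.

Lemma smooth_base_metric i j : smooth D (fun q => base_metric m q i j).
Proof.
have oD : open D by exact: open_bcv_region.
apply: (eq_smooth oD (f := fun q => (f q ^+ 2)^-1 * (i == j)%:R)).
  by move=> q _; rewrite base_metricE.
apply: smoothM => //; last exact: smooth_cst.
apply: smoothV => // [q Dq|]; first by rewrite expf_neq0// f_neq0.
by apply: smoothX => //; exact: smooth_bcv_factor.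
Qed.

Lemma det_base_metric q : D q -> \det (base_metric m q) != 0.
Proof.
move=> Dq; rewrite detZ det1 mulr1 expf_neq0// invr_neq0// expf_neq0//.
exact: f_neq0.
Qed.

Let df (q : 'rV[R]_2) l : is_derive q (delta_mx 0 l) f (2 * m * q 0 l).
Proof.
apply: derive_rule_eq; first by rewrite /f /bcv_factor; derive_solve.
rewrite !mxE eqxx /=.
by move: l; apply: ord2P; rewrite /=; ring.
Qed.

Lemma base_christoffel q k i j : D q -> christoffel (base_metric m) k i j q =
  - (2 * m) * ((k == j)%:R * q 0 i + (k == i)%:R * q 0 j - (i == j)%:R * q 0 k) / f q.
Proof.
move=> Dq; have f0 := f_neq0 Dq.
have dgE l a b : pd l (fun y => base_metric m y a b) q =
    - (4 * m * q 0 l / f q ^+ 3) * (a == b)%:R.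
  transitivity (pd l (fun y => (f y ^+ 2)^-1 * (a == b)%:R) q).
    by congr (pd _ _ _); apply/funext => y; rewrite base_metricE.
  apply: derive_rule.
    apply: derive_ruleM; apply: derive_ruleV; first by rewrite expf_neq0.
    by apply: derive_ruleX; exact: df.
  by rewrite /=; move: (f q) f0 (q 0 l) ((a == b)%:R) => u u0 v w; field.
have invE : invmx (base_metric m q) = f q ^+ 2 *: 1%:M.
  by rewrite /base_metric !scalemx1 invmx_scalar invrK.
rewrite /christoffel (bigD1 k)//= big1 ?addr0; last first.
  by move=> l lk; rewrite invE !mxE eq_sym (negPf lk) mulr0 mul0r.
rewrite invE !mxE eqxx mulr1 !dgE (eq_sym j k) (eq_sym i k).
move: (f q) f0 (q 0 i) (q 0 j) (q 0 k) => u u0 a b c.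
by move: ((k == j)%:R) ((k == i)%:R) ((i == j)%:R) => r s t; field.
Qed.

(** For a conformally flat metric (dx^2 + dy^2) / f^2 the curvature is f (Laplacian of f) - |grad
    f|^2, here 4m (1 + m r^2) - 4 m^2 r^2 = 4m with r^2 = x^2 + y^2. *)
Lemma base_riemann q l k : D q -> riemann (base_metric m) l k 0 1 q =
  4 * m * ((l == 0)%:R * base_metric m q 1 k - (l == 1)%:R * base_metric m q 0 k).
Proof.
move=> Dq; have f0 := f_neq0 Dq.
have oD : open D by exact: open_bcv_region.
have dG h i j b : pd h (christoffel (base_metric m) b i j) q =
    - (2 * m) * (((b == j)%:R * (i == h)%:R + (b == i)%:R * (j == h)%:R
          - (i == j)%:R * (b == h)%:R) / f q
      - ((b == j)%:R * q 0 i + (b == i)%:R * q 0 j - (i == j)%:R * q 0 b)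
         * (2 * m * q 0 h) / f q ^+ 2).
  transitivity (pd h (fun q => - (2 * m) * ((b == j)%:R * q 0 i + (b == i)%:R * q 0 j
      + - ((i == j)%:R * q 0 b)) * (f q)^-1) q).
    apply: near_eq_derive; apply: near_of_open oD Dq _ => y Dy.
    exact: base_christoffel.
  apply: derive_rule.
    apply: derive_ruleM; last by apply: derive_ruleV => //; exact: df.
    by derive_solve.
  rewrite !mxE !eqxx /=; move: (f q) f0 (q 0 i) (q 0 j) (q 0 b) (q 0 h) => u u0 v1 v2 v3 v4.
  move: ((b == j)%:R) ((b == i)%:R) ((i == j)%:R) => r s t.
  by move: ((b == h)%:R) ((i == h)%:R) ((j == h)%:R) => r' s' t'; field.
have fE : f q = 1 + m * (q 0 0 ^+ 2 + q 0 1 ^+ 2) by [].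
rewrite /riemann !dG !sum2E !base_christoffel// !base_metricE.
move: f0; rewrite fE => f0; move: l k; apply: ord2P; apply: ord2P; rewrite /=;
  by move: (q 0 0) (q 0 1) f0 => a b u0; field.
Qed.

End BaseCurvature.

(** * The orthonormal frame of a BCV space *)

Definition bcv_frame {R : realType} (m l : R) (p : 'rV[R]_3) : 'M[R]_3 :=
  let f := bcv_factor m (p 0 0) (p 0 1) in
  \matrix_(i, j) (nth [::] [:: [:: f; 0; - (l / 2 * p 0 1)];
                             [:: 0; f; l / 2 * p 0 0]; [:: 0; 0; 1]] i)`_j.

(* Sealed: unification would otherwise unfold derivatives when comparing large terms. *)
HB.lock Definition dcoord {R : realType} (i : 'I_3) (u : 'rV[R]_3 -> R) :
  'rV[R]_3 -> R := pd i u.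

HB.lock Definition fr {R : realType} (m l : R) (i : 'I_3) (u : 'rV[R]_3 -> R)
    (p : 'rV[R]_3) : R :=
  'D_(row i (bcv_frame m l p)) u p.

Section Frame.
Context {R : realType}.
Variables m l : R.
Implicit Types p : 'rV[R]_3.
Notation f p := (bcv_factor m (p 0 0) (p 0 1)).
Notation bcv_frame := (bcv_frame m l).
Notation fr := (fr m l).

Definition bcv_region := [set p : 'rV[R]_3 | 0 < f p].

Lemma smooth_dcoord (U : set 'rV[R]_3) i u : smooth U u -> smooth U (dcoord i u).
Proof. by rewrite dcoord.unlock; exact: smooth_pd. Qed.

Lemma dcoord_comm (U : set 'rV[R]_3) i j u p : open U -> U p -> smooth U u ->
  dcoord i (dcoord j u) p = dcoord j (dcoord i u) p.
Proof. by rewrite dcoord.unlock; exact: pd_comm. Qed.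

Lemma frE i u p : differentiable u p ->
  fr i u p = \sum_j bcv_frame p i j * dcoord j u p.
Proof. by move=> du; rewrite fr.unlock dcoord.unlock derive_pd//; apply: eq_bigr => j _; rewrite mxE. Qed.

Lemma fr0E u p : differentiable u p ->
  fr 0 u p = f p * dcoord 0 u p - l / 2 * p 0 1 * dcoord 2 u p.
Proof. by move=> du; rewrite frE// sum3E !mxE /=; ring. Qed.

Lemma fr1E u p : differentiable u p ->
  fr 1 u p = f p * dcoord 1 u p + l / 2 * p 0 0 * dcoord 2 u p.
Proof. by move=> du; rewrite frE// sum3E !mxE /=; ring. Qed.

Lemma fr2E u p : differentiable u p -> fr 2 u p = dcoord 2 u p.
Proof. by move=> du; rewrite frE// sum3E !mxE /=; ring. Qed.

Lemma smooth_frame (U : set 'rV[R]_3) i j : open U ->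
  smooth U (fun p => bcv_frame p i j).
Proof.
move=> oU; have sc k (c : R) : smooth U (fun p : 'rV[R]_3 => c * p 0 k).
  by apply: smoothM => //; [exact: smooth_cst|exact: smooth_coord].
have sF := smooth_bcv_factor m (0 : 'I_3) 1 oU.
have s0 (c : R) : smooth U (fun _ : 'rV[R]_3 => c) by exact: smooth_cst.
have -> : (fun p => bcv_frame p i j) = (fun p : 'rV[R]_3 =>
    (nth [::] [:: [:: f p; 0; - (l / 2 * p 0 1)];
                  [:: 0; f p; l / 2 * p 0 0]; [:: 0; 0; 1]] i)`_j).
  by apply/funext => p; rewrite mxE.
move: i j; apply: ord3P; apply: ord3P; rewrite /=;
  by [exact: sF|exact: s0|exact: sc|apply: smoothN => //; exact: sc].
Qed.

Lemma smooth_fr (U : set 'rV[R]_3) i u : open U -> smooth U u -> smooth U (fr i u).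
Proof.
move=> oU su.
apply: (eq_smooth oU (f := fun p => \sum_j bcv_frame p i j * dcoord j u p)).
  by move=> p Up; rewrite frE//; exact: smooth_differentiable su Up.
apply: smooth_sum => // j; apply: smoothM => //; first exact: smooth_frame.
exact: smooth_dcoord.
Qed.

Lemma bcv_metricE p i j : bcv_metric m l p i j =
  (f p ^+ 2)^-1 * ((i == j) && (i < 2)%N)%:R + bcv_form m l p 0 i * bcv_form m l p 0 j.
Proof. by rewrite !mxE big_ord1 !mxE. Qed.

Lemma frame_orthonormal p : f p != 0 ->
  bcv_frame p *m bcv_metric m l p *m (bcv_frame p)^T = 1%:M.
Proof.
move=> f0; apply/matrixP => i j; rewrite !mxE !sum3E !mxE !sum3E !bcv_metricE !mxE /=.
by move: i j; apply: ord3P; apply: ord3P; rewrite /=; move: (f p) f0 => u u0; field.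
Qed.

Lemma frame_unit p : f p != 0 -> bcv_frame p \in unitmx.
Proof. by move=> /frame_orthonormal; rewrite -mulmxA => /mulmx1_unit[]. Qed.

Lemma bcv_metric_unit p : f p != 0 -> bcv_metric m l p \in unitmx.
Proof.
move=> /frame_orthonormal; rewrite -mulmxA => /mulmx1C.
by rewrite -mulmxA => /mulmx1_unit[].
Qed.

Lemma bcv_metric_inv p : f p != 0 ->
  invmx (bcv_metric m l p) = (bcv_frame p)^T *m bcv_frame p.
Proof.
move=> f0; have /mulmx1C : bcv_frame p *m (bcv_metric m l p *m (bcv_frame p)^T) = 1%:M.
  by rewrite mulmxA; exact: frame_orthonormal.
rewrite -mulmxA => gE.
by rewrite -[LHS]mulmx1 -gE mulKmx// bcv_metric_unit.
Qed.

(** In other words x, y and z are harmonic functions: the square root of det g is f^-2, and the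
    divergences d_i (f^-2 g^(ij)) vanish since f is rotation invariant and independent of z. The
    Laplacian therefore has no first-order term in these coordinates. *)
Lemma bcv_harmonic_coordinates p k : f p != 0 ->
  \sum_i \sum_j invmx (bcv_metric m l p) i j * christoffel (bcv_metric m l) k i j p = 0.
Proof.
move=> f0.
pose K := l / 2.
have df q : is_derive p (delta_mx 0 q) (fun y : 'rV[R]_3 => f y)
    (2 * m * (p 0 q * (q < 2)%N%:R)).
  apply: derive_rule_eq; first by rewrite /bcv_factor; derive_solve.
  by rewrite !mxE eqxx /=; move: q; apply: ord3P; rewrite /=; ring.
(* [dth q i] and, further down, [dg q i j] are the derivatives along the coordinate q of the
   components of [bcv_form] and of the metric; the factor [(q < 2)] records that f does not depend
   on z. *)
pose dth (q i : 'I_3) : R := [::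
   K * ((1 == q)%:R / f p - p 0 1 * (2 * m * (p 0 q * (q < 2)%N%:R)) / f p ^+ 2);
   - (K * ((0 == q)%:R / f p - p 0 0 * (2 * m * (p 0 q * (q < 2)%N%:R)) / f p ^+ 2));
   0]`_i.
have dform q i : is_derive p (delta_mx 0 q) (fun y => bcv_form m l y 0 i) (dth q i).
  have -> : (fun y => bcv_form m l y 0 i) =
      (fun y : 'rV[R]_3 => [:: l / 2 * (y 0 1 / f y); - (l / 2 * (y 0 0 / f y)); 1]`_i).
    by apply/funext => y; rewrite mxE.
  rewrite /dth; move: i; apply: ord3P; rewrite /=.
  - apply: derive_rule_eq.
      apply: derive_ruleM; apply: derive_ruleM; first exact: is_derive_coord.
      by apply: derive_ruleV => //; exact: df.
    rewrite !mxE /=; move: (p 0 1) (p 0 q) ((1 == q)%:R) ((q < 2)%N%:R) (f p) f0.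
    by move=> v w c d u u0; rewrite /K; field.
  - apply: derive_rule_eq.
      apply: derive_ruleN; apply: derive_ruleM; apply: derive_ruleM; first exact: is_derive_coord.
      by apply: derive_ruleV => //; exact: df.
    rewrite !mxE /=; move: (p 0 0) (p 0 q) ((0 == q)%:R) ((q < 2)%N%:R) (f p) f0.
    by move=> v w c d u u0; rewrite /K; field.
  - exact: derive_rule_cst.
pose dg (q i j : 'I_3) := - (4 * m * (p 0 q * (q < 2)%N%:R) / f p ^+ 3) * ((i == j) && (i < 2)%N)%:R
   + (bcv_form m l p 0 i * dth q j + bcv_form m l p 0 j * dth q i).
have dgE q i j : pd q (fun y => bcv_metric m l y i j) p = dg q i j.
  transitivity (pd q (fun y : 'rV[R]_3 => (f y ^+ 2)^-1 * ((i == j) && (i < 2)%N)%:R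
     + bcv_form m l y 0 i * bcv_form m l y 0 j) p).
    by congr (pd _ _ _); apply/funext => y; rewrite bcv_metricE.
  apply: derive_rule.
    apply: derive_ruleD; apply: derive_ruleM; apply: derive_ruleV; by rewrite expf_neq0.
  rewrite /dg /= -![_ *: _]/(_ * _); congr (_ + _).
  by move: (p 0 q) ((q < 2)%N%:R) (((i == j) && (i < 2)%N)%:R) (f p) f0 => v w c u u0; field.
rewrite /christoffel.
under eq_bigr => i _ do under eq_bigr => j _ do
  (under eq_bigr => q _ do rewrite !dgE; rewrite mulrCA big_distrr /=).
transitivity (\sum_q 2^-1 * invmx (bcv_metric m l p) k q * (\sum_i \sum_j
   invmx (bcv_metric m l p) i j * (dg i j q + dg j i q - dg q i j))).
  by rewrite !sum3E; clear dgE; clearbody dg; move: (invmx _) => g; ring.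
apply: big1 => q _; rewrite [X in _ * X](_ : _ = 0) ?mulr0//.
rewrite bcv_metric_inv// !sum3E !mxE !sum3E !mxE /dg /dth /bcv_form !mxE /= /K.
have fE : f p = 1 + m * (p 0 0 ^+ 2 + p 0 1 ^+ 2) by [].
move: q; apply: ord3P; rewrite /=; move: f0; rewrite fE;
  by move: (p 0 0) (p 0 1) (p 0 2) => x y z u0; field.
Qed.

End Frame.

(** * Pointwise algebra of the vertical direction *)

Definition cross {R : pzRingType} (b c : 'I_3 -> R) (i : 'I_3) : R :=
  [:: b 1 * c 2 - b 2 * c 1; b 2 * c 0 - b 0 * c 2; b 0 * c 1 - b 1 * c 0]`_i.

(* The equation [nabla dF (n, n) = 0] for the normal [n = b 0 x b 1]: the horizontal part of
   the trace of the Hessian is cancelled by the Christoffel symbols [G] of the target, so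
   that harmonicity leaves only the vertical part. *)
Lemma harmonic_vertical_algebra {R : fieldType} (b : 'I_2 -> 'I_3 -> R)
    (Hs : 'I_2 -> 'I_3 -> 'I_3 -> R) (u : 'I_2 -> 'I_2 -> R)
    (dh du G : 'I_2 -> 'I_2 -> 'I_2 -> R) :
  2 != 0 :> R ->
  (forall a c, \sum_i b a i * b c i = u a c) ->
  (forall d i j, dh d i j = dh d j i) ->
  (forall c i j, Hs c i j = Hs c j i) ->
  (forall d a c, du d a c = - \sum_p \sum_q u a p * dh d p q * u q c) ->
  (forall a c k, \sum_i (Hs a k i * b c i + Hs c k i * b a i) = \sum_d du d a c * b d k) ->
  (forall c a e, G c a e = 2^-1 * \sum_d u c d * (dh a e d + dh e a d - dh d a e)) ->
  (forall c, \sum_k Hs c k k + \sum_a \sum_e G c a e * u a e = 0) ->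
  forall c, \sum_k \sum_i Hs c k i * cross (b 0) (b 1) k * cross (b 0) (b 1) i = 0.
Proof.
move=> t0 gram sdh sHs duE H1 GE tr c.
have su a e : u a e = u e a.
  by rewrite -!gram; apply: eq_bigr => i _; rewrite mulrC.
(* [T c a e] is the Hessian of F^c on the gradients of F^a and F^e; [M a e d] is the derivative of
   the inner product of grad F^a and grad F^e along grad F^d. *)
pose T c a e := \sum_k \sum_i Hs c k i * b a k * b e i.
pose M a e d := \sum_f du f a e * u f d.
have TM a e d : T a d e + T e d a = M a e d.
  transitivity (\sum_k (\sum_i (Hs a k i * b e i + Hs e k i * b a i)) * b d k).
    by rewrite /T !sum3E; ring.
  under eq_bigr => k _ do rewrite H1.
  by rewrite /M !sum3E !sum2E -!gram !sum3E; ring.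
have sT a d e : T a d e = T a e d.
  rewrite /T exchange_big; apply: eq_bigr => i _; apply: eq_bigr => k _.
  by rewrite sHs mulrAC.
(* As in Koszul's formula, three permutations of [TM] and the symmetry of [T] in its last two
   arguments determine [T]. *)
have TE a d e : T a d e = 2^-1 * (M a d e + M a e d - M d e a).
  apply: (mulfI t0); rewrite mulrA mulfV// mul1r.
  rewrite -!TM (sT d a e) (sT d e a) (sT e a d) (sT e d a) (sT a e d).
  rewrite (sT d a e) (sT e a d); ring.
(* The trace of [Hs c] split along the plane of b 0, b 1 and its normal n, multiplied by |n|^2 = det
   u to clear denominators. *)
transitivity ((u 0 0 * u 1 1 - u 0 1 * u 1 0) * \sum_k Hs c k k
   - (u 1 1 * T c 0 0 - 2 * u 0 1 * T c 0 1 + u 0 0 * T c 1 1)).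
  rewrite /T -!gram !sum3E (sHs c 1 0) (sHs c 2 0) (sHs c 2 1) /cross /=.
  by clear; move: (b 0) (b 1) (Hs c) => b0 b1 h; ring.
have -> : \sum_k Hs c k k = - \sum_a \sum_e G c a e * u a e.
  by apply/eqP; rewrite -addr_eq0 tr.
rewrite !TE /M !sum2E !GE !duE !sum2E (su 1 0) !(sdh _ 1 0).
move: c; apply: ord2P; rewrite ?(su 1 0).
  by clear -t0; move: (u 0 0) (u 0 1) (u 1 1) => x y z; field.
by clear -t0; move: (u 0 0) (u 0 1) (u 1 1) => x y z; field.
Qed.

(** b, c and b x c form a basis. The identity [E] expands |b x c|^2 x in it, with the adjugate of
    the Gram matrix of b and c as coefficients. *)
Lemma frame_complete {R : idomainType} (b c x : 'I_3 -> R) :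
  \sum_i cross b c i * cross b c i != 0 ->
  \sum_i b i * x i = 0 -> \sum_i c i * x i = 0 -> \sum_i cross b c i * x i = 0 ->
  forall i, x i = 0.
Proof.
rewrite !sum3E /cross /= => d Hb Hc Hn i; apply: (mulfI d); rewrite mulr0.
set nn := (X in X * x i = 0).
have E : nn * x i = cross b c i * ((b 1 * c 2 - b 2 * c 1) * x 0
  + (b 2 * c 0 - b 0 * c 2) * x 1 + (b 0 * c 1 - b 1 * c 0) * x 2)
  + (c 0 ^+ 2 + c 1 ^+ 2 + c 2 ^+ 2) * b i * (b 0 * x 0 + b 1 * x 1 + b 2 * x 2)
  + (b 0 ^+ 2 + b 1 ^+ 2 + b 2 ^+ 2) * c i * (c 0 * x 0 + c 1 * x 1 + c 2 * x 2)
  - (b 0 * c 0 + b 1 * c 1 + b 2 * c 2) * (b i * (c 0 * x 0 + c 1 * x 1 + c 2 * x 2)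
     + c i * (b 0 * x 0 + b 1 * x 1 + b 2 * x 2)).
  rewrite /nn /cross; clear; move: i; apply: ord3P; rewrite /=; ring.
by rewrite E Hb Hc Hn; ring.
Qed.

(** [a] stands for the unit vertical vector V, [b c] for the gradient of F^c, [Hs c] for its
    Hessian, and [W k] for nabla_{E_k} V. The hypotheses are the derivatives of dF (V) = 0 and of
    |V| = 1, the vanishing of the Hessians on (V, V), and the constancy along V of the inner
    products of gradients. The conclusion is nabla_X V = s V x X. *)
Lemma killing_algebra {R : idomainType} (b : 'I_2 -> 'I_3 -> R) (rho : R) (a : 'I_3 -> R)
    (Hs : 'I_2 -> 'I_3 -> 'I_3 -> R) (W : 'I_3 -> 'I_3 -> R) :
  (forall i, a i = rho * cross (b 0) (b 1) i) -> \sum_i a i * a i = 1 ->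
  (forall c i j, Hs c i j = Hs c j i) ->
  (forall k c, \sum_i W k i * b c i + \sum_i a i * Hs c k i = 0) ->
  (forall k, \sum_i W k i * a i = 0) ->
  (forall c, \sum_k \sum_i Hs c k i * a k * a i = 0) ->
  (forall c d, \sum_k a k * \sum_i (Hs c k i * b d i + Hs d k i * b c i) = 0) ->
  2 != 0 :> R ->
  let s := W 0 1 * a 2 + W 1 2 * a 0 + W 2 0 * a 1 in
  [/\ forall i, W i i = 0,
      W 0 1 = s * a 2 /\ W 1 0 = - (s * a 2),
      W 1 2 = s * a 0 /\ W 2 1 = - (s * a 0) &
      W 2 0 = s * a 1 /\ W 0 2 = - (s * a 1)].
Proof.
move=> aE a1 sHs Wb Wa Haa Hab t0 s.
have rho0 : rho != 0.
  apply/eqP => r0; move/eqP: a1; rewrite big1 ?(eq_sym _ 1) ?oner_eq0// => i _.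
  by rewrite aE r0 !mul0r.
have nn0 : \sum_i cross (b 0) (b 1) i * cross (b 0) (b 1) i != 0.
  apply/eqP => E; move/eqP: a1.
  have -> : \sum_i a i * a i = rho ^+ 2 * \sum_i cross (b 0) (b 1) i * cross (b 0) (b 1) i.
    by rewrite mulr_sumr; apply: eq_bigr => i _; rewrite !aE; ring.
  by rewrite E mulr0 eq_sym oner_eq0.
have FC (x : 'I_3 -> R) : (forall c, \sum_i b c i * x i = 0) -> \sum_i a i * x i = 0 ->
    forall i, x i = 0.
  move=> xb xa; apply: (frame_complete nn0 (xb 0) (xb 1)); apply: (mulfI rho0).
  rewrite mulr0 mulr_sumr -[RHS]xa; apply: eq_bigr => i _; by rewrite aE mulrA.
have Wb' k c : \sum_i b c i * W k i = - \sum_i a i * Hs c k i.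
  apply/eqP; rewrite -addr_eq0; apply/eqP; rewrite -[RHS](Wb k c).
  by congr (_ + _); apply: eq_bigr => i _; exact: mulrC.
(* nabla_V V = 0: its inner products with the gradients are minus the Hessians on (V, V), and it is
   orthogonal to V. *)
have aW i : \sum_k a k * W k i = 0.
  move: i; apply: FC.
    move=> c; transitivity (\sum_k a k * \sum_i b c i * W k i).
      by rewrite !sum3E; ring.
    under eq_bigr => k _ do rewrite Wb'.
    rewrite -[RHS]oppr0 -[in RHS](Haa c) !sum3E; ring.
  transitivity (\sum_k a k * \sum_i W k i * a i); first by rewrite !sum3E; ring.
  by rewrite big1// => k _; rewrite Wa mulr0.
(* V is a Killing field. The symmetrised derivative is tested on the basis b 0, b 1, a: on two
   gradients it is minus the derivative along V of their inner product, and if one argument is V it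
   vanishes by [aW] and |V| = 1. *)
have Q0 k i : W k i + W i k = 0.
  have Qb c j : \sum_i b c i * (W j i + W i j) = 0.
    move: j; apply: FC.
      move=> d; transitivity (\sum_k b d k * (\sum_i b c i * W k i) + \sum_k b c k * (\sum_i b d i * W k i)).
        by rewrite !sum3E; ring.
      under eq_bigr => j _ do rewrite Wb'.
      under [X in _ + X]eq_bigr => j _ do rewrite Wb'.
      transitivity (- \sum_k a k * \sum_i (Hs c k i * b d i + Hs d k i * b c i)).
        rewrite !sum3E (sHs c 1 0) (sHs c 2 0) (sHs c 2 1) (sHs d 1 0) (sHs d 2 0) (sHs d 2 1).
        ring.
      by rewrite Hab oppr0.
    transitivity (\sum_i b c i * (\sum_k W i k * a k) + \sum_k a k * (\sum_i b c i * W k i)).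
      by rewrite !sum3E; ring.
    under eq_bigr => j _ do rewrite Wa mulr0.
    under [X in _ + X]eq_bigr => j _ do rewrite Wb'.
    rewrite big1_eq add0r -[RHS]oppr0 -[in RHS](Haa c) !sum3E; ring.
  move: i; apply: FC; first by move=> c; exact: Qb.
  transitivity (\sum_i W k i * a i + \sum_i a i * W i k).
    by rewrite !sum3E; ring.
  by rewrite Wa aW addr0.
have WN k i : W i k = - W k i by apply/eqP; rewrite -addr_eq0 addrC Q0.
have Wd i : W i i = 0.
  apply: (mulfI t0); rewrite mulr0 -(Q0 i i); ring.
have a1' : a 0 * a 0 + a 1 * a 1 + a 2 * a 2 = 1 by rewrite -a1 sum3E.
have A0 := aW 0; have A1 := aW 1; have A2 := aW 2.
move: A0 A1 A2; rewrite !sum3E !Wd (WN 0 1) (WN 1 2) (WN 2 0) => A0 A1 A2.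
(* A skew W with the unit vector a in its kernel is a multiple of the cross product with a. Each
   entry is multiplied by |a|^2 = 1, and the kernel equations turn the result into s times a
   component of a. *)
have W01 : W 0 1 = s * a 2.
  rewrite /s -[LHS]mul1r -a1'.
  transitivity (a 0 * (a 0 * W 0 1 + a 1 * 0 + a 2 * - W 1 2)
     - a 1 * (a 0 * 0 + a 1 * - W 0 1 + a 2 * W 2 0)
     + (W 0 1 * a 2 + W 1 2 * a 0 + W 2 0 * a 1) * a 2); first by ring.
  by rewrite A0 A1; ring.
have W12 : W 1 2 = s * a 0.
  rewrite /s -[LHS]mul1r -a1'.
  transitivity (a 1 * (a 0 * - W 2 0 + a 1 * W 1 2 + a 2 * 0)
     - a 2 * (a 0 * W 0 1 + a 1 * 0 + a 2 * - W 1 2)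
     + (W 0 1 * a 2 + W 1 2 * a 0 + W 2 0 * a 1) * a 0); first by ring.
  by rewrite A2 A1; ring.
have W20 : W 2 0 = s * a 1.
  rewrite /s -[LHS]mul1r -a1'.
  transitivity (a 2 * (a 0 * 0 + a 1 * - W 0 1 + a 2 * W 2 0)
     - a 0 * (a 0 * - W 2 0 + a 1 * W 1 2 + a 2 * 0)
     + (W 0 1 * a 2 + W 1 2 * a 0 + W 2 0 * a 1) * a 1); first by ring.
  by rewrite A2 A0; ring.
by split=> //; split => //; congr (- _).
Qed.

Lemma sym3 {T : Type} (B : 'I_3 -> 'I_3 -> T) :
  B 0 1 = B 1 0 -> B 0 2 = B 2 0 -> B 1 2 = B 2 1 -> forall i j, B i j = B j i.
Proof. by move=> h1 h2 h3; apply: ord3P; apply: ord3P. Qed.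

(** * Commutators, connection and Hessian in the frame *)

Section FrameRules.
Context {R : realType}.
Variables m l : R.
Implicit Types (p : 'rV[R]_3) (U : set 'rV[R]_3) (u v : 'rV[R]_3 -> R).
Notation f p := (bcv_factor m (p 0 0) (p 0 1)).
Notation fr := (fr m l).
Notation E := (bcv_frame m l).

Lemma is_derive_bcv_factor n (i j : 'I_n) (p v : 'rV[R]_n) :
  is_derive p v (fun q : 'rV[R]_n => bcv_factor m (q 0 i) (q 0 j))
    (2 * m * (p 0 i * v 0 i + p 0 j * v 0 j)).
Proof.
apply: derive_rule_eq; first by rewrite /bcv_factor; derive_solve.
by rewrite /=; ring.
Qed.

Lemma fr_leaf i u p : differentiable u p -> is_derive p (row i (E p)) u (fr i u p).
Proof. by rewrite fr.unlock; exact: derive_rule_leaf. Qed.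

Lemma fr_coord i j p : is_derive p (row i (E p)) (fun q : 'rV[R]_3 => q 0 j) (E p i j).
Proof. by apply: derive_rule_eq; [exact: is_derive_coord|rewrite mxE]. Qed.

Lemma fr_factor i p : is_derive p (row i (E p)) (fun q : 'rV[R]_3 => f q)
  (2 * m * (p 0 0 * E p i 0 + p 0 1 * E p i 1)).
Proof. by apply: derive_rule_eq; [exact: is_derive_bcv_factor|rewrite ![row _ _ _ _]mxE]. Qed.

Lemma near_fr U i u v p : open U -> U p -> (forall q, U q -> u q = v q) ->
  fr i u p = fr i v p.
Proof. by move=> oU Up uv; rewrite fr.unlock; apply: near_eq_derive; exact: near_of_open oU Up uv. Qed.

Lemma fr_rule i u p d d' : is_derive p (row i (E p)) u d -> d = d' -> fr i u p = d'.
Proof. by rewrite fr.unlock; exact: derive_rule. Qed.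

End FrameRules.

Arguments near_fr {R m l U} i {u v p}.

Section FrameCalculus.
Context {R : realType}.
Variables m l : R.
Implicit Types (p : 'rV[R]_3) (U : set 'rV[R]_3) (u v : 'rV[R]_3 -> R).
Notation f p := (bcv_factor m (p 0 0) (p 0 1)).
Notation fr := (fr m l).
Notation E := (bcv_frame m l).

Lemma fr_fr0 i U u p : open U -> U p -> smooth U u ->
  fr i (fr 0 u) p = f p * fr i (dcoord 0 u) p
   + dcoord 0 u p * (2 * m * (p 0 0 * E p i 0 + p 0 1 * E p i 1))
   - l / 2 * (p 0 1 * fr i (dcoord 2 u) p + dcoord 2 u p * E p i 1).
Proof.
move=> oU Up su; have dpd j : differentiable (dcoord j u) p.
  exact: smooth_differentiable (smooth_dcoord j su) Up.
rewrite (near_fr i (v := fun q => f q * dcoord 0 u q - l / 2 * q 0 1 * dcoord 2 u q) oU Up); last first.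
  by move=> q Uq; rewrite fr0E//; exact: smooth_differentiable su Uq.
apply: fr_rule.
  apply: derive_ruleD; first by apply: derive_ruleM; [exact: fr_factor|exact: fr_leaf].
  apply: derive_ruleN; apply: derive_ruleM; last exact: fr_leaf.
  by apply: derive_ruleM; exact: fr_coord.
move: (fr i (dcoord 0 u) p) (fr i (dcoord 2 u) p) (dcoord 0 u p) (dcoord 2 u p) (E p i 0) (E p i 1).
by move=> a b c d e0 e1; rewrite /=; ring.
Qed.

Lemma fr_fr1 i U u p : open U -> U p -> smooth U u ->
  fr i (fr 1 u) p = f p * fr i (dcoord 1 u) p
   + dcoord 1 u p * (2 * m * (p 0 0 * E p i 0 + p 0 1 * E p i 1))
   + l / 2 * (p 0 0 * fr i (dcoord 2 u) p + dcoord 2 u p * E p i 0).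
Proof.
move=> oU Up su; have dpd j : differentiable (dcoord j u) p.
  exact: smooth_differentiable (smooth_dcoord j su) Up.
rewrite (near_fr i (v := fun q => f q * dcoord 1 u q + l / 2 * q 0 0 * dcoord 2 u q) oU Up); last first.
  by move=> q Uq; rewrite fr1E//; exact: smooth_differentiable su Uq.
apply: fr_rule.
  apply: derive_ruleD; first by apply: derive_ruleM; [exact: fr_factor|exact: fr_leaf].
  apply: derive_ruleM; last exact: fr_leaf.
  by apply: derive_ruleM; exact: fr_coord.
move: (fr i (dcoord 1 u) p) (fr i (dcoord 2 u) p) (dcoord 1 u p) (dcoord 2 u p) (E p i 0) (E p i 1).
by move=> a b c d e0 e1; rewrite /=; ring.
Qed.

Lemma fr_fr2 i U u p : open U -> U p -> smooth U u ->
  fr i (fr 2 u) p = fr i (dcoord 2 u) p.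
Proof.
move=> oU Up su; apply: (near_fr i oU Up) => q Uq.
by rewrite fr2E//; exact: smooth_differentiable su Uq.
Qed.

Section Commutators.
Variables (U : set 'rV[R]_3) (u : 'rV[R]_3 -> R) (p : 'rV[R]_3).
Hypotheses (oU : open U) (Up : U p) (su : smooth U u).

Let du : differentiable u p. Proof. exact: smooth_differentiable su Up. Qed.
Let dpd j : differentiable (dcoord j u) p.
Proof. exact: smooth_differentiable (smooth_dcoord j su) Up. Qed.

Lemma fr_comm01 : fr 0 (fr 1 u) p - fr 1 (fr 0 u) p =
  - (2 * m * p 0 1) * fr 0 u p + 2 * m * p 0 0 * fr 1 u p + l * fr 2 u p.
Proof.
have [D DE sD] : {D | (forall i j, dcoord i (dcoord j u) p = D i j) & forall i j, D i j = D j i}.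
  by exists (fun i j => dcoord i (dcoord j u) p) => i j; [exact: erefl|exact: (dcoord_comm i j oU Up su)].
have [d dE] : {d | forall i, dcoord i u p = d i} by exists (fun i => dcoord i u p).
have frpd i j := frE m l i (dpd j); have fru i := frE m l i du.
rewrite (fr_fr1 0 oU Up su) (fr_fr0 1 oU Up su) !frpd !fru !sum3E !DE !dE !mxE /=.
rewrite (sD 1 0) (sD 2 0) (sD 2 1) /bcv_factor.
by move: (p 0 0) (p 0 1) => x y; field.
Qed.

Lemma fr_comm02 : fr 0 (fr 2 u) p = fr 2 (fr 0 u) p.
Proof.
have [D DE sD] : {D | (forall i j, dcoord i (dcoord j u) p = D i j) & forall i j, D i j = D j i}.
  by exists (fun i j => dcoord i (dcoord j u) p) => i j; [exact: erefl|exact: (dcoord_comm i j oU Up su)].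
have [d dE] : {d | forall i, dcoord i u p = d i} by exists (fun i => dcoord i u p).
have frpd i j := frE m l i (dpd j); have fru i := frE m l i du.
rewrite (fr_fr2 0 oU Up su) (fr_fr0 2 oU Up su) !frpd !sum3E !DE !dE !mxE /=.
by rewrite (sD 2 0); ring.
Qed.

Lemma fr_comm12 : fr 1 (fr 2 u) p = fr 2 (fr 1 u) p.
Proof.
have [D DE sD] : {D | (forall i j, dcoord i (dcoord j u) p = D i j) & forall i j, D i j = D j i}.
  by exists (fun i j => dcoord i (dcoord j u) p) => i j; [exact: erefl|exact: (dcoord_comm i j oU Up su)].
have [d dE] : {d | forall i, dcoord i u p = d i} by exists (fun i => dcoord i u p).
have frpd i j := frE m l i (dpd j); have fru i := frE m l i du.
rewrite (fr_fr2 1 oU Up su) (fr_fr1 2 oU Up su) !frpd !sum3E !DE !dE !mxE /=.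
by rewrite (sD 2 1); ring.
Qed.

(** The subtracted first-order term is the derivative of u along the sum of the nabla_{E_k} E_k; it
    cancels the terms produced by the variable coefficients of the frame. *)
Lemma frame_laplacian_expand :
  fr 0 (fr 0 u) p + fr 1 (fr 1 u) p + fr 2 (fr 2 u) p
    - 2 * m * (p 0 1 * fr 1 u p + p 0 0 * fr 0 u p) =
  \sum_i \sum_j ((E p)^T *m E p) i j * pd i (pd j u) p.
Proof.
transitivity (\sum_i \sum_j ((E p)^T *m E p) i j * dcoord i (dcoord j u) p); last first.
  by rewrite dcoord.unlock.
have [D DE sD] : {D | (forall i j, dcoord i (dcoord j u) p = D i j) & forall i j, D i j = D j i}.
  by exists (fun i j => dcoord i (dcoord j u) p) => i j; [exact: erefl|exact: (dcoord_comm i j oU Up su)].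
have [d dE] : {d | forall i, dcoord i u p = d i} by exists (fun i => dcoord i u p).
have frpd i j := frE m l i (dpd j); have fru i := frE m l i du.
rewrite (fr_fr0 0 oU Up su) (fr_fr1 1 oU Up su) (fr_fr2 2 oU Up su).
rewrite !frpd !fru !sum3E !DE !dE !mxE !sum3E !mxE /=.
by rewrite (sD 1 0) (sD 2 0) (sD 2 1); ring.
Qed.

End Commutators.

(* [omega p k i j] is the E_j component of the Levi-Civita derivative of E_i along E_k. *)
Definition omega p (k i j : 'I_3) : R :=
  (nth [::] (nth [::]
   [:: [:: [:: 0; 2 * m * p 0 1; 0]; [:: - (2 * m * p 0 1); 0; l / 2]; [:: 0; - (l / 2); 0]];
       [:: [:: 0; - (2 * m * p 0 0); - (l / 2)]; [:: 2 * m * p 0 0; 0; 0]; [:: l / 2; 0; 0]];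
       [:: [:: 0; - (l / 2); 0]; [:: l / 2; 0; 0]; [:: 0; 0; 0]]] k) i)`_j.

Lemma omega_sumE p (x : 'I_3 -> R) :
  [/\ [/\ \sum_j omega p 0 0 j * x j = 2 * m * p 0 1 * x 1,
          \sum_j omega p 0 1 j * x j = - (2 * m * p 0 1) * x 0 + l / 2 * x 2 &
          \sum_j omega p 0 2 j * x j = - (l / 2) * x 1],
      [/\ \sum_j omega p 1 0 j * x j = - (2 * m * p 0 0) * x 1 - l / 2 * x 2,
          \sum_j omega p 1 1 j * x j = 2 * m * p 0 0 * x 0 &
          \sum_j omega p 1 2 j * x j = l / 2 * x 0] &
      [/\ \sum_j omega p 2 0 j * x j = - (l / 2) * x 1,
          \sum_j omega p 2 1 j * x j = l / 2 * x 0 &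
          \sum_j omega p 2 2 j * x j = 0]].
Proof. by split; split; rewrite sum3E /omega /=; ring. Qed.

Definition hess u p (k i : 'I_3) : R :=
  fr k (fr i u) p - \sum_j omega p k i j * fr j u p.

Lemma omega_antisym p k i j : omega p k i j = - omega p k j i.
Proof.
by move: k i j; apply: ord3P; apply: ord3P; apply: ord3P;
  rewrite /omega /= ?oppr0 ?opprK.
Qed.

(** The connection [omega] is torsion-free: its antisymmetric part in k and i gives the coefficients
    of [E_k, E_i] found in the commutator lemmas. *)
Lemma hess_sym U u p k i : open U -> U p -> smooth U u -> hess u p k i = hess u p i k.
Proof.
move=> oU Up su; have c01 := fr_comm01 oU Up su; have c02 := fr_comm02 oU Up su.
have c12 := fr_comm12 oU Up su.
have [[_ w01 w02] [w10 _ w12] [w20 w21 _]] := omega_sumE p (fun j => fr j u p).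
apply: sym3; rewrite /hess.
- rewrite w01 w10; apply/eqP; rewrite -subr_eq0; apply/eqP.
  transitivity (fr 0 (fr 1 u) p - fr 1 (fr 0 u) p - (- (2 * m * p 0 1) * fr 0 u p
     + 2 * m * p 0 0 * fr 1 u p + l * fr 2 u p)); first by field.
  by rewrite c01 subrr.
- by rewrite w02 ?w20 c02.
- by rewrite w12 ?w21 c12.
Qed.

Lemma smooth_omega U k i j : open U -> smooth U (fun p => omega p k i j).
Proof.
move=> oU; have sc h (c : R) : smooth U (fun p : 'rV[R]_3 => c * p 0 h).
  by apply: smoothM => //; [exact: smooth_cst|exact: smooth_coord].
have s0 (c : R) : smooth U (fun _ : 'rV[R]_3 => c) by exact: smooth_cst.
by move: k i j; apply: ord3P; apply: ord3P; apply: ord3P; rewrite /omega /=;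
  by [exact: s0|exact: sc|apply: smoothN => //; exact: sc].
Qed.

End FrameCalculus.

(** * The vertical field of a harmonic Riemannian submersion *)

Section SubmersionAlgebra.
Context {R : realType} {n k : nat}.

(** Rows of E form an orthonormal frame, so g^-1 = E^T E, and S = J^T g^-1 J is the matrix of inner
    products of the gradients of the components. Horizontal vectors are the w J^T g^-1; isometry on
    them reads S h S = S, and S is invertible by surjectivity, so S h = 1. *)
Lemma submersion_gram (E g : 'M[R]_n) (J : 'M[R]_(n, k)) (h : 'M[R]_k) :
  E *m g *m E^T = 1%:M ->
  (forall w : 'rV_k, exists v : 'rV_n, v *m J = w) ->
  (forall v w : 'rV_n, (forall u, u *m J = 0 -> ip g u v = 0) ->
     (forall u, u *m J = 0 -> ip g u w = 0) -> ip h (v *m J) (w *m J) = ip g v w) ->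
  (E *m J)^T *m (E *m J) *m h = 1%:M.
Proof.
move=> EgE surj iso.
have Eu : E \in unitmx by move: EgE; rewrite -mulmxA => /mulmx1_unit[].
have [gi giE] : {gi | gi = E^T *m E} by exists (E^T *m E).
have ggi : g *m gi = 1%:M.
  by move: EgE; rewrite giE -mulmxA => /mulmx1C; rewrite -mulmxA.
have giT : gi^T = gi by rewrite giE trmx_mul trmxK.
have [A AE] : {A | A = J^T *m gi} by exists (J^T *m gi).
have [S SdE] : {S | S = A *m J} by exists (A *m J).
have SE : (E *m J)^T *m (E *m J) = S.
  by rewrite SdE AE giE trmx_mul !mulmxA.
have hor (w : 'rV_k) u : u *m J = 0 -> ip g u (w *m A) = 0.
  move=> uJ; rewrite /ip AE !trmx_mul trmxK giT !mulmxA -(mulmxA u) ggi mulmx1 uJ.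
  by rewrite mul0mx mxE.
have key (v w : 'rV_k) : ip h (v *m S) (w *m S) = ip S v w.
  have := iso (v *m A) (w *m A) (hor v) (hor w); rewrite SdE !mulmxA => ->.
  rewrite /ip AE !trmx_mul trmxK giT !mulmxA; congr (_ 0 0).
  by rewrite -(mulmxA _ g gi) ggi mulmx1.
have ST : S^T = S by rewrite SdE AE !trmx_mul trmxK giT mulmxA.
have ip_delta (M : 'M[R]_k) i j : ip M (delta_mx 0 i) (delta_mx 0 j) = M i j.
  by rewrite /ip -rowE trmx_delta -colE !mxE.
have ShS : S *m h *m S = S.
  apply/matrixP => i j; rewrite -[RHS]ip_delta -key /ip !trmx_mul ST.
  rewrite -[LHS]ip_delta /ip !mulmxA; congr (_ 0 0).
(* If w S = 0, then w S w^T is the squared length of w J^T E^T, so w J^T = 0 and w is orthogonal to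
   the image of J, which is everything. *)
have Su : S \in unitmx.
  rewrite -row_free_unit; apply: inj_row_free => w wS.
  have wJ : w *m J^T = 0.
    suff : w *m J^T *m E^T = 0.
      have Et : E^T \in unitmx by rewrite unitmx_tr.
      by move=> H; apply: (can_inj (mulmxK Et)); rewrite H mul0mx.
    set r := w *m J^T *m E^T.
    have r0 : (r *m r^T) 0 0 = 0.
      rewrite /r !trmx_mul !trmxK.
      have -> : w *m J^T *m E^T *m (E *m (J *m w^T)) = w *m S *m w^T.
        by rewrite SdE AE giE !mulmxA.
      by rewrite wS mul0mx mxE.
    apply/rowP => i; rewrite [RHS]mxE; apply/eqP; rewrite -sqrf_eq0.
    move: r0; rewrite mxE => /eqP; rewrite psumr_eq0.
      by move=> /allP/(_ i (mem_index_enum _)) /=; rewrite [r^T _ _]mxE -expr2.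
    by move=> j _; rewrite [r^T _ _]mxE -expr2 sqr_ge0.
  apply/rowP => i; have [v vJ] := surj (delta_mx 0 i).
  have : (w *m (v *m J)^T) 0 0 = 0 by rewrite trmx_mul mulmxA wJ mul0mx mxE.
  by rewrite vJ trmx_delta -colE !mxE.
by rewrite SE; apply: (can_inj (mulmxK Su)); rewrite ShS mul1mx.
Qed.

End SubmersionAlgebra.

Lemma antisym_sum3 {R : idomainType} (w : 'I_3 -> 'I_3 -> R) (x y : 'I_3 -> R) :
  2 != 0 :> R -> (forall i j, w i j = - w j i) ->
  \sum_i \sum_j w i j * (x j * y i + y j * x i) = 0.
Proof.
move=> t0 aw; have d i : w i i = 0.
  by apply: (mulfI t0); rewrite mulr0 mulr_natl mulr2n {1}aw addNr.
by rewrite !sum3E !d (aw 1 0) (aw 2 0) (aw 2 1); ring.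
Qed.

Section Laplacian.
Context {R : realType}.
Variables m l : R.
Notation f p := (bcv_factor m (p 0 0) (p 0 1)).

Lemma frame_laplacian (U : set 'rV[R]_3) u p : open U -> U p -> smooth U u ->
  \sum_k hess m l u p k k =
  \sum_i \sum_j ((bcv_frame m l p)^T *m bcv_frame m l p) i j * pd i (pd j u) p.
Proof.
move=> oU Up su; rewrite -(frame_laplacian_expand m l oU Up su) sum3E /hess.
have [[-> _ _] [_ -> _] [_ _ ->]] := omega_sumE m l p (fun j => fr m l j u p).
ring.
Qed.

End Laplacian.

(* nabla_X V = (s - l / 2) V x X for the field V = sum_i v i * E_i: its integral curves are
   geodesics, and V is a Killing field. *)
Definition killing_equations {R : realType} (m l : R) (v : 'I_3 -> 'rV[R]_3 -> R)
    (s : 'rV[R]_3 -> R) (p : 'rV[R]_3) : Prop :=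
  [/\ [/\ fr m l 0 (v 0) p = 2 * m * p 0 1 * v 1 p,
          fr m l 0 (v 1) p = - (2 * m * p 0 1) * v 0 p + s p * v 2 p &
          fr m l 0 (v 2) p = - s p * v 1 p],
      [/\ fr m l 1 (v 0) p = - (2 * m * p 0 0) * v 1 p - s p * v 2 p,
          fr m l 1 (v 1) p = 2 * m * p 0 0 * v 0 p &
          fr m l 1 (v 2) p = s p * v 0 p] &
      [/\ fr m l 2 (v 0) p = (s p - l) * v 1 p,
          fr m l 2 (v 1) p = (l - s p) * v 0 p &
          fr m l 2 (v 2) p = 0]].

Section Vertical.
Context {R : realType}.
Variables m l : R.
Notation f p := (bcv_factor m (p 0 0) (p 0 1)).
Notation E := (bcv_frame m l).
Variables (O : set 'rV[R]_3) (W : set 'rV[R]_2) (F : 'rV[R]_3 -> 'rV[R]_2)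
  (H : 'rV[R]_2 -> 'M[R]_2).
Hypotheses (oO : open O) (Of : forall p, O p -> f p != 0).
Hypotheses (oW : open W) (OW : forall p, O p -> W (F p)).
Hypotheses (sF : smooth O F) (sH : forall i j, smooth W (fun y => H y i j)).
Hypothesis symH : forall y i j, W y -> H y i j = H y j i.
Hypothesis dH : forall y, W y -> \det (H y) != 0.
Hypothesis gram : forall p, O p ->
  (E p *m jac F p)^T *m (E p *m jac F p) *m H (F p) = 1%:M.
Hypothesis harm : forall p, O p -> tension (bcv_metric m l) H F p = 0.

Let Fc c q := F q 0 c.
Let b p c i := fr m l i (Fc c) p.
Let Hs p c k i := hess m l (Fc c) p k i.
Let u y a c := invmx (H y) a c.

Let sFc c : smooth O (Fc c). Proof. exact: smooth_entry. Qed.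

Let dF p : O p -> differentiable F p.
Proof. by move=> Op; exact: smooth_differentiable sF Op. Qed.

Let dFc c p : O p -> differentiable (Fc c) p.
Proof. by move=> Op; exact: smooth_differentiable (sFc c) Op. Qed.

Let sb c i : smooth O (fun p => b p c i). Proof. exact: smooth_fr. Qed.

Let su a c : smooth W (fun y => u y a c). Proof. exact: smooth_invmx. Qed.

Let EJ p i c : O p -> (E p *m jac F p) i c = b p c i.
Proof.
move=> Op; rewrite mxE /b frE; last exact: dFc.
by apply: eq_bigr => j _; rewrite [jac _ _ _ _]mxE dcoord.unlock.
Qed.

Let gramE p a c : O p -> \sum_i b p a i * b p c i = u (F p) a c.
Proof.
move=> Op; have := gram Op; set S := _ *m (E p *m jac F p) => SH.
have Hu : H (F p) \in unitmx by have [] := mulmx1_unit SH.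
have -> : u (F p) a c = S a c by rewrite /u -[invmx _]mul1mx -SH mulmxK.
by rewrite /S mxE; apply: eq_bigr => i _; rewrite [_^T _ _]mxE !EJ.
Qed.

Let fr_compF (g : 'rV[R]_2 -> R) k p : O p -> smooth W g ->
  is_derive p (row k (E p)) (fun q => g (F q)) (\sum_d pd d g (F p) * b p d k).
Proof.
move=> Op sg; have dg := smooth_differentiable sg (OW Op).
have [dgF Ev] := derive_compose (row k (E p)) (dF Op) dg.
apply: derive_rule_eq; first exact: derive_rule_leaf.
rewrite Ev -deriveE// derive_pd//; apply: eq_bigr => d _; rewrite mulrC; congr (_ * _).
rewrite -deriveE; last exact: dF.
rewrite -derive_entry; last exact: dF.
by rewrite /b fr.unlock.
Qed.

Let fr_b k c i p : O p ->
  is_derive p (row k (E p)) (fun q => b q c i) (fr m l k (fr m l i (Fc c)) p).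
Proof. by move=> Op; apply: fr_leaf; exact: smooth_differentiable (sb c i) Op. Qed.

Let fr_bE k c i p : fr m l k (fr m l i (Fc c)) p =
  Hs p c k i + \sum_j omega m l p k i j * b p c j.
Proof. by rewrite /Hs /hess subrK. Qed.

Let two_neq0 : 2 != 0 :> R. Proof. by rewrite pnatr_eq0. Qed.

(** Derivative of [gramE] along E_k. Replacing second frame derivatives by Hessians adds terms in
    [omega], which cancel because [omega] is skew and they are symmetric. *)
Let hess_gram a c k p : O p ->
  \sum_i (Hs p a k i * b p c i + Hs p c k i * b p a i)
    = \sum_d pd d (fun y => u y a c) (F p) * b p d k.
Proof.
move=> Op; have [_ <-] := fr_compF k Op (su a c).
transitivity ('D_(row k (E p)) (fun q => \sum_i b q a i * b q c i) p); last first.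
  by apply: near_eq_derive; apply: near_of_open oO Op _ => q Oq; exact: gramE.
symmetry; apply: derive_rule.
  by apply: derive_rule_sum => i; apply: derive_ruleM; exact: fr_b.
have := antisym_sum3 (b p a) (b p c) two_neq0 (omega_antisym m l p k).
move=> A; rewrite -[RHS]addr0 -[X in _ = _ + X]A -big_split /=; apply: eq_bigr => i _.
rewrite !fr_bE; have [h [h1 h2]] : exists h, h a = Hs p a k i /\ h c = Hs p c k i.
  by exists (fun a => Hs p a k i).
rewrite -h1 -h2.
have -> : \sum_j omega m l p k i j * (b p a j * b p c i + b p c j * b p a i) =
    b p c i * (\sum_j omega m l p k i j * b p a j)
    + b p a i * (\sum_j omega m l p k i j * b p c j).
  by rewrite !mulr_sumr -big_split /=; apply: eq_bigr => j _; ring.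
by ring.
Qed.

(** The tension equation in the orthonormal frame: the Christoffel symbols of the source drop out by
    [bcv_harmonic_coordinates], and the inverse metric contracted with two first derivatives of F
    gives [u] by [gramE]. *)
Let hess_trace c p : O p ->
  \sum_k Hs p c k k
    + \sum_a \sum_e christoffel H c a e (F p) * u (F p) a e = 0.
Proof.
move=> Op; have Op' := Of Op; have /rowP/(_ c) := harm Op; rewrite /tension !mxE.
rewrite /Hs (frame_laplacian m l oO Op (sFc c)) -(bcv_metric_inv l Op') => T0.
set g := invmx (bcv_metric m l p) in T0 *.
have gJ a e : \sum_i \sum_j g i j * (pd i (Fc a) p * pd j (Fc e) p) = u (F p) a e.
  rewrite -gramE// /g bcv_metric_inv//.
  transitivity (((E p *m jac F p)^T *m (E p *m jac F p)) a e); last first.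
    by rewrite mxE; apply: eq_bigr => i _; rewrite [_^T _ _]mxE !EJ.
  rewrite trmx_mul -mulmxA (mulmxA _ (E p)) mxE; apply: eq_bigr => i _.
  rewrite [(jac F p)^T _ _]mxE [X in _ = _ * X]mxE mulr_sumr; apply: eq_bigr => j _.
  by rewrite ![jac _ _ _ _]mxE mulrCA mulrA.
have K0 := fun k => bcv_harmonic_coordinates l k Op'.
rewrite -[RHS]T0 /second_fund_form.
under [RHS]eq_bigr => i _ do under eq_bigr => j _ do rewrite mulrDr mulrBr.
under [RHS]eq_bigr => i _ do rewrite big_split sumrB /=.
rewrite big_split sumrB /=.
rewrite [X in _ = _ - X + _](_ : _ = 0) ?subr0; last first.
  transitivity (\sum_k pd k (Fc c) p *
     \sum_i \sum_j g i j * christoffel (bcv_metric m l) k i j p).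
    rewrite exchange_big /=.
    under [RHS]eq_bigr => k _ do rewrite mulr_sumr.
    rewrite [RHS]exchange_big /= exchange_big /=; apply: eq_bigr => i _.
    under [RHS]eq_bigr => k _ do rewrite mulr_sumr.
    rewrite [RHS]exchange_big /=; apply: eq_bigr => j _.
    rewrite mulr_sumr; apply: eq_bigr => k _; by rewrite mulrA [LHS]mulrC.
  by rewrite big1// => k _; rewrite K0 mulr0.
congr (_ + _).
under eq_bigr => a _ do under eq_bigr => e _ do rewrite -gJ mulr_sumr.
transitivity (\sum_a \sum_e \sum_i \sum_j
    g i j * (christoffel H c a e (F p) * pd i (Fc a) p * pd j (Fc e) p)).
  apply: eq_bigr => a _; apply: eq_bigr => e _; apply: eq_bigr => i _.
  rewrite mulr_sumr; apply: eq_bigr => j _; rewrite mulrCA; congr (_ * _).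
  by rewrite mulrA.
transitivity (\sum_a \sum_i \sum_e \sum_j
    g i j * (christoffel H c a e (F p) * pd i (Fc a) p * pd j (Fc e) p)).
  by apply: eq_bigr => a _; rewrite exchange_big.
rewrite exchange_big /=; apply: eq_bigr => i _.
transitivity (\sum_a \sum_j \sum_e
    g i j * (christoffel H c a e (F p) * pd i (Fc a) p * pd j (Fc e) p)).
  by apply: eq_bigr => a _; rewrite exchange_big.
rewrite exchange_big /=; apply: eq_bigr => j _.
rewrite mulr_sumr; apply: eq_bigr => a _.
by rewrite mulr_sumr.
Qed.

Let duE d a c p : O p -> pd d (fun y => u y a c) (F p) =
  - \sum_i \sum_j u (F p) a i * pd d (fun y => H y i j) (F p) * u (F p) j c.
Proof.
move=> /OW; move: (F p) => y Wy.
have uH z i j : W z -> \sum_e u z i e * H z e j = (i == j)%:R.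
  move=> Wz; have Hu : H z \in unitmx by rewrite unitmxE unitfE dH.
  by have /matrixP/(_ i j) := mulVmx Hu; rewrite !mxE.
have Hu z i j : W z -> \sum_e H z i e * u z e j = (i == j)%:R.
  move=> Wz; have Hz : H z \in unitmx by rewrite unitmxE unitfE dH.
  by have /matrixP/(_ i j) := mulmxV Hz; rewrite !mxE.
have D j : \sum_e pd d (fun y => u y a e) y * H y e j
     = - \sum_e u y a e * pd d (fun y => H y e j) y.
  apply/eqP; rewrite -addr_eq0 -big_split /=; apply/eqP.
  have : pd d (fun z => \sum_e u z a e * H z e j) y = pd d (fun=> (a == j)%:R) y.
    by apply: near_eq_derive; apply: near_of_open oW Wy _ => z Wz; exact: uH.
  rewrite [RHS]derive_cst => E0; apply: (eq_trans _ E0); symmetry; apply: derive_rule.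
    apply: derive_rule_sum => e; apply: derive_ruleM; apply: derive_rule_leaf.
      exact: smooth_differentiable (su a e) Wy.
    exact: smooth_differentiable (sH e j) Wy.
  by apply: eq_bigr => e _; rewrite addrC; congr (_ + _); rewrite mulrC.
transitivity (\sum_j (\sum_e pd d (fun y => u y a e) y * H y e j) * u y j c).
  transitivity (\sum_e pd d (fun y => u y a e) y * \sum_j H y e j * u y j c).
    under eq_bigr => e _ do rewrite Hu//.
    by rewrite (bigD1 c)//= eqxx mulr1 big1 ?addr0// => e /negPf ec; rewrite ec mulr0.
  under eq_bigr => e _ do rewrite mulr_sumr.
  rewrite exchange_big /=; apply: eq_bigr => j _.
  by rewrite mulr_suml; apply: eq_bigr => e _; rewrite mulrA.
under eq_bigr => j _ do rewrite D mulNr mulr_suml.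
by rewrite sumrN exchange_big.
Qed.

(** The vertical direction as the cross product of the gradients of the two components of F: this
    makes it smooth, with a sign fixed throughout [O]. *)
Let nrm p i := cross (b p 0) (b p 1) i.
Let nn p := \sum_i nrm p i * nrm p i.
Let rho p := (Num.sqrt (nn p))^-1.
Let a i p := rho p * nrm p i.

(** By Lagrange's identity |b 0 x b 1|^2 is the Gram determinant, here the determinant of the
    inverse metric of the target. *)
Let nn_gt0 p : O p -> 0 < nn p.
Proof.
move=> Op; rewrite lt_def sumr_ge0; last by move=> i _; rewrite -expr2 sqr_ge0.
rewrite andbT; have -> : nn p = \det (invmx (H (F p))).
  rewrite det2E -!/(u (F p) _ _) -!gramE// /nn /nrm /cross !sum3E /=.
  by move: (b p 0) (b p 1) => x y; ring.
by rewrite det_inv invr_neq0// dH//; exact: OW.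
Qed.

Let snrm i : smooth O (fun p => nrm p i).
Proof.
by move: i; apply: ord3P; rewrite /nrm /cross /=; apply: smoothB => //; exact: smoothM.
Qed.

Let sa i : smooth O (a i).
Proof.
have snn : smooth O nn by apply: smooth_sum => // j; exact: smoothM.
apply: smoothM => //; apply: smoothV => //; last exact: smooth_sqrt.
by move=> p Op; rewrite gt_eqF// sqrtr_gt0 nn_gt0.
Qed.

Let a_unit p : O p -> \sum_i a i p * a i p = 1.
Proof.
move=> Op; transitivity (rho p ^+ 2 * nn p).
  by rewrite mulr_sumr; apply: eq_bigr => i _; rewrite /a; ring.
by rewrite /rho exprVn sqr_sqrtr ?mulVf// ?gt_eqF ?nn_gt0// ltW// nn_gt0.
Qed.

Let a_vertical c p : \sum_i a i p * b p c i = 0.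
Proof.
rewrite !sum3E /a /nrm /cross /=; move: c; apply: ord2P;
  by move: (b p 0) (b p 1) (rho p) => x y r; ring.
Qed.

Let fr_a k i p : O p -> is_derive p (row k (E p)) (a i) (fr m l k (a i) p).
Proof. by move=> Op; apply: fr_leaf; exact: smooth_differentiable (sa i) Op. Qed.

(* [W' p k i] is the E_i component of the covariant derivative of the unit vertical field
   along E_k. *)
Let W' p k i := fr m l k (a i) p + \sum_j omega m l p k j i * a j p.

Let W'b p k c : O p -> \sum_i W' p k i * b p c i + \sum_i a i p * Hs p c k i = 0.
Proof.
move=> Op; have : fr m l k (fun q => \sum_i a i q * b q c i) p = fr m l k (fun=> 0) p.
  by apply: (near_fr k oO Op) => q _; exact: a_vertical.
rewrite (fr_rule (derive_rule_cst _ _ _) erefl).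
rewrite (fr_rule (d := \sum_i (a i p * fr m l k (fr m l i (Fc c)) p + b p c i * fr m l k (a i) p))
  _ erefl); last first.
  by apply: derive_rule_sum => i; apply: derive_ruleM; [exact: fr_a|exact: fr_b].
move=> D0; apply: (eq_trans _ D0).
have X : \sum_i \sum_j omega m l p k j i * a j p * b p c i =
    \sum_i a i p * \sum_j omega m l p k i j * b p c j.
  rewrite exchange_big /=; apply: eq_bigr => i _; rewrite mulr_sumr.
  by apply: eq_bigr => j _; ring.
transitivity (\sum_i fr m l k (a i) p * b p c i
   + \sum_i \sum_j omega m l p k j i * a j p * b p c i + \sum_i a i p * Hs p c k i).
  congr (_ + _); rewrite -big_split /=; apply: eq_bigr => i _.
  by rewrite /W' mulrDl mulr_suml.
rewrite X -!big_split /=; apply: eq_bigr => i _; rewrite fr_bE.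
have [h hE] : exists h, h = Hs p c k i by exists (Hs p c k i).
by rewrite -hE; ring.
Qed.

Let W'a p k : O p -> \sum_i W' p k i * a i p = 0.
Proof.
move=> Op; have : fr m l k (fun q => \sum_i a i q * a i q) p = fr m l k (fun=> 1) p.
  by apply: (near_fr k oO Op) => q Oq; exact: a_unit.
rewrite (fr_rule (derive_rule_cst _ _ _) erefl).
rewrite (fr_rule (d := \sum_i (a i p * fr m l k (a i) p + a i p * fr m l k (a i) p))
  _ erefl); last first.
  by apply: derive_rule_sum => i; apply: derive_ruleM; exact: fr_a.
rewrite big_split /= => D0; apply: (mulfI two_neq0); rewrite mulr0.
have X := antisym_sum3 (fun i => a i p) (fun i => a i p) two_neq0 (omega_antisym m l p k).
have Y : \sum_i \sum_j omega m l p k j i * a j p * a i p = 0.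
  apply: (mulfI two_neq0); rewrite mulr0; apply: (eq_trans _ X).
  rewrite exchange_big mulr_sumr /=; apply: eq_bigr => i _; rewrite mulr_sumr.
  by apply: eq_bigr => j _; ring.
transitivity (2 * (\sum_i a i p * fr m l k (a i) p)
     + 2 * (\sum_i \sum_j omega m l p k j i * a j p * a i p)).
  rewrite -mulrDr -big_split /=; congr (_ * _); apply: eq_bigr => i _.
  by rewrite /W' mulrDl mulr_suml; congr (_ + _); exact: mulrC.
by rewrite Y mulr0 addr0 mulr_natl mulr2n.
Qed.

Let sigma p := W' p 0 1 * a 2 p + W' p 1 2 * a 0 p + W' p 2 0 * a 1 p.

Let covariant_derivative p : O p ->
  [/\ forall i, W' p i i = 0,
      W' p 0 1 = sigma p * a 2 p /\ W' p 1 0 = - (sigma p * a 2 p),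
      W' p 1 2 = sigma p * a 0 p /\ W' p 2 1 = - (sigma p * a 0 p) &
      W' p 2 0 = sigma p * a 1 p /\ W' p 0 2 = - (sigma p * a 1 p)].
Proof.
move=> Op.
have HsS c i j : Hs p c i j = Hs p c j i by exact: (hess_sym m l i j oO Op (sFc c)).
apply: (killing_algebra (b := b p) (rho := rho p) (a := fun i => a i p) (Hs := Hs p)
  (W := W' p)) => //.
- exact: a_unit.
- by move=> k c; exact: W'b.
- by move=> k; exact: W'a.
(* Harmonicity enters here, through [hess_trace]: the Hessians of the components vanish on the
   normal, hence on its normalisation by [rho]. *)
- move=> c; have := harmonic_vertical_algebra (b := b p) (Hs := Hs p) (u := u (F p))
    (dh := fun d i j => pd d (fun y => H y i j) (F p))
    (du := fun d i j => pd d (fun y => u y i j) (F p))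
    (G := fun c a e => christoffel H c a e (F p)) two_neq0.
  move=> /(_ (fun a c => gramE a c Op)) /(_ (fun d i j => pd_metric_sym oW symH d i j (OW Op))).
  move=> /(_ HsS) /(_ (fun d a c => duE d a c Op)) /(_ (fun a c k => hess_gram a c k Op)).
  move=> /(_ (fun c a e => erefl)) /(_ (fun c => hess_trace c Op)) /(_ c) N0.
  transitivity (rho p ^+ 2 * \sum_k \sum_i Hs p c k i * cross (b p 0) (b p 1) k
     * cross (b p 0) (b p 1) i); last by rewrite N0 mulr0.
  rewrite mulr_sumr; apply: eq_bigr => k _; rewrite mulr_sumr; apply: eq_bigr => i _.
  have [h hE] : exists h, h = Hs p c k i by exists (Hs p c k i).
  by rewrite -hE /a /nrm; ring.
- move=> c d; under eq_bigr => k _ do rewrite hess_gram// mulr_sumr.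
  rewrite exchange_big /=; apply: big1 => e _.
  transitivity (pd e (fun y => u y c d) (F p) * \sum_i a i p * b p e i).
    by rewrite mulr_sumr; apply: eq_bigr => i _; ring.
  by rewrite a_vertical mulr0.
Qed.

Lemma vertical_field : exists (v : 'I_3 -> 'rV[R]_3 -> R) (s : 'rV[R]_3 -> R),
  [/\ forall i, smooth O (v i), smooth O s,
      forall p, O p -> v 0 p ^+ 2 + v 1 p ^+ 2 + v 2 p ^+ 2 = 1,
      forall c p, O p -> \sum_i v i p * fr m l i (fun q => F q 0 c) p = 0 &
      forall p, O p -> killing_equations m l v s p].
Proof.
have sW' k i : smooth O (fun p => W' p k i).
  apply: smoothD => //; first exact: smooth_fr.
  apply: smooth_sum => // j; apply: smoothM => //; exact: smooth_omega.
(* Since nabla_{E1} E3 = - (l / 2) E2, the field d/dz has sigma = - l / 2, so the shifted function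
   is 0 for it. *)
exists a, (fun p => sigma p + l / 2); split => //.
- apply: smoothD => //; last exact: smooth_cst.
  apply: smoothD => //; last exact: smoothM.
  by apply: smoothD => //; exact: smoothM.
- by move=> p Op; rewrite -[RHS](a_unit Op) sum3E !expr2.
- by move=> c p _; exact: a_vertical.
move=> p Op; rewrite /killing_equations; cbv beta.
have [Wd [W01 W10] [W12 W21] [W20 W02]] := covariant_derivative Op.
have frE' k i : fr m l k (a i) p = W' p k i + \sum_j omega m l p k i j * a j p.
  rewrite /W' -addrA -big_split /= big1 ?addr0// => j _.
  by rewrite (omega_antisym m l p k i j) mulNr subrr.
have [[w00 w01 w02] [w10 w11 w12] [w20 w21 w22]] := omega_sumE m l p (fun j => a j p).
move: Wd W01 W10 W12 W21 W20 W02 frE' w00 w01 w02 w10 w11 w12 w20 w21 w22.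
move: (W' p) (omega m l p) (sigma p) => w om s Wd W01 W10 W12 W21 W20 W02 frE'.
move=> w00 w01 w02 w10 w11 w12 w20 w21 w22.
rewrite !frE' !Wd W01 W10 W12 W21 W20 W02 w00 w01 w02 w10 w11 w12 w20 w21 w22.
move: (a 0 p) (a 1 p) (a 2 p) => x y z.
by split; split; field.
Qed.

End Vertical.

(** * Rigidity of the vertical field *)

Lemma linear_eq {V : zmodType} (x y a b : V) : x = y -> a - b = x - y -> a = b.
Proof. by move=> ->; rewrite subrr => /eqP; rewrite subr_eq0 => /eqP. Qed.

Section Rigidity.
Context {R : realType}.
Variables m l : R.
Notation f p := (bcv_factor m (p 0 0) (p 0 1)).
Notation E := (bcv_frame m l).
Notation fr := (fr m l).
Variables (O : set 'rV[R]_3) (v : 'I_3 -> 'rV[R]_3 -> R) (s : 'rV[R]_3 -> R).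
Hypotheses (oO : open O) (sv : forall i, smooth O (v i)) (ss : smooth O s).
Hypothesis unit_v : forall p, O p -> v 0 p ^+ 2 + v 1 p ^+ 2 + v 2 p ^+ 2 = 1.
Hypothesis fr_v : forall p, O p -> killing_equations m l v s p.

Let lv k i p : O p -> is_derive p (row k (E p)) (v i) (fr k (v i) p).
Proof. by move=> Op; apply: fr_leaf; exact: smooth_differentiable (sv i) Op. Qed.

Let ls k p : O p -> is_derive p (row k (E p)) s (fr k s p).
Proof. by move=> Op; apply: fr_leaf; exact: smooth_differentiable ss Op. Qed.

Let lc k (c : R) i p : is_derive p (row k (E p)) (fun q => c * q 0 i) (c * E p k i).
Proof.
apply: derive_rule_eq; first by apply: derive_ruleM; exact: fr_coord.
by rewrite /= mulr0 addr0.
Qed.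

Let frcv k c i j p : O p -> fr k (fun q => c * q 0 i * v j q) p =
  c * p 0 i * fr k (v j) p + c * E p k i * v j p.
Proof.
move=> Op; apply: fr_rule; first by apply: derive_ruleM; [exact: lc|exact: lv].
by rewrite /=; ring.
Qed.

Let frsv k (c : R) j p : O p -> fr k (fun q => (s q - c) * v j q) p =
  (s p - c) * fr k (v j) p + fr k s p * v j p.
Proof.
move=> Op; apply: fr_rule.
  apply: derive_ruleM; last exact: lv.
  by apply: derive_ruleD; exact: ls.
by rewrite /=; ring.
Qed.

Let frD k (u w : 'rV[R]_3 -> R) p : differentiable u p -> differentiable w p ->
  fr k (fun q => u q + w q) p = fr k u p + fr k w p.
Proof.
by move=> du dw; apply: fr_rule; [apply: derive_ruleD; exact: fr_leaf|].
Qed.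

Let frN k (u : 'rV[R]_3 -> R) p : differentiable u p ->
  fr k (fun q => - u q) p = - fr k u p.
Proof. by move=> du; apply: fr_rule; [apply: derive_ruleN; exact: fr_leaf|]. Qed.

Let dcv (c : R) i j p : O p -> differentiable (fun q : 'rV[R]_3 => c * q 0 i * v j q) p.
Proof.
move=> Op; apply: smooth_differentiable Op; apply: smoothM => //.
by apply: smoothM => //; [exact: smooth_cst|exact: smooth_coord].
Qed.

Let dsv (c : R) j p : O p -> differentiable (fun q => (s q - c) * v j q) p.
Proof.
move=> Op; apply: smooth_differentiable Op; apply: smoothM => //.
by apply: smoothB => //; exact: smooth_cst.
Qed.

Let second p k : O p -> [/\
  [/\ fr k (fr 0 (v 0)) p = 2 * m * p 0 1 * fr k (v 1) p + 2 * m * E p k 1 * v 1 p,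
      fr k (fr 0 (v 1)) p = - (2 * m) * p 0 1 * fr k (v 0) p + - (2 * m) * E p k 1 * v 0 p
         + (s p * fr k (v 2) p + fr k s p * v 2 p) &
      fr k (fr 0 (v 2)) p = - (s p * fr k (v 1) p + fr k s p * v 1 p)],
  [/\ fr k (fr 1 (v 0)) p = - (2 * m) * p 0 0 * fr k (v 1) p + - (2 * m) * E p k 0 * v 1 p
         - (s p * fr k (v 2) p + fr k s p * v 2 p),
      fr k (fr 1 (v 1)) p = 2 * m * p 0 0 * fr k (v 0) p + 2 * m * E p k 0 * v 0 p &
      fr k (fr 1 (v 2)) p = s p * fr k (v 0) p + fr k s p * v 0 p] &
  [/\ fr k (fr 2 (v 0)) p = (s p - l) * fr k (v 1) p + fr k s p * v 1 p,
      fr k (fr 2 (v 1)) p = - ((s p - l) * fr k (v 0) p + fr k s p * v 0 p) &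
      fr k (fr 2 (v 2)) p = 0]].
Proof.
move=> Op; have frs0 j : fr k (fun q => s q * v j q) p = s p * fr k (v j) p + fr k s p * v j p.
  transitivity (fr k (fun q => (s q - 0) * v j q) p).
    by apply: (near_fr k oO Op) => q _; rewrite subr0.
  by rewrite frsv// subr0.
have ds0 j : differentiable (fun q => s q * v j q) p.
  by apply: smooth_differentiable Op; exact: smoothM.
split; split.
- rewrite -frcv//; apply: (near_fr k oO Op) => q Oq.
  by have [[-> _ _] _ _] := fr_v Oq.
- rewrite -frcv// -frs0 -frD//; last exact: dcv.
  apply: (near_fr k oO Op) => q Oq; have [[_ -> _] _ _] := fr_v Oq.
  by rewrite !mulNr.
- rewrite -frs0 -frN//; apply: (near_fr k oO Op) => q Oq.
  by have [[_ _ ->] _ _] := fr_v Oq; rewrite mulNr.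
- rewrite -frcv// -frs0 -frN// -frD//; [|exact: dcv|]; last first.
    by apply: smooth_differentiable Op; apply: smoothN => //; exact: smoothM.
  apply: (near_fr k oO Op) => q Oq; have [_ [-> _ _] _] := fr_v Oq.
  by rewrite !mulNr.
- rewrite -frcv//; apply: (near_fr k oO Op) => q Oq.
  by have [_ [_ -> _] _] := fr_v Oq.
- rewrite -frs0; apply: (near_fr k oO Op) => q Oq.
  by have [_ [_ _ ->] _] := fr_v Oq.
- rewrite -frsv//; apply: (near_fr k oO Op) => q Oq.
  by have [_ _ [-> _ _]] := fr_v Oq.
- rewrite -frsv// -frN//; last exact: dsv.
  apply: (near_fr k oO Op) => q Oq; have [_ _ [_ -> _]] := fr_v Oq.
  by rewrite -mulNr opprB.
- transitivity (fr k (fun=> 0) p).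
    by apply: (near_fr k oO Op) => q Oq; have [_ _ [_ _ ->]] := fr_v Oq.
  exact: (fr_rule (derive_rule_cst _ _ _) erefl).
Qed.

Let frame_entries p : [/\ E p 0 0 = f p, E p 0 1 = 0, E p 1 0 = 0, E p 1 1 = f p
  & (E p 2 0 = 0) * (E p 2 1 = 0)].
Proof. by rewrite !mxE. Qed.

(** Integrability conditions of [killing_equations]: the commutators of the frame, applied to the
    components of V, are evaluated a second time by differentiating the equations. Five of them
    suffice. *)
Let relations p : O p -> [/\ fr 2 s p * v 1 p + s p * (l - s p) * v 0 p = 0,
  fr 2 s p * v 0 p - s p * (l - s p) * v 1 p = 0,
  (s p ^+ 2 - l * s p - 4 * m + l ^+ 2) * v 1 p = fr 0 s p * v 2 p,
  (s p ^+ 2 - l * s p - 4 * m + l ^+ 2) * v 0 p = - (fr 1 s p * v 2 p) &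
  fr 0 s p * v 1 p + (s p - l) * s p * v 2 p = 0].
Proof.
move=> Op; have fE : f p = 1 + m * (p 0 0 ^+ 2 + p 0 1 ^+ 2) by [].
have [E00 E01 E10 E11 [E20 E21]] := frame_entries p.
have [[a000 a001 a002] [a010 a011 a012] [a020 a021 a022]] := second 0 Op.
have [[a100 a101 a102] [a110 a111 a112] [a120 a121 a122]] := second 1 Op.
have [[a200 a201 a202] [a210 a211 a212] [a220 a221 a222]] := second 2 Op.
have [[b00 b01 b02] [b10 b11 b12] [b20 b21 b22]] := fr_v Op.
have c02 i := fr_comm02 m l oO Op (sv i).
have c12 i := fr_comm12 m l oO Op (sv i).
have c01 i := fr_comm01 m l oO Op (sv i).
move: (c02 0) (c02 2) (c12 2) (c01 0) (c01 1).
rewrite ?a000 ?a001 ?a002 ?a010 ?a011 ?a012 ?a020 ?a021 ?a022 ?a100 ?a101 ?a102 ?a110 ?a111 ?a112 ?a120 ?a121 ?a122.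
rewrite ?a200 ?a201 ?a202 ?a210 ?a211 ?a212 ?a220 ?a221 ?a222.
rewrite ?b00 ?b01 ?b02 ?b10 ?b11 ?b12 ?b20 ?b21 ?b22 ?E00 ?E01 ?E10 ?E11 ?E20 ?E21 ?fE.
move: (p 0 0) (p 0 1) (s p) (v 0 p) (v 1 p) (v 2 p) (fr 0 s p) (fr 1 s p) (fr 2 s p).
move=> x y t a b c t0 t1 t2 e1 e2 e3 e4 e5.
split; [apply: (linear_eq e2)|apply: (linear_eq (esym e3))|apply: (linear_eq e4)
  |apply: (linear_eq (esym e5))|apply: (linear_eq e1)]; by ring.
Qed.

(** Eliminating the derivative of s along E3 from the first two relations gives s (s - l) (v0^2 +
    v1^2) = 0. If s (s - l) were nonzero, v0 and v1 would vanish, and the last relation would force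
    v2 = 0 as well, against |V| = 1. *)
Let s_values p : O p -> s p * (s p - l) = 0.
Proof.
move=> Op; have [A B _ _ G] := relations Op; have u1 := unit_v Op.
move: A B G u1; move: (s p) (v 0 p) (v 1 p) (v 2 p) (fr 0 s p) (fr 2 s p).
move=> t a b c t0 t2 A B G u1.
have K : t * (t - l) * (a ^+ 2 + b ^+ 2) = 0.
  transitivity (b * (t2 * a - t * (l - t) * b) - a * (t2 * b + t * (l - t) * a)); first by ring.
  by rewrite A B; ring.
have [//|st0] := eqVneq (t * (t - l)) 0.
have /eqP := K; rewrite mulf_eq0 (negPf st0) /= paddr_eq0 ?sqr_ge0// !sqrf_eq0.
move=> /andP[/eqP a0 /eqP b0]; move: G u1; rewrite a0 b0 mulr0 add0r expr0n /= !add0r.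
move=> /eqP; rewrite mulf_eq0 (mulrC (t - l)) (negPf st0) /= => /eqP ->.
by rewrite expr0n /= => /eqP; rewrite eq_sym oner_eq0.
Qed.

(** Differentiating s (s - l) = 0 gives (2 s - l) E_k s = 0. The first factor vanishes only for s =
    l / 2, where the equation itself yields l = 0; in that case s is identically 0. *)
Let fr_s k p : O p -> fr k s p = 0.
Proof.
move=> Op; have [l0|l0] := eqVneq l 0.
  have s0 q : O q -> s q = 0.
    by move=> Oq; have := s_values Oq; rewrite l0 subr0 => /eqP; rewrite mulf_eq0 orbb => /eqP.
  transitivity (fr k (fun=> 0) p); first by apply: (near_fr k oO Op).
  exact: (fr_rule (derive_rule_cst _ _ _) erefl).
have : fr k (fun q => (s q - l) * s q) p = fr k (fun=> 0) p.
  by apply: (near_fr k oO Op) => q Oq; rewrite mulrC s_values.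
rewrite (fr_rule (derive_rule_cst _ _ _) erefl).
rewrite (fr_rule (d := (s p - l) * fr k s p + s p * fr k s p) _ erefl); last first.
  apply: derive_rule_eq; first by apply: derive_ruleM; [apply: derive_ruleD|]; exact: ls.
  by rewrite /= addr0.
rewrite -mulrDl => /eqP; rewrite mulf_eq0 => /orP[/eqP E0|/eqP//].
have sE : s p = l / 2 by move: E0; move: (s p) => t E0; lra.
have := s_values Op; rewrite sE => H; suff : l ^+ 2 == 0 by rewrite sqrf_eq0 (negPf l0).
by apply/eqP; transitivity (- 4 * (l / 2 * (l / 2 - l))); [field|rewrite H mulr0].
Qed.

(** With the derivatives of s gone, the third and fourth [relations] have zero right-hand side, and
    s (s - l) = 0 reduces their coefficient to l^2 - 4m. *)
Lemma vertical_rigidity p : O p -> [/\ s p = 0 \/ s p = l,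
  forall k, fr k s p = 0, (l ^+ 2 - 4 * m) * v 0 p = 0 & (l ^+ 2 - 4 * m) * v 1 p = 0].
Proof.
move=> Op; have [_ _ C D _] := relations Op; have sv0 := s_values Op.
have T : s p ^+ 2 - l * s p - 4 * m + l ^+ 2 = l ^+ 2 - 4 * m.
  transitivity (s p * (s p - l) + (l ^+ 2 - 4 * m)); first by ring.
  by rewrite sv0 add0r.
rewrite T !fr_s// mul0r ?oppr0 in C D; split=> //.
- by move/eqP: sv0; rewrite mulf_eq0 subr_eq0 => /orP[]/eqP; [left|right].
- by move=> k; exact: fr_s.
Qed.

End Rigidity.

Lemma sum4E {V : nmodType} (f : 'I_4 -> V) : \sum_i f i = f 0 + f 1 + f 2 + f 3.
Proof.
rewrite !big_ord_recl big_ord0 addr0 !addrA.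
by congr (f _ + f _ + f _ + f _); apply: val_inj.
Qed.

Lemma ord4P (P : 'I_4 -> Prop) : P 0 -> P 1 -> P 2 -> P 3 -> forall i, P i.
Proof.
move=> P0 P1 P2 P3 [[|[|[|[|//]]]] H].
- by rewrite (_ : Ordinal H = 0)//; exact: val_inj.
- by rewrite (_ : Ordinal H = 1)//; exact: val_inj.
- by rewrite (_ : Ordinal H = 2)//; exact: val_inj.
- by rewrite (_ : Ordinal H = 3)//; exact: val_inj.
Qed.

(** * The Hopf map and the case l^2 = 4m > 0 *)

Lemma derive_rule_comp {R : realType} {n : nat} (g : R -> R) (u : 'rV[R]_n -> R) p v du dg :
  differentiable u p -> is_derive p v u du -> is_derive (u p) 1 g dg ->
  is_derive p v (fun q => g (u q)) (dg * du).
Proof.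
move=> u' uE gE; have [d1 d2] := derive_comp1 v u' gE.
apply: DeriveDef; first exact: diff_derivable.
by rewrite d2; have [_ ->] := uE.
Qed.

(* On the region, and when m = b ^ 2, l = 2 b, the metric is the pull-back by [hopf]
   of the round metric of R^4 divided by [m]; the first two entries are the real and
   imaginary parts of exp (i b z) / sqrt f, and the last two those of its product with
   b (x - i y). *)
Section Hopf.
Context {R : realType}.
Variable b : R.
Hypothesis b0 : b != 0.
Notation m := (b ^+ 2).
Notation l := (2 * b).
Implicit Type p : 'rV[R]_3.
Notation f p := (bcv_factor m (p 0 0) (p 0 1)).
Notation E := (bcv_frame m l).
Notation fr := (fr m l).

Definition hopf p : 'rV[R]_4 :=
  let c := cos (b * p 0 2) / Num.sqrt (f p) in
  let s := sin (b * p 0 2) / Num.sqrt (f p) in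
  \row_A [:: c; s; b * (p 0 0 * c + p 0 1 * s); b * (p 0 0 * s - p 0 1 * c)]`_A.

(** The derivative of [hopf] along E_k, written through [hopf] itself so that later identities are
    polynomial. The last row is b times multiplication by i on both complex coordinates: d/dz is
    tangent to a Hopf fibration. *)
Definition dhopf p (k : 'I_3) : 'rV[R]_4 :=
  let P := hopf p 0 in
  \row_A (nth [::] [::
    [:: - m * (p 0 0 * P 0 - p 0 1 * P 1); - m * (p 0 0 * P 1 + p 0 1 * P 0); b * P 0; b * P 1];
    [:: - m * (p 0 0 * P 1 + p 0 1 * P 0); m * (p 0 0 * P 0 - p 0 1 * P 1); b * P 1; - (b * P 0)];
    [:: - (b * P 1); b * P 0; - (b * P 3); b * P 2]] k)`_A.

Lemma hopf23 p : hopf p 0 2 = b * (p 0 0 * hopf p 0 0 + p 0 1 * hopf p 0 1) /\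
  hopf p 0 3 = b * (p 0 0 * hopf p 0 1 - p 0 1 * hopf p 0 0).
Proof. by rewrite !mxE. Qed.

Lemma hopf_norm01 p : 0 < f p -> f p * (hopf p 0 0 ^+ 2 + hopf p 0 1 ^+ 2) = 1.
Proof.
move=> f0; rewrite !mxE /= !expr_div_n -mulrDl cos2Dsin2 div1r sqr_sqrtr ?ltW//.
by rewrite mulfV// gt_eqF.
Qed.

Lemma hopf_norm p : 0 < f p -> \sum_A hopf p 0 A * hopf p 0 A = 1.
Proof.
move=> f0; rewrite -[RHS](hopf_norm01 f0) sum4E; have [-> ->] := hopf23 p.
rewrite /bcv_factor; move: (hopf p 0 0) (hopf p 0 1) (p 0 0) (p 0 1) => P Q x y.
by ring.
Qed.

Lemma smooth_hopf (U : set 'rV[R]_3) A : open U -> (forall p, U p -> 0 < f p) ->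
  smooth U (fun p => hopf p 0 A).
Proof.
move=> oU f0; pose u (p : 'rV[R]_3) := b * p 0 2.
have su : smooth U u by apply: smoothM => //; [exact: smooth_cst|exact: smooth_coord].
have [sc ss] := smooth_cos_sin oU su.
have sV : smooth U (fun p => (Num.sqrt (f p))^-1).
  apply: smoothV => //; first by move=> p /f0 fp; rewrite gt_eqF// sqrtr_gt0.
  by apply: smooth_sqrt => //; exact: smooth_bcv_factor.
have s0 : smooth U (fun p => hopf p 0 0).
  by apply: (eq_smooth oU) (smoothM oU sc sV) => p _; rewrite mxE.
have s1 : smooth U (fun p => hopf p 0 1).
  by apply: (eq_smooth oU) (smoothM oU ss sV) => p _; rewrite mxE.
have sx i : smooth U (fun p : 'rV[R]_3 => p 0 i) by exact: smooth_coord.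
move: A; apply: ord4P => //.
- apply: (eq_smooth oU (f := fun p => b * (p 0 0 * hopf p 0 0 + p 0 1 * hopf p 0 1))).
    by move=> p _; have [-> _] := hopf23 p.
  by apply: smoothM => //; [exact: smooth_cst|apply: smoothD => //; exact: smoothM].
- apply: (eq_smooth oU (f := fun p => b * (p 0 0 * hopf p 0 1 - p 0 1 * hopf p 0 0))).
    by move=> p _; have [_ ->] := hopf23 p.
  by apply: smoothM => //; [exact: smooth_cst|apply: smoothB => //; exact: smoothM].
Qed.

Lemma is_derive_hopf p k A : 0 < f p ->
  is_derive p (row k (E p)) (fun q => hopf q 0 A) (dhopf p k 0 A).
Proof.
move=> f0; have fE : f p = 1 + m * (p 0 0 ^+ 2 + p 0 1 ^+ 2) by [].
have s0 : Num.sqrt (f p) != 0 by rewrite gt_eqF// sqrtr_gt0.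
have ss : Num.sqrt (f p) ^+ 2 = f p by rewrite sqr_sqrtr// ltW.
have dbz : is_derive p (row k (E p)) (fun q : 'rV[R]_3 => b * q 0 2) (b * E p k 2).
  apply: derive_rule_eq; first by apply: derive_ruleM; exact: fr_coord.
  by rewrite /= mulr0 addr0.
have diff_bz : differentiable (fun q : 'rV[R]_3 => b * q 0 2) p.
  by apply: differentiableM; [exact: differentiable_cst|exact: differentiable_coord].
have dsq : is_derive p (row k (E p)) (fun q : 'rV[R]_3 => (Num.sqrt (f q))^-1)
   (- (m * (p 0 0 * E p k 0 + p 0 1 * E p k 1)) / f p / Num.sqrt (f p)).
  apply: derive_rule_eq.
    apply: derive_ruleV => //; apply: derive_rule_comp; last exact: is_derive1_sqrt.
      exact: smooth_differentiable (smooth_bcv_factor m _ _ openT) I.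
    exact: fr_factor.
  rewrite /= ss; have f0' := lt0r_neq0 f0.
  move: (E p k 0) (E p k 1) (p 0 0) (p 0 1) (f p) f0' (Num.sqrt (f p)) s0.
  by move=> e0 e1 x y v v0 t t0; field; rewrite t0 v0.
have d0 : is_derive p (row k (E p)) (fun q => hopf q 0 0)
    (- b * E p k 2 * hopf p 0 1 - m * (p 0 0 * E p k 0 + p 0 1 * E p k 1) / f p * hopf p 0 0).
  rewrite (_ : (fun q => hopf q 0 0) = fun q => cos (b * q 0 2) * (Num.sqrt (f q))^-1); last first.
    by apply/funext => q; rewrite mxE.
  apply: derive_rule_eq.
    by apply: derive_ruleM; apply: derive_rule_comp.
  by rewrite ![hopf _ _ _]mxE /=; move: (cos _) (sin _) (f p) (Num.sqrt _)^-1 => *; ring.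
have d1 : is_derive p (row k (E p)) (fun q => hopf q 0 1)
    (b * E p k 2 * hopf p 0 0 - m * (p 0 0 * E p k 0 + p 0 1 * E p k 1) / f p * hopf p 0 1).
  rewrite (_ : (fun q => hopf q 0 1) = fun q => sin (b * q 0 2) * (Num.sqrt (f q))^-1); last first.
    by apply/funext => q; rewrite mxE.
  apply: derive_rule_eq.
    by apply: derive_ruleM; apply: derive_rule_comp.
  by rewrite ![hopf _ _ _]mxE /=; move: (cos _) (sin _) (f p) (Num.sqrt _)^-1 => *; ring.
have fn0 : f p != 0 by rewrite gt_eqF.
have dx i := fr_coord m l k i p.
have [h2 h3] := hopf23 p; have N := hopf_norm01 f0.
move: A; apply: ord4P.
- apply: derive_rule_eq; rewrite [RHS]mxE.
  move: (hopf p 0) fn0 => P; rewrite fE => fn0.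
  by move: k {dbz dsq d0 d1 dx}; apply: ord3P; rewrite !mxE /=; rewrite ?fE;
    move: (p 0 0) (p 0 1) fn0 => x y fn0; field.
- apply: derive_rule_eq; rewrite [RHS]mxE.
  move: (hopf p 0) fn0 => P; rewrite fE => fn0.
  by move: k {dbz dsq d0 d1 dx}; apply: ord3P; rewrite !mxE /=; rewrite ?fE;
    move: (p 0 0) (p 0 1) fn0 => x y fn0; field.
- rewrite (_ : (fun q => hopf q 0 2) =
     fun q => b * (q 0 0 * hopf q 0 0 + q 0 1 * hopf q 0 1)); last first.
    by apply/funext => q; have [-> _] := hopf23 q.
  apply: derive_rule_eq.
  rewrite [RHS]mxE h2 h3 -![_ *: _]/(_ * _).
  move: (hopf p 0) fn0 => P; rewrite fE => fn0.
  by move: k {dbz dsq d0 d1 dx}; apply: ord3P; rewrite !mxE /=; rewrite ?fE;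
    move: (p 0 0) (p 0 1) fn0 => x y fn0; field.
- rewrite (_ : (fun q => hopf q 0 3) =
     fun q => b * (q 0 0 * hopf q 0 1 - q 0 1 * hopf q 0 0)); last first.
    by apply/funext => q; have [_ ->] := hopf23 q.
  apply: derive_rule_eq.
  rewrite [RHS]mxE h2 h3 -![_ *: _]/(_ * _).
  move: (hopf p 0) fn0 => P; rewrite fE => fn0.
  by move: k {dbz dsq d0 d1 dx}; apply: ord3P; rewrite !mxE /=; rewrite ?fE;
    move: (p 0 0) (p 0 1) fn0 => x y fn0; field.
Qed.

Lemma dhopf_gram p k k' : 0 < f p ->
  \sum_A dhopf p k 0 A * dhopf p k' 0 A = m * (k == k')%:R.
Proof.
move=> f0; have N := hopf_norm01 f0; have [h2 h3] := hopf23 p.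
transitivity (m * (f p * (hopf p 0 0 ^+ 2 + hopf p 0 1 ^+ 2)) * (k == k')%:R); last first.
  by rewrite N mulr1.
rewrite sum4E ![dhopf _ _ _ _]mxE h2 h3 /bcv_factor.
move: (hopf p 0 0) (hopf p 0 1) (p 0 0) (p 0 1) => P Q x y.
by move: k k'; apply: ord3P; apply: ord3P; rewrite /=; ring.
Qed.

Lemma hopf_dhopf p k : \sum_A hopf p 0 A * dhopf p k 0 A = 0.
Proof.
have [h2 h3] := hopf23 p; rewrite sum4E ![dhopf _ _ _ _]mxE h2 h3.
move: (hopf p 0 0) (hopf p 0 1) (p 0 0) (p 0 1) => P Q x y.
by move: k; apply: ord3P; rewrite /=; ring.
Qed.

End Hopf.

Lemma linear_eqM {V : pzRingType} (x y c a b : V) : x = y -> a - b = c * (x - y) -> a = b.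
Proof. by move=> ->; rewrite subrr mulr0 => /eqP; rewrite subr_eq0 => /eqP. Qed.

Lemma fr_constant {R : realType} (m l : R) (p0 : 'rV[R]_3) r (u : 'rV[R]_3 -> R) :
  (forall p, ball p0 r p -> bcv_factor m (p 0 0) (p 0 1) != 0) ->
  smooth (ball p0 r) u ->
  (forall k p, ball p0 r p -> fr m l k u p = 0) ->
  forall p, ball p0 r p -> u p = u p0.
Proof.
move=> f0 su du p Bp; apply: (constant_on_ball Bp) => q Bq.
have dq := smooth_differentiable su Bq; split => //.
have E2 : dcoord 2 u q = 0 by rewrite -(fr2E m l dq) du.
have E0 : dcoord 0 u q = 0.
  apply: (mulfI (f0 _ Bq)); rewrite mulr0.
  by have := du 0 q Bq; rewrite (fr0E m l dq) E2 mulr0 subr0.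
have E1 : dcoord 1 u q = 0.
  apply: (mulfI (f0 _ Bq)); rewrite mulr0.
  by have := du 1 q Bq; rewrite (fr1E m l dq) E2 mulr0 addr0.
by rewrite dcoord.unlock in E0 E1 E2; exact: ord3P.
Qed.

(* Left and right multiplication by a purely imaginary quaternion. *)
Definition quatl {R : pzRingType} (q x y : R) : 'M[R]_4 :=
  \matrix_(i, j) (nth [::] [:: [:: 0; - q; - x; - y]; [:: q; 0; - y; x];
                               [:: x; y; 0; - q]; [:: y; - x; q; 0]] i)`_j.

Definition quatr {R : pzRingType} (q x y : R) : 'M[R]_4 :=
  \matrix_(i, j) (nth [::] [:: [:: 0; - q; - y; - x]; [:: q; 0; x; - y];
                               [:: y; - x; 0; q]; [:: x; y; - q; 0]] i)`_j.

Lemma quatl_orthogonal {R : comPzRingType} (q x y : R) : q ^+ 2 + x ^+ 2 + y ^+ 2 = 1 ->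
  (quatl q x y)^T = - quatl q x y /\ quatl q x y *m (quatl q x y)^T = 1%:M.
Proof.
move=> N; split.
  by apply/matrixP; apply: ord4P; apply: ord4P; rewrite !mxE /= ?oppr0 ?opprK.
apply/matrixP; apply: ord4P; apply: ord4P; rewrite !mxE sum4E !mxE /=;
  by rewrite -?N; ring.
Qed.

Lemma quatr_orthogonal {R : comPzRingType} (q x y : R) : q ^+ 2 + x ^+ 2 + y ^+ 2 = 1 ->
  (quatr q x y)^T = - quatr q x y /\ quatr q x y *m (quatr q x y)^T = 1%:M.
Proof.
move=> N; split.
  by apply/matrixP; apply: ord4P; apply: ord4P; rewrite !mxE /= ?oppr0 ?opprK.
apply/matrixP; apply: ord4P; apply: ord4P; rewrite !mxE sum4E !mxE /=;
  by rewrite -?N; ring.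
Qed.

Lemma combination3_entry {R : pzRingType} {n} (x : 'I_3 -> R) (a : 'I_3 -> 'rV[R]_n) A :
  (\sum_k x k *: a k) 0 A = x 0 * a 0 0 A + x 1 * a 1 0 A + x 2 * a 2 0 A.
Proof. by rewrite sum3E !mxE. Qed.

Lemma scale_mulmx_entry {R : pzRingType} (b : R) (h : 'rV[R]_4) (B : 'M[R]_4) A :
  (b *: (h *m B^T)) 0 A = b * (h 0 0 * B A 0 + h 0 1 * B A 1 + h 0 2 * B A 2 + h 0 3 * B A 3).
Proof. by rewrite !mxE sum4E !mxE. Qed.

Ltac smooth_by leaf := repeat first
  [ leaf | exact: smooth_cst | exact: smooth_coord | apply: smoothD | apply: smoothB
  | apply: smoothM | apply: smoothX | apply: smoothN ].

Section HopfVertical.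
Context {R : realType}.
Variable b : R.
Hypothesis b0 : b != 0.
Notation m := (b ^+ 2).
Notation l := (2 * b).
Notation f p := (bcv_factor m (p 0 0) (p 0 1)).
Notation E := (bcv_frame m l).
Notation fr := (fr m l).
Notation hopf := (hopf b).
Notation dhopf := (dhopf b).
Variables (p0 : 'rV[R]_3) (r : R) (v : 'I_3 -> 'rV[R]_3 -> R) (s : 'rV[R]_3 -> R).
Notation O := (ball p0 r).
Hypotheses (r0 : 0 < r) (f0 : forall p, O p -> 0 < f p).
Hypothesis sv : forall i, smooth O (v i).
Hypothesis unit_v : forall p, O p -> v 0 p ^+ 2 + v 1 p ^+ 2 + v 2 p ^+ 2 = 1.
Hypothesis fr_v : forall p, O p -> killing_equations m l v s p.

Let oO : open O. Proof. exact: ball_open. Qed.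
Let Op0 : O p0. Proof. exact: ballxx. Qed.
Let fn0 p : O p -> f p != 0. Proof. by move=> /f0/lt0r_neq0. Qed.

Let lv k i p : O p -> is_derive p (row k (E p)) (v i) (fr k (v i) p).
Proof. by move=> Op; apply: fr_leaf; exact: smooth_differentiable (sv i) Op. Qed.

Let sx i : smooth O (fun p : 'rV[R]_3 => p 0 i). Proof. exact: smooth_coord. Qed.
Let sc (c : R) : smooth O (fun _ : 'rV[R]_3 => c). Proof. exact: smooth_cst. Qed.
Let sf : smooth O (fun p : 'rV[R]_3 => f p). Proof. exact: smooth_bcv_factor. Qed.
Let sh A : smooth O (fun p => hopf p 0 A). Proof. exact: smooth_hopf. Qed.

(** The fields P -> B P, for B left multiplication by the imaginary units, form an orthonormal frame
    of the sphere; [v 2], [g1], [g2] are the components of V in it, and the equations with s = 0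
    make them constant. *)
Lemma hopf_vertical_left : (forall p, O p -> s p = 0) ->
  exists B : 'M[R]_4, [/\ B^T = - B, B *m B^T = 1%:M &
    forall p, O p -> \sum_k v k p *: dhopf p k = b *: (hopf p *m B^T)].
Proof.
move=> s0.
(* g1 + i g2 = (v 0 - i v 1) exp (2 i b z): with respect to the invariant frame, E1 and E2 turn by
   the angle 2 b z. The exponential is f times the square of the first complex coordinate of
   [hopf]. *)
pose g1 (p : 'rV[R]_3) := f p * (v 0 p * (hopf p 0 0 ^+ 2 - hopf p 0 1 ^+ 2)
   + 2 * v 1 p * hopf p 0 0 * hopf p 0 1).
pose g2 (p : 'rV[R]_3) := f p * (2 * v 0 p * hopf p 0 0 * hopf p 0 1
   - v 1 p * (hopf p 0 0 ^+ 2 - hopf p 0 1 ^+ 2)).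
have sg1 : smooth O g1.
  by smooth_by ltac:(first [exact: oO|exact: sv|exact: sh|exact: sf]).
have sg2 : smooth O g2.
  by smooth_by ltac:(first [exact: oO|exact: sv|exact: sh|exact: sf]).
have c3 : forall p, O p -> v 2 p = v 2 p0.
  apply: (fr_constant (l := l) fn0) => // k p Op.
  have [[_ _ e0] [_ _ e1] [_ _ e2]] := fr_v Op.
  rewrite (s0 _ Op) ?oppr0 mul0r in e0; rewrite (s0 _ Op) mul0r in e1.
  by move: k; apply: ord3P.
have c1 : forall p, O p -> g1 p = g1 p0.
  apply: (fr_constant (l := l) fn0) => // k p Op.
  have [[a0 a1 _] [b1 b2 _] [d1 d2 _]] := fr_v Op; rewrite (s0 _ Op) in a0 a1 b1 b2 d1 d2.
  have lf := fr_factor m l k p.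
  have lh A := is_derive_hopf k A (f0 Op) : is_derive p (row k (E p)) (fun q => hopf q 0 A) _.
  have lvk i := lv k i Op.
  apply: fr_rule; rewrite -![_ *: _]/(_ * _) ![dhopf _ _ _ _]mxE ![E _ _ _]mxE.
  move: (hopf p 0) {lf lh lvk} => P; move: k; apply: ord3P;
    rewrite /= ?a0 ?a1 ?b1 ?b2 ?d1 ?d2 /bcv_factor;
    by move: (p 0 0) (p 0 1) (v 0 p) (v 1 p) (v 2 p) => x y w0 w1 w2; ring.
have c2 : forall p, O p -> g2 p = g2 p0.
  apply: (fr_constant (l := l) fn0) => // k p Op.
  have [[a0 a1 _] [b1 b2 _] [d1 d2 _]] := fr_v Op; rewrite (s0 _ Op) in a0 a1 b1 b2 d1 d2.
  have lf := fr_factor m l k p.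
  have lh A := is_derive_hopf k A (f0 Op) : is_derive p (row k (E p)) (fun q => hopf q 0 A) _.
  have lvk i := lv k i Op.
  apply: fr_rule; rewrite -![_ *: _]/(_ * _) ![dhopf _ _ _ _]mxE ![E _ _ _]mxE.
  move: (hopf p 0) {lf lh lvk} => P; move: k; apply: ord3P;
    rewrite /= ?a0 ?a1 ?b1 ?b2 ?d1 ?d2 /bcv_factor;
    by move: (p 0 0) (p 0 1) (v 0 p) (v 1 p) (v 2 p) => x y w0 w1 w2; ring.
have N p : O p -> f p * (hopf p 0 0 ^+ 2 + hopf p 0 1 ^+ 2) = 1.
  by move=> /f0; exact: hopf_norm01.
have B1 : v 2 p0 ^+ 2 + g1 p0 ^+ 2 + g2 p0 ^+ 2 = 1.
  rewrite -[RHS](unit_v Op0).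
  transitivity ((v 0 p0 ^+ 2 + v 1 p0 ^+ 2) *
     (f p0 * (hopf p0 0 0 ^+ 2 + hopf p0 0 1 ^+ 2)) ^+ 2 + v 2 p0 ^+ 2).
    rewrite /g1 /g2; move: (hopf p0 0) (v 0 p0) (v 1 p0) (v 2 p0) (f p0) => P w0 w1 w2 F.
    by ring.
  by rewrite N// expr1n mulr1.
exists (quatl (v 2 p0) (g1 p0) (g2 p0)).
have [? ?] := quatl_orthogonal B1; split => // p Op.
rewrite -(c1 p Op) -(c2 p Op) -(c3 p Op) /g1 /g2; apply/rowP => A.
have [h2 h3] := hopf23 b p; have fE : f p = 1 + m * (p 0 0 ^+ 2 + p 0 1 ^+ 2) by [].
(* The two sides agree modulo the relation f (P0^2 + P1^2) = 1, and the multiplier is the part of V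
   along E1 and E2. *)
apply: (linear_eqM (esym (N p Op)) (c := v 0 p * dhopf p 0 0 A + v 1 p * dhopf p 1 0 A)).
rewrite combination3_entry scale_mulmx_entry ![dhopf _ _ _ _]mxE ![quatl _ _ _ _ _]mxE.
rewrite h2 h3; move: (hopf p 0) => P; move: A; apply: ord4P; rewrite /= fE;
  by move: (p 0 0) (p 0 1) (v 0 p) (v 1 p) (v 2 p) => x y w0 w1 w2; ring.
Qed.

(** As for s = 0, but with right multiplications: it is their frame in which the equations with s =
    l give V constant components. *)
Lemma hopf_vertical_right : (forall p, O p -> s p = l) ->
  exists B : 'M[R]_4, [/\ B^T = - B, B *m B^T = 1%:M &
    forall p, O p -> \sum_k v k p *: dhopf p k = b *: (hopf p *m B^T)].
Proof.
move=> s0.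
(* The components of V along the three fields P -> B P with B = [quatr 1 0 0], [quatr 0 1 0] and
   [quatr 0 0 1], computed on the frame; the last two are simplified by means of [g0]. *)
pose g0 (p : 'rV[R]_3) := (v 2 p * (1 - m * (p 0 0 ^+ 2 + p 0 1 ^+ 2))
   - 2 * b * (p 0 1 * v 0 p - p 0 0 * v 1 p)) * (f p)^-1.
pose g1 (p : 'rV[R]_3) := b * p 0 0 * (g0 p + v 2 p) - v 1 p.
pose g2 (p : 'rV[R]_3) := b * p 0 1 * (g0 p + v 2 p) + v 0 p.
have sfV : smooth O (fun p : 'rV[R]_3 => (f p)^-1) by apply: smoothV.
have sg0 : smooth O g0.
  by smooth_by ltac:(first [exact: oO|exact: sv|exact: sfV]).
have sg1 : smooth O g1.
  by smooth_by ltac:(first [exact: oO|exact: sv|exact: sg0]).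
have sg2 : smooth O g2.
  by smooth_by ltac:(first [exact: oO|exact: sv|exact: sg0]).
have fg0 k p : O p -> fr k g0 p = 0.
  move=> Op.
  have [[a0 a1 a2] [b1 b2 b3] [d1 d2 d3]] := fr_v Op.
  rewrite (s0 _ Op) in a0 a1 a2 b1 b2 b3 d1 d2 d3.
  have lf : is_derive p (row k (E p)) (fun q : 'rV[R]_3 => (f q)^-1) _ :=
    derive_ruleV (f := fun q : 'rV[R]_3 => f q) (fn0 Op) (fr_factor m l k p).
  have lvk i := lv k i Op; have lc i := fr_coord m l k i p.
  apply: fr_rule; rewrite -![_ *: _]/(_ * _) ![E _ _ _]mxE.
  have := fn0 Op; move: k {lf lvk lc}; apply: ord3P;
    rewrite /= ?a0 ?a1 ?a2 ?b1 ?b2 ?b3 ?d1 ?d2 ?d3 /bcv_factor;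
    by move: (p 0 0) (p 0 1) (v 0 p) (v 1 p) (v 2 p) => x y w0 w1 w2 fn; field.
have dg0 p : O p -> differentiable g0 p by exact: smooth_differentiable.
have c0 : forall p, O p -> g0 p = g0 p0.
  by apply: (fr_constant (l := l) fn0) => // k p Op; exact: fg0.
have c1 : forall p, O p -> g1 p = g1 p0.
  apply: (fr_constant (l := l) fn0) => // k p Op.
  have [[a0 a1 a2] [b1 b2 b3] [d1 d2 d3]] := fr_v Op.
  rewrite (s0 _ Op) in a0 a1 a2 b1 b2 b3 d1 d2 d3.
  have lg : is_derive p (row k (E p)) g0 0 
    by apply: (derive_rule_eq (fr_leaf m l k (dg0 p Op))); exact: fg0.
  have lvk i := lv k i Op; have lc i := fr_coord m l k i p.
  apply: fr_rule; rewrite -![_ *: _]/(_ * _) ![E _ _ _]mxE /g0.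
  have := fn0 Op; move: k {lg lvk lc}; apply: ord3P;
    rewrite /= ?a0 ?a1 ?a2 ?b1 ?b2 ?b3 ?d1 ?d2 ?d3 /bcv_factor;
    by move: (p 0 0) (p 0 1) (v 0 p) (v 1 p) (v 2 p) => x y w0 w1 w2 fn; field.
have c2 : forall p, O p -> g2 p = g2 p0.
  apply: (fr_constant (l := l) fn0) => // k p Op.
  have [[a0 a1 a2] [b1 b2 b3] [d1 d2 d3]] := fr_v Op.
  rewrite (s0 _ Op) in a0 a1 a2 b1 b2 b3 d1 d2 d3.
  have lg : is_derive p (row k (E p)) g0 0 
    by apply: (derive_rule_eq (fr_leaf m l k (dg0 p Op))); exact: fg0.
  have lvk i := lv k i Op; have lc i := fr_coord m l k i p.
  apply: fr_rule; rewrite -![_ *: _]/(_ * _) ![E _ _ _]mxE /g0.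
  have := fn0 Op; move: k {lg lvk lc}; apply: ord3P;
    rewrite /= ?a0 ?a1 ?a2 ?b1 ?b2 ?b3 ?d1 ?d2 ?d3 /bcv_factor;
    by move: (p 0 0) (p 0 1) (v 0 p) (v 1 p) (v 2 p) => x y w0 w1 w2 fn; field.
have B1 : g0 p0 ^+ 2 + g1 p0 ^+ 2 + g2 p0 ^+ 2 = 1.
  rewrite -[RHS](unit_v Op0) /g1 /g2 /g0; have := fn0 Op0; rewrite /bcv_factor.
  by move: (p0 0 0) (p0 0 1) (v 0 p0) (v 1 p0) (v 2 p0) => x y w0 w1 w2 fn; field.
exists (quatr (g0 p0) (g1 p0) (g2 p0)).
have [? ?] := quatr_orthogonal B1; split => // p Op.
rewrite -(c0 p Op) -(c1 p Op) -(c2 p Op) /g1 /g2 /g0; apply/rowP => A.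
have [h2 h3] := hopf23 b p.
rewrite combination3_entry scale_mulmx_entry ![dhopf _ _ _ _]mxE ![quatr _ _ _ _ _]mxE.
rewrite h2 h3; have := fn0 Op; rewrite /bcv_factor; move: (hopf p 0) => P fn.
move: A; apply: ord4P; rewrite /=;
  by move: (p 0 0) (p 0 1) fn (v 0 p) (v 1 p) (v 2 p) => x y fn w0 w1 w2; field.
Qed.

End HopfVertical.

(* Lagrange's identity in C^2: with w = (u + i v, s + i t) of norm 1, the first two
   squares are |w1 dw2 - w2 dw1|^2 and the third one is Im <dw, w>. *)
Lemma lagrange_identity {R : comRingType} (u v s t du dv ds dt du' dv' ds' dt' : R) :
  u ^+ 2 + v ^+ 2 + s ^+ 2 + t ^+ 2 = 1 ->
  u * du + v * dv + s * ds + t * dt = 0 ->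
  (u * ds - v * dt - (s * du - t * dv)) * (u * ds' - v * dt' - (s * du' - t * dv'))
  + (u * dt + v * ds - (s * dv + t * du)) * (u * dt' + v * ds' - (s * dv' + t * du'))
  + (u * dv - v * du + s * dt - t * ds) * (u * dv' - v * du' + s * dt' - t * ds')
  = du * du' + dv * dv' + ds * ds' + dt * dt'.
Proof.
move=> N C; rewrite -[RHS]mul1r -N.
transitivity ((u ^+ 2 + v ^+ 2 + s ^+ 2 + t ^+ 2) * (du * du' + dv * dv' + ds * ds' + dt * dt')
  - (u * du + v * dv + s * ds + t * dt) * (u * du' + v * dv' + s * ds' + t * dt')).
  by ring.
by rewrite C mul0r subr0.
Qed.

(** * The inverse of the Hopf map *)

Section StereographicAlgebra.
Context {R : fieldType}.
Variables (b u v s t : R).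
Hypotheses (b0 : b != 0) (D0 : u ^+ 2 + v ^+ 2 != 0).
Hypothesis N : u ^+ 2 + v ^+ 2 + s ^+ 2 + t ^+ 2 = 1.
Let D := u ^+ 2 + v ^+ 2.
Let X := (s * u + t * v) / (b * D).
Let Y := (s * v - t * u) / (b * D).
(** With w1 = u + i v and w2 = s + i t, [hopf] satisfies w2 = b (x - i y) w1, so its inverse is x -
    i y = w2 / (b w1), z = arg w1 / b. The three formulas are the derivatives of x, y and z; the
    first two are the real and minus the imaginary part of (w1 dw2 - w2 dw1) / (b w1^2). *)
Definition stereo_dx (du dv ds dt : R) :=
  ((u * ds - v * dt - (s * du - t * dv)) * (u ^+ 2 - v ^+ 2)
   + (u * dt + v * ds - (s * dv + t * du)) * (2 * u * v)) / (b * (u ^+ 2 + v ^+ 2) ^+ 2).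
Definition stereo_dy (du dv ds dt : R) :=
  ((u * ds - v * dt - (s * du - t * dv)) * (2 * u * v)
   - (u * dt + v * ds - (s * dv + t * du)) * (u ^+ 2 - v ^+ 2)) / (b * (u ^+ 2 + v ^+ 2) ^+ 2).
Definition stereo_dz (du dv ds dt : R) := (u * dv - v * du) / (b * (u ^+ 2 + v ^+ 2)).

Lemma stereo_factor : 1 + b ^+ 2 * (X ^+ 2 + Y ^+ 2) = D^-1.
Proof.
transitivity ((u ^+ 2 + v ^+ 2 + s ^+ 2 + t ^+ 2) / D); last by rewrite N mul1r.
by rewrite /X /Y /D; field; rewrite b0 D0.
Qed.

(** The 1-form of the BCV metric with l / 2 = b, evaluated in the coordinates X, Y, Z, is the
    standard contact form of the 3-sphere divided by b. *)
Lemma stereo_form du dv ds dt :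
  stereo_dx du dv ds dt * (b * (Y / D^-1)) + stereo_dy du dv ds dt * (- (b * (X / D^-1)))
   + stereo_dz du dv ds dt = (u * dv - v * du + s * dt - t * ds) / b.
Proof.
transitivity ((s * dt - t * ds + (u * dv - v * du) * (1 - (s ^+ 2 + t ^+ 2)) / D) / b).
  by rewrite /stereo_dx /stereo_dy /stereo_dz /X /Y /D invrK; field; rewrite b0 D0.
have -> : 1 - (s ^+ 2 + t ^+ 2) = D by rewrite /D -N; ring.
by rewrite mulfK//; congr (_ / _); ring.
Qed.

(** The base part of the metric is |w1 dw2 - w2 dw1|^2 / b^2 and the fibre part is the square of the
    contact form over b^2; Lagrange's identity adds them up to the round metric. *)
Lemma stereo_isometry du dv ds dt du' dv' ds' dt' :
  u * du + v * dv + s * ds + t * dt = 0 ->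
  (stereo_dx du dv ds dt * stereo_dx du' dv' ds' dt'
   + stereo_dy du dv ds dt * stereo_dy du' dv' ds' dt') / D^-1 ^+ 2
  + (u * dv - v * du + s * dt - t * ds) / b * ((u * dv' - v * du' + s * dt' - t * ds') / b)
  = (du * du' + dv * dv' + ds * ds' + dt * dt') / b ^+ 2.
Proof.
move=> C; rewrite -(lagrange_identity du' dv' ds' dt' N C) /stereo_dx /stereo_dy /D.
rewrite exprVn invrK; field; by rewrite b0 D0.
Qed.

Lemma sum_stereo (a du dv ds dt : 'I_3 -> R) :
  let S x := \sum_k a k * x k in
  \sum_k a k * stereo_dx (du k) (dv k) (ds k) (dt k) = stereo_dx (S du) (S dv) (S ds) (S dt) /\
  \sum_k a k * stereo_dy (du k) (dv k) (ds k) (dt k) = stereo_dy (S du) (S dv) (S ds) (S dt).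
Proof. by rewrite /stereo_dx /stereo_dy !sum3E /=; split; ring. Qed.

End StereographicAlgebra.

Section StereographicDerivative.
Context {R : realType} {n : nat}.
Variables (b : R) (u v s t : 'rV[R]_n -> R) (p h : 'rV[R]_n) (du dv ds dt : R).
Hypotheses (b0 : b != 0) (u0 : u p != 0) (D0 : u p ^+ 2 + v p ^+ 2 != 0).
Hypotheses (uu : differentiable u p) (vv : differentiable v p).
Hypotheses (Du : is_derive p h u du) (Dv : is_derive p h v dv).
Hypotheses (Ds : is_derive p h s ds) (Dt : is_derive p h t dt).

Lemma is_derive_stereo :
  [/\ is_derive p h (fun q => (s q * u q + t q * v q) * (b * (u q ^+ 2 + v q ^+ 2))^-1)
        (stereo_dx b (u p) (v p) (s p) (t p) du dv ds dt),
      is_derive p h (fun q => (s q * v q + - (t q * u q)) * (b * (u q ^+ 2 + v q ^+ 2))^-1)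
        (stereo_dy b (u p) (v p) (s p) (t p) du dv ds dt) &
      is_derive p h (fun q => atan (v q * (u q)^-1) * b^-1)
        (stereo_dz b (u p) (v p) du dv ds dt)].
Proof.
have bD : b * (u p ^+ 2 + v p ^+ 2) != 0 by rewrite mulf_neq0.
have dD : is_derive p h (fun q => (b * (u q ^+ 2 + v q ^+ 2))^-1)
    (- (b * (u p ^+ 2 + v p ^+ 2)) ^- 2 * (b * (2 * u p * du + 2 * v p * dv))).
  apply: derive_ruleV => //; apply: derive_rule_eq; rewrite -![_ *: _]/(_ * _).
  by move: (u p) (v p) => *; ring.
split.
- apply: derive_rule_eq; rewrite -![_ *: _]/(_ * _).
  rewrite /stereo_dx; move: (u p) (v p) (s p) (t p) D0 => U V S T D.
  by field; rewrite D b0.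
- apply: derive_rule_eq; rewrite -![_ *: _]/(_ * _).
  rewrite /stereo_dy; move: (u p) (v p) (s p) (t p) D0 => U V S T D.
  by field; rewrite D b0.
- have dq : is_derive p h (fun q => v q * (u q)^-1) (v p * (- (u p) ^- 2 * du) + (u p)^-1 * dv).
    by apply: derive_ruleM => //; apply: derive_ruleV.
  have qq : differentiable (fun q => v q * (u q)^-1) p.
    by apply: differentiableM => //; exact: differentiableV.
  apply: derive_rule_eq.
    apply: derive_ruleM; apply: (derive_rule_comp qq dq).
  rewrite /stereo_dz /=; move: (u p) (v p) u0 D0 => U V U0 D.
  have D' : U ^+ 2 + V ^+ 2 != 0 by [].
  by field; rewrite U0 b0 D.
Qed.

End StereographicDerivative.

(** * Straightening the vertical field *)

Section FrameIsometry.
Context {R : realType}.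
Variables m l : R.
Notation f p := (bcv_factor m (p 0 0) (p 0 1)).
Notation E := (bcv_frame m l).

Lemma bcv_metric_gram (M : 'M[R]_3) (q : 'rV[R]_3) i j :
  (M *m bcv_metric m l q *m M^T) i j =
  (M i 0 * M j 0 + M i 1 * M j 1) / f q ^+ 2 +
  (M i 0 * bcv_form m l q 0 0 + M i 1 * bcv_form m l q 0 1 + M i 2)
  * (M j 0 * bcv_form m l q 0 0 + M j 1 * bcv_form m l q 0 1 + M j 2).
Proof.
have F2 : bcv_form m l q 0 2 = 1 by rewrite mxE.
rewrite mxE sum3E ![M^T _ _]mxE ![(_ *m _) _ _]mxE !sum3E !bcv_metricE F2 /=.
by move: (bcv_form m l q 0) (f q) => w F; ring.
Qed.

Lemma frame_isometry (U : set 'rV[R]_3) (Phi : 'rV[R]_3 -> 'rV[R]_3) p :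
  open U -> U p -> smooth U Phi -> f p != 0 ->
  (forall k k', let M := fun k i => fr m l k (fun q => Phi q 0 i) p in
    let w := bcv_form m l (Phi p) 0 in
    (M k 0 * M k' 0 + M k 1 * M k' 1) / f (Phi p) ^+ 2 +
    (M k 0 * w 0 + M k 1 * w 1 + M k 2) * (M k' 0 * w 0 + M k' 1 * w 1 + M k' 2)
    = (k == k')%:R) ->
  jac Phi p *m bcv_metric m l (Phi p) *m (jac Phi p)^T = bcv_metric m l p.
Proof.
move=> oU Up sP f0 H.
have EJ k i : (E p *m jac Phi p) k i = fr m l k (fun q => Phi q 0 i) p.
  rewrite mxE frE; last first.
    exact: differentiable_entry (smooth_differentiable sP Up).
  by apply: eq_bigr => j _; rewrite [jac _ _ _ _]mxE dcoord.unlock.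
have Eu := frame_unit l f0; have Et : (E p)^T \in unitmx by rewrite unitmx_tr.
apply: (can_inj (mulKmx Eu)); apply: (can_inj (mulmxK Et)).
rewrite [RHS]frame_orthonormal//.
transitivity ((E p *m jac Phi p) *m bcv_metric m l (Phi p) *m (E p *m jac Phi p)^T).
  by rewrite trmx_mul !mulmxA.
by apply/matrixP => k k'; rewrite bcv_metric_gram !EJ H mxE.
Qed.

End FrameIsometry.

(** [Q] is the reflection in the hyperplane orthogonal to a - b, or the identity when a = b. *)
Lemma reflection_exists {R : realFieldType} {n} (a b : 'rV[R]_n) :
  a *m a^T = b *m b^T -> exists Q : 'M[R]_n, Q *m Q^T = 1%:M /\ a *m Q = b.
Proof.
move=> ab; have [->|anb] := eqVneq a b.
  by exists 1%:M; rewrite trmx1 !mulmx1.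
have [w wE] : {w | w = a - b} by exists (a - b).
have w0 : w != 0 by rewrite wE subr_eq0.
pose d := (w *m w^T) 0 0.
have wd : w *m w^T = d%:M by rewrite [LHS]mx11_scalar.
have d0 : d != 0.
  apply: contra w0 => /eqP d0; apply/eqP/rowP => i; rewrite [RHS]mxE; apply/eqP.
  rewrite -sqrf_eq0; move: d0; rewrite /d mxE => /eqP; rewrite psumr_eq0.
    by move=> /allP/(_ i (mem_index_enum _)) /=; rewrite [w^T _ _]mxE -expr2.
  by move=> j _; rewrite [w^T _ _]mxE -expr2 sqr_ge0.
pose Q := 1%:M - (2 / d) *: (w^T *m w).
have QT : Q^T = Q by rewrite /Q linearB linearZ /= trmx1 trmx_mul trmxK.
have ww : w^T *m w *m (w^T *m w) = d *: (w^T *m w).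
  by rewrite mulmxA -(mulmxA w^T) wd mul_mx_scalar -scalemxAl.
exists Q; split.
  rewrite QT /Q mulmxBl mul1mx mulmxBr mulmx1 -scalemxAl -scalemxAr ww !scalerA.
  apply/matrixP => i j; rewrite !mxE; move: (\sum__ _) => S; field.
  by rewrite d0.
have abT : b *m a^T = a *m b^T by rewrite [LHS]mx11_scalar [RHS]mx11_scalar; congr (_%:M);
  rewrite !mxE; apply: eq_bigr => i _; rewrite !mxE mulrC.
have aw : (2 : R) *: (a *m w^T) = d%:M.
  rewrite -wd wE linearB /= mulmxBr mulmxBl !mulmxBr abT -ab.
  by move: (a *m a^T) (a *m b^T) => x y; apply/matrixP => i j; rewrite !mxE; ring.
rewrite /Q mulmxBr mulmx1 -scalemxAr mulmxA.
have -> : a *m w^T *m w = (d / 2) *: w.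
  have -> : a *m w^T = (d / 2)%:M.
    apply: (@scalerI _ _ (2 : R)); first by rewrite pnatr_eq0.
    by rewrite aw scale_scalar_mx; congr (_%:M); field.
  by rewrite mul_scalar_mx.
rewrite scalerA (_ : 2 / d * (d / 2) = 1) ?scale1r; first by rewrite wE opprB addrC subrK.
by field; rewrite d0.
Qed.

Lemma orthonormal_complement {R : rcfType} (c d : 'rV[R]_4) :
  exists e : 'rV[R]_4, [/\ (e *m e^T) = 1%:M, e *m c^T = 0 & e *m d^T = 0].
Proof.
pose K := row_mx c^T d^T.
have : kermx K != 0.
  rewrite -mxrank_eq0 mxrank_ker -lt0n subn_gt0.
  by apply: leq_ltn_trans (rank_leq_col K) _.
case/rowV0Pn => v /sub_kermxP; rewrite /K mul_mx_row => vK v0.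
have /eq_row_mx[vc vd] : row_mx (v *m c^T) (v *m d^T) = row_mx 0 0 by rewrite vK row_mx0.
pose n := (v *m v^T) 0 0.
have n0 : 0 < n.
  rewrite lt_def; apply/andP; split; last first.
    by rewrite /n mxE sumr_ge0// => i _; rewrite mxE -expr2 sqr_ge0.
  apply: contra v0 => /eqP; rewrite /n mxE => /eqP; rewrite psumr_eq0; last first.
    by move=> i _; rewrite mxE -expr2 sqr_ge0.
  move=> /allP H; apply/eqP/rowP => i; rewrite [RHS]mxE; apply/eqP.
  by have := H i (mem_index_enum _); rewrite /= mxE -expr2 sqrf_eq0.
exists ((Num.sqrt n)^-1 *: v); split.
- rewrite linearZ /= -scalemxAl -scalemxAr scalerA [v *m v^T]mx11_scalar -/n.
  rewrite scale_scalar_mx -invfM -expr2 sqr_sqrtr ?ltW// mulVf//.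
  by rewrite gt_eqF.
- by rewrite -scalemxAl vc scaler0.
- by rewrite -scalemxAl vd scaler0.
Qed.

(* [Phi] is a local isometry which takes the field [v] to a multiple of d/dz. *)
Definition straightens {R : realType} (m l : R) (O : set 'rV[R]_3)
    (v : 'I_3 -> 'rV[R]_3 -> R) (p0 : 'rV[R]_3) : Prop :=
  exists (U : set 'rV[R]_3) (Phi : 'rV[R]_3 -> 'rV[R]_3),
  [/\ open U, U `<=` O, U p0 & smooth U Phi] /\
  forall p, U p -> [/\ bcv_region m (Phi p),
     jac Phi p *m bcv_metric m l (Phi p) *m (jac Phi p)^T = bcv_metric m l p,
     \sum_k v k p * fr m l k (fun q => Phi q 0 0) p = 0 &
     \sum_k v k p * fr m l k (fun q => Phi q 0 1) p = 0].

Lemma open_pos {R : realType} {n} (U : set 'rV[R]_n) (u : 'rV[R]_n -> R) :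
  open U -> smooth U u -> open (U `&` [set x | 0 < u x]).
Proof.
move=> oU su; rewrite openE => x [Ux ux].
have cu := differentiable_continuous (smooth_differentiable su Ux).
have nU : nbhs x U by exact: open_nbhs_nbhs.
apply: filterI => //; have /cvgrPdist_lt/(_ _ ux) := cu.
apply: filterS => y /=; rewrite ltr_norml => /andP[_].
by rewrite ltrBlDr -ltrBlDl subrr.
Qed.

Section Straightening.
Context {R : realType}.
Variables (m l : R).
Notation f p := (bcv_factor m (p 0 0) (p 0 1)).
Notation E := (bcv_frame m l).
Variables (O : set 'rV[R]_3) (v : 'I_3 -> 'rV[R]_3 -> R) (s : 'rV[R]_3 -> R).
Hypotheses (oO : open O) (f0 : O `<=` bcv_region m).

Lemma straighten_vertical p0 : O p0 -> (forall p, O p -> v 0 p = 0) ->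
  (forall p, O p -> v 1 p = 0) -> straightens m l O v p0.
Proof.
move=> Op0 v0 v1; exists O, (fun p => p); split.
  by split => //; apply: smooth_mx => // i j; rewrite ord1; exact: smooth_coord.
move=> p Op; have frc k i : fr m l k (fun q : 'rV[R]_3 => q 0 i) p = E p k i.
  by apply: fr_rule; first exact: fr_coord.
split; first exact: f0.
- have -> : jac (fun q : 'rV[R]_3 => q) p = 1%:M.
    apply/matrixP => i j; rewrite !mxE; apply: derive_rule; first exact: is_derive_coord.
    by rewrite mxE eqxx eq_sym.
  by rewrite mul1mx trmx1 mulmx1.
- by rewrite sum3E !frc v0// v1// !mxE /= !mul0r mulr0 !addr0.
- by rewrite sum3E !frc v0// v1// !mxE /= !mul0r mulr0 !addr0.
Qed.

(** The frame is the standard basis and V a constant unit vector, so a linear orthogonal map does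
    it. It may be a reflection: orientation does not matter for an isometry. *)
Lemma straighten_flat p0 r : m = 0 -> l = 0 -> O = ball p0 r -> O p0 ->
  (forall i, smooth O (v i)) -> (forall k i p, O p -> fr m l k (v i) p = 0) ->
  (forall p, O p -> v 0 p ^+ 2 + v 1 p ^+ 2 + v 2 p ^+ 2 = 1) ->
  straightens m l O v p0.
Proof.
move=> m0 l0 OE Op0 sv fv u1.
have cv i p : O p -> v i p = v i p0.
  rewrite OE; apply: (fr_constant (m := m) (l := l)).
  - by move=> q Bq; apply: lt0r_neq0; apply: f0; rewrite OE.
  - by rewrite -OE.
  - by move=> k q; rewrite -OE; exact: fv.
pose a : 'rV[R]_3 := \row_i v i p0.
have [Q [QQ aQ]] : exists Q : 'M[R]_3, Q *m Q^T = 1%:M /\ a *m Q = delta_mx 0 2.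
  apply: reflection_exists; apply/rowP => i; rewrite ord1 !mxE !sum3E !mxE /=.
  by rewrite mul0r add0r mul1r add0r -!expr2 u1.
pose Phi (p : 'rV[R]_3) := p *m Q.
have f1 (p : 'rV[R]_3) : f p = 1 by rewrite /bcv_factor m0 mul0r addr0.
have PhiE i : (fun p => Phi p 0 i) = fun p => \sum_j p 0 j * Q j i.
  by apply/funext => p; rewrite mxE.
have sPhi : smooth O Phi.
  apply: smooth_mx => // i j; rewrite ord1 PhiE; apply: smooth_sum => // k.
  by apply: smoothM => //; [exact: smooth_coord|exact: smooth_cst].
have pdPhi p i j : is_derive p (delta_mx 0 i) (fun p => Phi p 0 j) (Q i j).
  rewrite PhiE; apply: derive_rule_eq.
    by apply: derive_rule_sum => k; apply: derive_ruleM; exact: is_derive_coord.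
  rewrite (bigD1 i)//= big1; first by rewrite !mxE !eqxx /= mulr0 add0r mulr1 addr0.
  by move=> k ki; rewrite !mxE eqxx /= (negPf ki) !mulr0 addr0.
have EI p : E p = 1%:M.
  apply/matrixP; apply: ord3P; apply: ord3P; rewrite !mxE /= ?f1// ?l0 ?mul0r ?oppr0//.
have gI p : bcv_metric m l p = 1%:M.
  have := frame_orthonormal l (p := p) (m := m); rewrite f1 oner_eq0 EI trmx1 mulmx1 mul1mx.
  by apply.
have frPhi p k i : O p -> fr m l k (fun q => Phi q 0 i) p = Q k i.
  move=> Op; rewrite frE; last first.
    exact: differentiable_entry (smooth_differentiable sPhi Op).
  rewrite EI dcoord.unlock (bigD1 k)//= big1 ?addr0; last first.
    by move=> j jk; rewrite mxE eq_sym (negPf jk) mul0r.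
  by rewrite mxE eqxx mul1r; have [_] := pdPhi p k i.
have vQ p i : O p -> \sum_k v k p * fr m l k (fun q => Phi q 0 i) p = (i == 2)%:R.
  move=> Op; under eq_bigr => k _ do rewrite (cv _ _ Op) (frPhi _ _ _ Op).
  transitivity ((a *m Q) 0 i); last by rewrite aQ !mxE.
  by rewrite mxE; apply: eq_bigr => k _; rewrite mxE.
exists O, Phi; split; first by split.
move=> p Op; split.
- by rewrite /bcv_region /= f1 ltr01.
- have -> : jac Phi p = Q by apply/matrixP => i j; rewrite mxE; have [_] := pdPhi p i j.
  by rewrite !gI mulmx1.
- by rewrite vQ.
- by rewrite vQ.
Qed.

(* Stereographic projection of a sphere around the point [hopf b p0], with the axes
   chosen so that the fibres become vertical. *)
Lemma straighten_round (b : R) p0 (B : 'M[R]_4) : b != 0 -> m = b ^+ 2 -> l = 2 * b ->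
  O p0 -> (forall i, smooth O (v i)) ->
  B^T = - B -> B *m B^T = 1%:M ->
  (forall p, O p -> \sum_k v k p *: dhopf b p k = b *: (hopf b p *m B^T)) ->
  straightens m l O v p0.
Proof.
move=> b0 mE lE Op0 sv BT BB VB.
have BTB : B^T *m B = 1%:M by exact: mulmx1C.
pose c := hopf b p0; pose d := c *m B^T.
have fb p : O p -> 0 < bcv_factor (b ^+ 2) (p 0 0) (p 0 1).
  by move=> /f0; rewrite /bcv_region /= mE.
have dot (x y : 'rV[R]_4) : (x *m y^T) 0 0 = \sum_i x 0 i * y 0 i.
  by rewrite mxE; apply: eq_bigr => i _; rewrite mxE.
have cc : c *m c^T = 1%:M.
  by rewrite [LHS]mx11_scalar dot hopf_norm// fb.
have skew (x : 'rV[R]_4) : x *m (x *m B^T)^T = 0.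
  rewrite trmx_mul trmxK mulmxA [LHS]mx11_scalar; set y := x *m B *m x^T.
  have yT : y^T = - y by rewrite /y !trmx_mul trmxK BT mulNmx mulmxN mulmxA.
  have y0 : y 0 0 = - y 0 0 by rewrite -{1}(trmxK y) [LHS]mxE yT mxE.
  have -> : y 0 0 = 0.
    by move: y0; move: (y 0 0) => z; lra.
  by apply/matrixP => i j; rewrite !mxE mul0rn.
have rotB (x y : 'rV[R]_4) : x *m B^T *m (y *m B^T)^T = x *m y^T.
  by rewrite trmx_mul trmxK mulmxA -(mulmxA x) BTB mulmx1.
have swap (x y : 'rV[R]_4) : x *m B^T *m y^T = - (x *m (y *m B^T)^T).
  by rewrite trmx_mul trmxK BT mulmxN mulNmx mulmxA.
have [e [ee ec ed]] := orthonormal_complement c d.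
(* In the orthonormal basis c, B c, e, B e the complex structure B is the standard one, so V acts on
   w 0 + i w 1 and w 2 + i w 3 as multiplication by i b. As c = hopf b p0, the point p0 itself has
   coordinates (1, 0, 0, 0). *)
pose A := \matrix_(i < 4) nth 0 [:: c; d; e; e *m B^T] i.
have tr0 (x y : 'rV[R]_4) : x *m y^T = 0 -> y *m x^T = 0.
  by move=> xy; rewrite -[LHS]trmxK trmx_mul trmxK xy trmx0.
have AA : A *m A^T = 1%:M.
  have key i j : (A *m A^T) i j = (row i A *m (row j A)^T) 0 0.
    by rewrite dot mxE; apply: eq_bigr => k _; rewrite !mxE.
  have cd : c *m d^T = 0 by exact: skew.
  have dd : d *m d^T = 1%:M by rewrite rotB.
  have eg : e *m (e *m B^T)^T = 0 by exact: skew.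
  have gg : e *m B^T *m (e *m B^T)^T = 1%:M by rewrite rotB.
  have gc : e *m B^T *m c^T = 0 by rewrite swap -/d ed oppr0.
  have gd : e *m B^T *m d^T = 0 by rewrite /d rotB.
  have dc := tr0 _ _ cd; have ce := tr0 _ _ ec; have de := tr0 _ _ ed.
  have ge := tr0 _ _ eg; have cg := tr0 _ _ gc; have dg := tr0 _ _ gd.
  apply/matrixP => i j; rewrite key !rowK; move: i j; apply: ord4P; apply: ord4P; rewrite /=;
    by rewrite ?cc ?cd ?dd ?eg ?gg ?gc ?gd ?dc ?ce ?de ?ge ?cg ?dg ?ee ?ec ?ed !mxE.
have ATA : A^T *m A = 1%:M by exact: mulmx1C.
pose w p i := \sum_C hopf b p 0 C * A i C.
pose dw p k i := \sum_C dhopf b p k 0 C * A i C.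
have rot (x y : 'rV[R]_4) : \sum_i (\sum_C x 0 C * A i C) * (\sum_C y 0 C * A i C)
    = \sum_C x 0 C * y 0 C.
  rewrite -!dot; transitivity (((x *m A^T) *m (y *m A^T)^T) 0 0).
    rewrite dot; apply: eq_bigr => i _; congr (_ * _);
      by rewrite [RHS]mxE; apply: eq_bigr => C _; rewrite [A^T _ _]mxE.
  by rewrite trmx_mul trmxK mulmxA -(mulmxA x) ATA mulmx1.
have wN p : O p -> w p 0 ^+ 2 + w p 1 ^+ 2 + w p 2 ^+ 2 + w p 3 ^+ 2 = 1.
  by move=> Op; have := rot (hopf b p) (hopf b p); rewrite hopf_norm ?fb// sum4E -!expr2.
have wC p k : w p 0 * dw p k 0 + w p 1 * dw p k 1 + w p 2 * dw p k 2 + w p 3 * dw p k 3 = 0.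
  by have := rot (hopf b p) (dhopf b p k); rewrite hopf_dhopf// sum4E.
have wG p k k' : O p -> dw p k 0 * dw p k' 0 + dw p k 1 * dw p k' 1 + dw p k 2 * dw p k' 2
    + dw p k 3 * dw p k' 3 = b ^+ 2 * (k == k')%:R.
  by move=> Op; have := rot (dhopf b p k) (dhopf b p k'); rewrite dhopf_gram ?fb// sum4E.
have Vw p i : O p -> \sum_k v k p * dw p k i = b * (hopf b p *m B^T *m (row i A)^T) 0 0.
  move=> Op; transitivity (((\sum_k v k p *: dhopf b p k) *m (row i A)^T) 0 0).
    rewrite dot; under [RHS]eq_bigr => C _ do rewrite summxE mulr_suml.
    rewrite [RHS]exchange_big /=; apply: eq_bigr => k _; rewrite mulr_sumr; apply: eq_bigr => C _.
    by rewrite [X in _ = X * _]mxE [row _ _ _ _]mxE mulrA.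
  by rewrite VB// -scalemxAl mxE.
have wdot p i : (hopf b p *m (row i A)^T) 0 0 = w p i.
  by rewrite dot; apply: eq_bigr => C _; rewrite [row _ _ _ _]mxE.
have V0 p : O p -> \sum_k v k p * dw p k 0 = - (b * w p 1).
  by move=> Op; rewrite Vw// -wdot !rowK /= swap -/d mxE mulrN.
have V1 p : O p -> \sum_k v k p * dw p k 1 = b * w p 0.
  by move=> Op; rewrite Vw// -wdot !rowK /= /d rotB.
have V2 p : O p -> \sum_k v k p * dw p k 2 = - (b * w p 3).
  by move=> Op; rewrite Vw// -wdot !rowK /= swap mxE mulrN.
have V3 p : O p -> \sum_k v k p * dw p k 3 = b * w p 2.
  by move=> Op; rewrite Vw// -wdot !rowK /= rotB.
have sw i : smooth O (fun p => w p i).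
  apply: smooth_sum => // C; apply: smoothM => //; last exact: smooth_cst.
  by apply: smooth_hopf => // p; exact: fb.
have Dw p k i : O p -> is_derive p (row k (bcv_frame (b ^+ 2) (2 * b) p))
    (fun q => w q i) (dw p k i).
  move=> Op; apply: derive_rule_eq.
    by apply: derive_rule_sum => C; apply: derive_ruleM; apply: is_derive_hopf; exact: fb.
  by apply: eq_bigr => C _; rewrite mulr0 add0r mulrC.
have sU : smooth O (fun p => w p 0) by exact: sw.
(* Positivity of w 0 keeps the denominators nonzero and makes atan (w 1 / w 0) the argument of w 0 +
   i w 1; at p0 its value is 1. *)
pose U := O `&` [set p | 0 < w p 0].
have oU : open U by exact: open_pos.
have UO : U `<=` O by move=> p [].
have Up0 : U p0.
  split => //=; rewrite (_ : w p0 0 = 1)//.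
  by have := wdot p0 0; rewrite rowK /= -/c cc mxE => <-.
have w0 p : U p -> w p 0 != 0 by move=> [_] /=; exact: lt0r_neq0.
have D0 p : U p -> w p 0 ^+ 2 + w p 1 ^+ 2 != 0.
  move=> Up; apply: lt0r_neq0; apply: ltr_wpDr; first exact: sqr_ge0.
  by rewrite exprn_even_gt0//= w0.
have swU i : smooth U (fun p => w p i) by exact: smooth_sub (sw i).
(* The inverse of [hopf], applied to the rotated coordinates w. *)
pose X p := (w p 2 * w p 0 + w p 3 * w p 1) * (b * (w p 0 ^+ 2 + w p 1 ^+ 2))^-1.
pose Y p := (w p 2 * w p 1 + - (w p 3 * w p 0)) * (b * (w p 0 ^+ 2 + w p 1 ^+ 2))^-1.
pose Z p := atan (w p 1 * (w p 0)^-1) * b^-1.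
pose Phi p : 'rV[R]_3 := \row_i [:: X p; Y p; Z p]`_i.
have Phi0 : (fun p => Phi p 0 0) = X by apply/funext => p; rewrite mxE.
have Phi1 : (fun p => Phi p 0 1) = Y by apply/funext => p; rewrite mxE.
have Phi2 : (fun p => Phi p 0 2) = Z by apply/funext => p; rewrite mxE.
have sPhi : smooth U Phi.
  have siD : smooth U (fun p => (b * (w p 0 ^+ 2 + w p 1 ^+ 2))^-1).
    apply: smoothV => //; first by move=> p Up; rewrite mulf_neq0// D0.
    by smooth_by ltac:(first [exact: oU|exact: swU]).
  apply: smooth_mx => // i j; rewrite ord1; move: j; apply: ord3P.
  - by rewrite Phi0; smooth_by ltac:(first [exact: oU|exact: swU|exact: siD]).
  - by rewrite Phi1; smooth_by ltac:(first [exact: oU|exact: swU|exact: siD]).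
  - rewrite Phi2; apply: smoothM => //; last exact: smooth_cst.
    by apply: smooth_atan => //; apply: smooth_div.
have dPhi p k : U p ->
    [/\ fr m l k X p = stereo_dx b (w p 0) (w p 1) (w p 2) (w p 3)
          (dw p k 0) (dw p k 1) (dw p k 2) (dw p k 3),
        fr m l k Y p = stereo_dy b (w p 0) (w p 1) (w p 2) (w p 3)
          (dw p k 0) (dw p k 1) (dw p k 2) (dw p k 3) &
        fr m l k Z p = stereo_dz b (w p 0) (w p 1) (dw p k 0) (dw p k 1) (dw p k 2) (dw p k 3)].
  move=> Up; have Op := UO _ Up; rewrite mE lE.
  have df i := smooth_differentiable (sw i) Op.
  have [dX dY dZ] := is_derive_stereo b0 (w0 _ Up) (D0 _ Up) (df 0) (df 1)
    (Dw p k 0 Op) (Dw p k 1 Op) (Dw p k 2 Op) (Dw p k 3 Op).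
  by split; [exact: fr_rule dX erefl|exact: fr_rule dY erefl|exact: fr_rule dZ erefl].
exists U, Phi; split; first by split.
move=> p Up; have Op := UO _ Up; have N := wN _ Op; have D := D0 _ Up.
have fPhi : bcv_factor m (Phi p 0 0) (Phi p 0 1) = (w p 0 ^+ 2 + w p 1 ^+ 2)^-1.
  by rewrite /bcv_factor mE !mxE /=; exact: stereo_factor b0 D N.
split.
- by rewrite /bcv_region /= fPhi invr_gt0 lt_def D addr_ge0 ?sqr_ge0.
- apply: (frame_isometry (U := U)) => //; first exact: lt0r_neq0 (f0 Op).
  move=> k k' /=; rewrite Phi0 Phi1 Phi2 fPhi.
  have F0 : bcv_form m l (Phi p) 0 0 = b * (Y p / (w p 0 ^+ 2 + w p 1 ^+ 2)^-1).
    by rewrite mxE /= fPhi [Phi _ _ _]mxE /= lE; congr (_ * _); field.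
  have F1 : bcv_form m l (Phi p) 0 1 = - (b * (X p / (w p 0 ^+ 2 + w p 1 ^+ 2)^-1)).
    by rewrite mxE /= fPhi [Phi _ _ _]mxE /= lE; congr (- (_ * _)); field.
  have [-> -> ->] := dPhi p k Up; have [-> -> ->] := dPhi p k' Up.
  rewrite F0 F1 !(stereo_form b0 D N) (stereo_isometry b0 D N) ?wC// wG//.
  by rewrite mulrC mulKf// expf_neq0.
(* V multiplies both complex coordinates by i b to first order, so their quotient, which gives X and
   Y, is constant along V. *)
- rewrite Phi0; under eq_bigr => k _ do have [-> _ _] := dPhi p k Up.
  by have [-> _] := sum_stereo b (w p 0) (w p 1) (w p 2) (w p 3)
    (fun k => v k p) (fun k => dw p k 0) (fun k => dw p k 1) (fun k => dw p k 2) (fun k => dw p k 3);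
   rewrite V0// V1// V2// V3// /stereo_dx; ring.
- rewrite Phi1; under eq_bigr => k _ do have [_ -> _] := dPhi p k Up.
  by have [_ ->] := sum_stereo b (w p 0) (w p 1) (w p 2) (w p 3)
    (fun k => v k p) (fun k => dw p k 0) (fun k => dw p k 1) (fun k => dw p k 2) (fun k => dw p k 3);
   rewrite V0// V1// V2// V3// /stereo_dy; ring.
Qed.

End Straightening.

(** * Local form of the submersion *)

Lemma straightens_sub {R : realType} (m l : R) (O O' : set 'rV[R]_3) v p0 :
  O' `<=` O -> straightens m l O' v p0 -> straightens m l O v p0.
Proof.
move=> OO' [U [Phi [[oU UO Up sP] H]]]; exists U, Phi; split => //; split => //.
exact: subset_trans UO OO'.
Qed.

Lemma vertical_field_straightens {R : realType} (m l : R) (O : set 'rV[R]_3)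
    (v : 'I_3 -> 'rV[R]_3 -> R) (s : 'rV[R]_3 -> R) p0 :
  open O -> O `<=` bcv_region m -> O p0 ->
  (forall i, smooth O (v i)) -> smooth O s ->
  (forall p, O p -> v 0 p ^+ 2 + v 1 p ^+ 2 + v 2 p ^+ 2 = 1) ->
  (forall p, O p -> killing_equations m l v s p) ->
  straightens m l O v p0.
Proof.
move=> oO O_reg Op0 sv ss u1 frv.
have rig := vertical_rigidity oO sv ss u1 frv.
(* A ball is taken because there vanishing derivatives imply constancy. *)
have [r r0 rO] : exists2 r, 0 < r & ball p0 r `<=` O.
  by have /nbhs_ballP[r r0 rO] := open_nbhs_nbhs (conj oO Op0); exists r.
apply: (straightens_sub rO).
have oB : open (ball p0 r) by exact: ball_open.
have Bp0 : ball p0 r p0 by exact: ballxx.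
have B_reg : ball p0 r `<=` bcv_region m by exact: subset_trans O_reg.
have sv' i : smooth (ball p0 r) (v i) by exact: smooth_sub (sv i).
have ss' : smooth (ball p0 r) s by exact: smooth_sub ss.
have [lm|lm] := eqVneq (l ^+ 2 - 4 * m) 0; last first.
  apply: straighten_vertical => // p /rO Op; have [_ _ E0 E1] := rig p Op.
  - by move/eqP: E0; rewrite mulf_eq0 (negPf lm) => /eqP.
  - by move/eqP: E1; rewrite mulf_eq0 (negPf lm) => /eqP.
have f0 p : ball p0 r p -> bcv_factor m (p 0 0) (p 0 1) != 0.
  by move=> /B_reg; exact: lt0r_neq0.
have [l0|l0] := eqVneq l 0.
  have m0 : m = 0 by move: lm; rewrite l0; lra.
  apply: (straighten_flat oB B_reg m0 l0 erefl Bp0 sv'); last by move=> p /rO; exact: u1.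
  (* Both possible values of s are 0 when l = 0, and with m = 0 all right-hand sides of
     [killing_equations] vanish. *)
  move=> k i p /rO Op; have s0 : s p = 0 by have [[]] := rig p Op; rewrite l0.
  have [[a00 a01 a02] [a10 a11 a12] [a20 a21 a22]] := frv p Op.
  have z := (m0, l0, s0, oppr0, mulr0, mul0r, addr0, subr0).
  move: k i; apply: ord3P; apply: ord3P;
    by rewrite ?a00 ?a01 ?a02 ?a10 ?a11 ?a12 ?a20 ?a21 ?a22 ?z.
have [b [b0 mE lE]] : exists b, [/\ b != 0, m = b ^+ 2 & l = 2 * b].
  exists (l / 2); split; first by rewrite mulf_neq0// invr_neq0// pnatr_eq0.
    by move: lm => E; apply/eqP; rewrite -subr_eq0; apply/eqP; lra.
  by rewrite mulrCA divff ?mulr1// pnatr_eq0.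
have sc p : ball p0 r p -> s p = s p0.
  apply: (fr_constant f0 ss' (l := l)) => k q /rO Oq.
  by have [_ + _ _] := rig q Oq; apply.
have frv' p (Bp : ball p0 r p) := frv p (rO p Bp).
have u1' p (Bp : ball p0 r p) := u1 p (rO p Bp).
have [B [BT BB VB]] : exists B : 'M[R]_4, [/\ B^T = - B, B *m B^T = 1%:M &
    forall p, ball p0 r p -> \sum_k v k p *: dhopf b p k = b *: (hopf b p *m B^T)].
  have [[s0|sl] _ _ _] := rig p0 Op0.
  - have s0' p : ball p0 r p -> s p = 0 by move=> Bp; rewrite sc.
    move: B_reg frv'; rewrite mE lE => B_reg' frv2.
    exact: (hopf_vertical_left r0 B_reg' sv' u1' frv2 s0').
  - have sl' p : ball p0 r p -> s p = l by move=> Bp; rewrite sc.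
    move: B_reg frv' sl'; rewrite mE lE => B_reg' frv2 sl2.
    exact: (hopf_vertical_right r0 B_reg' sv' u1' frv2 sl2).
exact: (straighten_round oB B_reg b0 mE lE Bp0 sv' BT BB VB).
Qed.

Lemma smooth_continuous {R : realType} {n} {V : normedModType R} (U : set 'rV[R]_n)
    (f : 'rV[R]_n -> V) x : smooth U f -> U x -> {for x, continuous f}.
Proof. by move=> sf; exact: (sf 0%N). Qed.

Lemma open_setI_preimage {T S : topologicalType} (U : set T) (W : set S) (f : T -> S) :
  open U -> open W -> (forall x, U x -> {for x, continuous f}) -> open (U `&` f @^-1` W).
Proof.
move=> oU oW cf; rewrite openE => x [Ux Wfx].
have nU : nbhs x U by exact: open_nbhs_nbhs.
apply: filterI => //; apply: (cf x Ux); exact: open_nbhs_nbhs.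
Qed.

Lemma isometry_jac_neq0 {R : fieldType} {n} (G H J : 'M[R]_n) :
  G = J *m H *m J^T -> \det G != 0 -> \det J != 0.
Proof. by move=> ->; rewrite !det_mulmx det_tr; apply: contraNneq => ->; rewrite mulr0. Qed.

Lemma bcv_metric_det {R : realType} (m l : R) (p : 'rV[R]_3) :
  bcv_factor m (p 0 0) (p 0 1) != 0 -> \det (bcv_metric m l p) != 0.
Proof. by move=> /(bcv_metric_unit l); rewrite unitmxE unitfE. Qed.

(** The map [bcv_proj], typed between spaces of row vectors so that the calculus applies to it. *)
Definition proj32 {R : realType} (p : 'rV[R]_3) : 'rV[R]_2 :=
  \row_(i < 2) [:: p 0 0; p 0 1]`_i.

Lemma smooth_proj32 {R : realType} (U : set 'rV[R]_3) : open U -> smooth U proj32.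
Proof.
move=> oU; apply: smooth_mx => // i j; rewrite ord1; move: j; apply: ord2P.
- by rewrite (_ : (fun _ => _) = fun p : 'rV[R]_3 => p 0 0);
    [exact: smooth_coord|apply/funext => p; rewrite mxE].
- by rewrite (_ : (fun _ => _) = fun p : 'rV[R]_3 => p 0 1);
    [exact: smooth_coord|apply/funext => p; rewrite mxE].
Qed.

Lemma proj32_jac {R : realType} (p : 'rV[R]_3) i j : jac proj32 p i j = (i == j :> nat)%:R.
Proof.
rewrite mxE; move: j; apply: ord2P.
- rewrite (_ : (fun _ => _) = fun p : 'rV[R]_3 => p 0 0); last first.
    by apply/funext => q; rewrite mxE.
  apply: derive_rule; first exact: is_derive_coord.
  by rewrite mxE eqxx /= eq_sym.
- rewrite (_ : (fun _ => _) = fun p : 'rV[R]_3 => p 0 1); last first.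
    by apply/funext => q; rewrite mxE.
  apply: derive_rule; first exact: is_derive_coord.
  by rewrite mxE eqxx /= eq_sym.
Qed.

Lemma jac_compose {R : realType} {n k h} (U : set 'rV[R]_n) (F : 'rV[R]_n -> 'rV[R]_h)
    (Phi : 'rV[R]_n -> 'rV[R]_k) (G : 'rV[R]_k -> 'rV[R]_h) p :
  open U -> U p -> (forall q, U q -> F q = G (Phi q)) ->
  differentiable Phi p -> differentiable G (Phi p) ->
  jac F p = jac Phi p *m jac G (Phi p).
Proof.
move=> oU Up FG dP dG; apply/matrixP => i c; rewrite !mxE.
transitivity (pd i (fun y => (fun z => G z 0 c) (Phi y)) p).
  by rewrite /pd; apply: near_eq_derive; apply: near_of_open oU Up _ => q Uq; rewrite FG.
rewrite (@pd_compose _ _ _ Phi (fun z => G z 0 c))//; last exact: differentiable_entry.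
by apply: eq_bigr => a _; rewrite !mxE mulrC.
Qed.

Lemma frame_jacE {R : realType} {k} (m l : R) (u : 'rV[R]_3 -> 'rV[R]_k) p i c :
  differentiable u p ->
  (bcv_frame m l p *m jac u p) i c = fr m l i (fun q => u q 0 c) p.
Proof.
move=> du; rewrite mxE frE; last exact: differentiable_entry.
by apply: eq_bigr => j _; rewrite [jac _ _ _ _]mxE dcoord.unlock.
Qed.

Lemma ball_rowP {R : realType} {n} (p q : 'rV[R]_n) r :
  0 < r -> ball p r q <-> forall i, `|p 0 i - q 0 i| < r.
Proof. by move=> r0; split=> [[_ H] i|H]; [exact: H|split=> // i j; rewrite ord1; exact: H]. Qed.

(* Near [p0], an isometry [Phi] takes the map [F] to the projection onto the base followed by
   an isometry [G] of the base metric onto [H]; the inverses are [Phi'] and [G']. *)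
Definition factors_through_base {R : realType} (m l : R) (O : set 'rV[R]_3)
    (W : set 'rV[R]_2) (F : 'rV[R]_3 -> 'rV[R]_2) (H : 'rV[R]_2 -> 'M[R]_2)
    (p0 : 'rV[R]_3) : Prop :=
  exists (U : set 'rV[R]_3) (Phi Phi' : 'rV[R]_3 -> 'rV[R]_3)
    (D : set 'rV[R]_2) (G G' : 'rV[R]_2 -> 'rV[R]_2),
  [/\ [/\ open U, U `<=` O, U p0, smooth U Phi & open (Phi @` U)],
      [/\ smooth (Phi @` U) Phi', forall p, U p -> Phi' (Phi p) = p,
          forall p, U p -> bcv_region m (Phi p) &
          forall p, U p ->
            jac Phi p *m bcv_metric m l (Phi p) *m (jac Phi p)^T = bcv_metric m l p],
      [/\ open D, forall y, D y -> 0 < bcv_factor m (y 0 0) (y 0 1),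
          smooth D G, open (G @` D) & smooth (G @` D) G'],
      [/\ forall y, D y -> G' (G y) = y, forall y, D y -> W (G y) &
          forall y, D y -> base_metric m y = jac G y *m H (G y) *m (jac G y)^T] &
      [/\ forall p, U p -> D (proj32 (Phi p)),
          forall p, U p -> F p = G (proj32 (Phi p)) &
          forall y, D y -> exists2 p, U p & proj32 (Phi p) = y]].

Section LocalForm.
Context {R : realType}.
Variables m l : R.
Notation f p := (bcv_factor m (p 0 0) (p 0 1)).
Notation E := (bcv_frame m l).
Notation fr := (fr m l).
Variables (O : set 'rV[R]_3) (W : set 'rV[R]_2) (F : 'rV[R]_3 -> 'rV[R]_2)
  (H : 'rV[R]_2 -> 'M[R]_2) (v : 'I_3 -> 'rV[R]_3 -> R) (p0 : 'rV[R]_3).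
Hypotheses (oO : open O) (O_reg : O `<=` bcv_region m).
Hypotheses (OW : forall p, O p -> W (F p)) (sF : smooth O F).
Hypothesis gram : forall p, O p ->
  (E p *m jac F p)^T *m (E p *m jac F p) *m H (F p) = 1%:M.
Hypothesis unit_v : forall p, O p -> v 0 p ^+ 2 + v 1 p ^+ 2 + v 2 p ^+ 2 = 1.
Hypothesis vert : forall c p, O p -> \sum_i v i p * fr i (fun q => F q 0 c) p = 0.
Hypothesis str : straightens m l O v p0.

Lemma local_form : factors_through_base m l O W F H p0.
Proof.
have [U1 [Phi [[oU1 U1O U1p0 sPhi] U1H]]] := str.
have O0 p : O p -> f p != 0 by move=> /O_reg; exact: lt0r_neq0.
have detPhi p : U1 p -> \det (jac Phi p) != 0.
  move=> Up; have [_ iso _ _] := U1H p Up.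
  by apply: (isometry_jac_neq0 (esym iso)); apply: bcv_metric_det; apply: O0; exact: U1O.
have [D1 [oD1 D1p0 D1U1 oPD1 [Phi' [sPhi' Phi'K]]]] :=
  inverse_function oU1 U1p0 sPhi (detPhi _ U1p0).
have D1O : D1 `<=` O by exact: subset_trans U1O.
have sPhi1 : smooth D1 Phi by exact: smooth_sub sPhi.
pose q0 := Phi p0.
(* In the sup norm this ball is a cube: its projection to the plane is a ball of the same radius,
   and vertical segments between its points stay inside. *)
have [r r0 rV] : exists2 r, 0 < r & ball q0 r `<=` Phi @` D1.
  have Vq0 : (Phi @` D1) q0 by exists p0.
  by have /nbhs_ballP[r r0 rO] := open_nbhs_nbhs (conj oPD1 Vq0); exists r.
pose B := ball q0 r.
have oB : open B by exact: ball_open.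
pose G3 q := F (Phi' q).
have Phi'D q : B q -> D1 (Phi' q) by move=> /rV[p Dp <-]; rewrite Phi'K.
have PhiK q : B q -> Phi (Phi' q) = q by move=> /rV[p Dp <-]; rewrite Phi'K.
have sPhiB : smooth B Phi' by exact: smooth_sub sPhi'.
have sG3 : smooth B G3.
  apply: (smooth_compose_mx oB oO (W := O)) => //; by move=> q /Phi'D /D1O.
pose U2 := D1 `&` Phi @^-1` B.
have oU2 : open U2.
  by apply: open_setI_preimage => // p Dp; exact: smooth_continuous sPhi1 Dp.
have U2D1 : U2 `<=` D1 by move=> p [].
have sPhi2 : smooth U2 Phi by exact: smooth_sub sPhi1.
have FG3 p : U2 p -> F p = G3 (Phi p) by move=> [Dp _]; rewrite /G3 Phi'K.
have U2' q : B q -> U2 (Phi' q) by move=> Bq; split; [exact: Phi'D|rewrite /= PhiK].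
pose M p := E p *m jac Phi p.
have jacF p : U2 p -> E p *m jac F p = M p *m jac G3 (Phi p).
  move=> Up; rewrite /M -mulmxA; congr (_ *m _); apply: (jac_compose oU2 Up FG3).
    exact: smooth_differentiable sPhi2 Up.
  by apply: smooth_differentiable sG3 _; case: Up.
have ME p : U2 p -> M p *m bcv_metric m l (Phi p) *m (M p)^T = 1%:M.
  move=> Up; have Up1 : U1 p by apply: D1U1; exact: U2D1.
  have [_ iso _ _] := U1H p Up1.
  rewrite /M trmx_mul !mulmxA -(mulmxA (E p)) -(mulmxA (E p)) iso.
  by rewrite frame_orthonormal// O0//; exact: U1O.
(* [Phi] carries the vertical unit field to a multiple of d/dz. *)
have dG3 c q : B q -> pd 2 (fun y => G3 y 0 c) q = 0.
  move=> Bq; set p := Phi' q; have Up : U2 p by exact: U2'.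
  have Op : O p by apply: D1O; exact: U2D1.
  have [_ _ z0 z1] := U1H p (D1U1 _ (U2D1 _ Up)).
  pose V : 'rV[R]_3 := \row_i v i p.
  have Mu : M p \in unitmx by have := ME p Up; rewrite -mulmxA => /mulmx1_unit[].
  have dPhi : differentiable Phi p by exact: smooth_differentiable sPhi2 Up.
  have VM i : (V *m M p) 0 i = \sum_k v k p * fr k (fun q => Phi q 0 i) p.
    by rewrite mxE; apply: eq_bigr => k _; rewrite /M frame_jacE// mxE.
  (* The image of V under [Phi] has no x and y components; it is nonzero, V being a unit vector and
     [M p] invertible, so its z component is nonzero. *)
  have VM0 : (V *m M p) 0 2 != 0.
    apply/eqP => E2; have VM0 : V *m M p = 0.
      apply/rowP; apply: ord3P; rewrite [RHS]mxE.
      - by rewrite VM.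
      - by rewrite VM.
      - by [].
    have V0 : V = 0 by rewrite -(mulmxK Mu V) VM0 mul0mx.
    have vz i : v i p = 0 by move/rowP/(_ i): V0; rewrite !mxE.
    by have := unit_v Op; rewrite !vz expr0n /= !addr0 => /eqP; rewrite eq_sym oner_eq0.
  have : (V *m M p *m jac G3 (Phi p)) 0 c = 0.
    rewrite -mulmxA -jacF// -(vert c Op) mxE; apply: eq_bigr => k _.
    by rewrite frame_jacE ?mxE//; exact: smooth_differentiable sF Op.
  rewrite mxE sum3E [X in X * _]VM z0 [X in _ + X * _ + _]VM z1 !mul0r !add0r => /eqP.
  by rewrite mulf_eq0 (negPf VM0) /= => /eqP; rewrite mxE /p PhiK.
pose y0 := proj32 q0.
(* The section of the projection at the height of q0; it maps [B2] into the cube [B]. *)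
pose lift2 (y : 'rV[R]_2) : 'rV[R]_3 := \row_i [:: y 0 0; y 0 1; q0 0 2]`_i.
have lift2K y : proj32 (lift2 y) = y.
  by apply/rowP; apply: ord2P; rewrite !mxE.
pose B2 := ball y0 r.
have oB2 : open B2 by exact: ball_open.
have B2y0 : B2 y0 by exact: ballxx.
have lift2B y : B2 y -> B (lift2 y).
  move=> /(ball_rowP _ _ r0) yB; apply/(ball_rowP _ _ r0); apply: ord3P; rewrite [lift2 _ _ _]mxE /=.
  - by have := yB 0; rewrite mxE.
  - by have := yB 1; rewrite mxE.
  - by rewrite subrr normr0.
have projB q : B q -> B2 (proj32 q).
  move=> /(ball_rowP _ _ r0) qB; apply/(ball_rowP _ _ r0); apply: ord2P; rewrite !mxE /=; exact: qB.
pose G y := G3 (lift2 y).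
have G3E q : B q -> G3 q = G (proj32 q).
  move=> Bq; set x := lift2 (proj32 q); pose w := q - x.
  have Bx : B x by apply: lift2B; exact: projB.
  have w0 : w 0 0 = 0 by rewrite !mxE /= ?mxE /= subrr.
  have w1 : w 0 1 = 0 by rewrite !mxE /= ?mxE /= subrr.
  have qE : q = x + w by rewrite /w addrC subrK.
  have Bt t : 0 <= t <= 1 -> B (x + t *: w) by move=> t01; exact: convex_ball.
  have dt c t (t01 : 0 <= t <= 1) :
      differentiable (fun y => G3 y 0 c) (x + t *: w).
    exact: differentiable_entry (smooth_differentiable sG3 (Bt t t01)).
  apply/rowP => c; rewrite [in LHS]qE; apply: (constant_on_line (dt c)) => t t01.
  rewrite derive_pd; last exact: dt.
  by rewrite sum3E w0 w1 dG3 ?mul0r ?mulr0 ?addr0//; exact: Bt.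
have slift : smooth B2 lift2.
  apply: smooth_mx => // i j; rewrite ord1; move: j; apply: ord3P.
  - by apply: (eq_smooth oB2 _ (smooth_coord 0 oB2)) => x _; rewrite mxE.
  - by apply: (eq_smooth oB2 _ (smooth_coord 1 oB2)) => x _; rewrite mxE.
  - by apply: (eq_smooth oB2 _ (smooth_cst B2 (q0 0 2))) => x _; rewrite mxE.
have sG : smooth B2 G by exact: (smooth_compose_mx oB2 oB lift2B slift sG3).
have GW y : B2 y -> W (G y).
  by move=> /lift2B/Phi'D/D1O Oy; exact: OW.
have reg2 y : B2 y -> 0 < bcv_factor m (y 0 0) (y 0 1).
  move=> /lift2B By; have [+ _ _ _] := U1H _ (D1U1 _ (Phi'D _ By)).
  by rewrite PhiK// /bcv_region /= !mxE.
have isoG y : B2 y -> base_metric m y = jac G y *m H (G y) *m (jac G y)^T.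
  move=> By; set q := lift2 y; have Bq : B q by exact: lift2B.
  set p := Phi' q; have Up : U2 p by exact: U2'.
  have Pq : Phi p = q by exact: PhiK.
  have fq : bcv_factor m (q 0 0) (q 0 1) = bcv_factor m (y 0 0) (y 0 1) by rewrite !mxE.
  have fy0 := lt0r_neq0 (reg2 y By).
  have JG3 : jac G3 q = jac proj32 q *m jac G y.
    rewrite -{1}(lift2K y); apply: (jac_compose oB Bq G3E).
      exact: smooth_differentiable (smooth_proj32 openT) I.
    by rewrite lift2K; exact: smooth_differentiable sG By.
  (* [M p], the image of the frame at p under the isometry [Phi], and the frame [E q] are both
     orthonormal at q, so both give the inverse metric there. The submersion identity [gram] at p
     can then be read in the standard frame at q, where the projection contributes the factor
     f^2. *)
  have MM : (M p)^T *m M p = (E q)^T *m E q.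
    rewrite -bcv_metric_inv ?fq// -Pq; apply/esym.
    have /mulmx1C := ME p Up; rewrite mulmxA => MMg.
    have gu : bcv_metric m l (Phi p) \in unitmx by rewrite bcv_metric_unit// Pq fq.
    by rewrite -[RHS](mulmxK gu) MMg mul1mx.
  have PEP : (jac proj32 q)^T *m ((E q)^T *m E q) *m jac proj32 q
      = (bcv_factor m (y 0 0) (y 0 1) ^+ 2)%:M.
    rewrite -fq; have EP i j : (E q *m jac proj32 q) i j
        = bcv_factor m (q 0 0) (q 0 1) * (i == j :> nat)%:R.
      rewrite mxE sum3E !proj32_jac; move: i j; apply: ord3P; apply: ord2P;
      by rewrite !mxE /= !(mulr0, mul0r, addr0, add0r).
    rewrite -mulmxA -(mulmxA _^T) mulmxA -trmx_mul; apply/matrixP => i j.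
    rewrite mxE sum3E ![(_^T) _ _]mxE !EP [RHS]mxE.
    by move: i j; apply: ord2P; apply: ord2P; rewrite /=; ring.
  have := gram (D1O _ (U2D1 _ Up)); rewrite jacF// Pq JG3 FG3// Pq.
  have -> : G3 q = G y by [].
  move: PEP; rewrite -MM; move: (M p) (jac proj32 q) (jac G y) (H (G y)) => A P J h PEP.
  have -> : (A *m (P *m J))^T *m (A *m (P *m J)) *m h
      = J^T *m (P^T *m (A^T *m A) *m P) *m (J *m h) by rewrite !trmx_mul !mulmxA.
  rewrite PEP mul_mx_scalar -scalemxAl => EQ.
  have f2 : bcv_factor m (y 0 0) (y 0 1) ^+ 2 != 0 by rewrite expf_neq0.
  have JJ : J^T *m (bcv_factor m (y 0 0) (y 0 1) ^+ 2 *: (J *m h)) = 1%:M.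
    by rewrite -scalemxAr.
  have /mulmx1C := JJ; rewrite -scalemxAl => {}JJ.
  by rewrite /base_metric -JJ scalerA mulVf// scale1r.
have detG : \det (jac G y0) != 0.
  apply: (isometry_jac_neq0 (isoG y0 B2y0)); apply: det_base_metric; exact: reg2.
have [D [oD Dy0 DB2 oGD [G' [sG' G'K]]]] := inverse_function oB2 B2y0 sG detG.
(* The neighbourhood is cut down so that its image under [Phi] lies exactly over [D]: each y in [D]
   is hit by [lift2 y], which makes the image of [U] under [F] equal to the image of [D] under
   [G]. *)
pose T := B `&` proj32 @^-1` D.
have oT : open T.
  apply: open_setI_preimage => // q _.
  exact: smooth_continuous (smooth_proj32 openT) I.
pose U := D1 `&` Phi @^-1` T.
have oU : open U.
  by apply: open_setI_preimage => // q Dq; exact: smooth_continuous sPhi1 Dq.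
have UU2 : U `<=` U2 by move=> p [Dp [Bp _]].
have PhiU : Phi @` U = T.
  apply/seteqP; split => [q [p [_ Tp] <-] //|q Tq].
  have [Bq Dq] := Tq; exists (Phi' q); last exact: PhiK.
  by split; [exact: Phi'D|rewrite /= PhiK].
exists U, Phi, Phi', D, G, G'; split.
- split => //; first by move=> p [/D1O].
  + by split => //; split; [exact: ballxx|].
  + by apply: smooth_sub sPhi1 => p [].
  + by rewrite PhiU.
- split; first by rewrite PhiU; apply: smooth_sub sPhi' => q [/rV].
  + by move=> p [Dp _]; exact: Phi'K.
  + by move=> p [/D1U1/U1H[]].
  + by move=> p [/D1U1/U1H[]].
- split => //; first by move=> y /DB2/reg2.
  exact: smooth_sub sG.
- by split => // y /DB2; [exact: GW|exact: isoG].
- split; first by move=> p [_ []].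
  + by move=> p Up; rewrite FG3; [apply: G3E; case: (UU2 _ Up)|exact: UU2].
  + move=> y Dy; have Ty : T (lift2 y) by split; [exact/lift2B/DB2|rewrite /= lift2K].
    by move: Ty; rewrite -PhiU => -[p Up pE]; exists p; rewrite // pE lift2K.
Qed.

End LocalForm.

(** * Charts, isometries and assembly *)

Lemma ip_mulmx {R : realType} {n k} (A : 'M[R]_(n, k)) (G : 'M[R]_k) (v w : 'rV[R]_n) :
  (v *m A *m G *m (w *m A)^T) 0 0 = (v *m (A *m G *m A^T) *m w^T) 0 0.
Proof. by rewrite trmx_mul !mulmxA. Qed.

Section Atlas.
Context {R : realType} {n : nat}.
Variable N : atlas_data R n.
Hypothesis hN : riemannian_manifold N.

Lemma chart_cinvK (j : idx N) x : (cmap j @` cdom j) x ->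
  cdom j (cinv j x) /\ cmap j (cinv j x) = x.
Proof. by move=> [q jq <-]; rewrite (rm_cancel hN). Qed.

Lemma open_chart_image (i : idx N) (A : set (pt N)) : open A -> open (cmap i @` (A `&` cdom i)).
Proof.
move=> oA; rewrite (_ : _ @` _ = (cmap i @` cdom i) `&` cinv i @^-1` A).
  apply: open_setI_preimage => //; first exact: rm_cimg.
  by move=> x; exact: rm_cinv.
apply/seteqP; split => [x [q [Aq iq] <-]|x [[q iq <-]]].
  by split; [exists q|rewrite /= (rm_cancel hN)].
by rewrite /= (rm_cancel hN)// => Aq; exists q.
Qed.

Lemma met_entry_smooth (j : idx N) i k : smooth (cmap j @` cdom j) (fun y => met j y i k).
Proof. by apply: smooth_entry; [exact: rm_cimg|exact: rm_met_smooth]. Qed.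

Lemma met_sym (j : idx N) y i k : (cmap j @` cdom j) y -> met j y i k = met j y k i.
Proof. by move=> Wy; rewrite -{1}(rm_met_sym hN Wy) mxE. Qed.

Lemma met_det (j : idx N) y : (cmap j @` cdom j) y -> \det (met j y) != 0.
Proof.
move=> Wy; rewrite -unitfE -unitmxE -row_free_unit -kermx_eq0; apply/negP => /negP.
case/rowV0Pn => w /sub_kermxP wK w0; have := rm_met_pos hN Wy w0.
by rewrite /ip wK mul0mx mxE ltxx.
Qed.

Lemma locdom_id (i j : idx N) :
  locdom (supp N) (id : pt N -> pt N) i j = cmap i @` (cdom j `&` cdom i).
Proof.
have sub k p : cdom k p -> supp N p by move=> kp; rewrite -(rm_cover hN); exists k.
apply/seteqP; split => [x [q [[_ iq] jq] <-]|x [q [jq iq] <-]].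
  by exists q.
by exists q => //; split => //; split => //; exact: sub iq.
Qed.

End Atlas.

Section HarmonicSubmersion.
Context {R : realType}.
Variables m l : R.
Variables (N : atlas_data R 2) (hN : riemannian_manifold N).
Variable phi : pt (bcv m l) -> pt N.
Hypotheses (hsub : riemannian_submersion phi) (hharm : harmonic_map phi).
Variables (j : idx N) (p0 : 'rV[R]_3).
Hypotheses (p0_reg : bcv_region m p0) (jp0 : cdom j (phi p0)).
Notation F := (fun p => cmap j (phi p)).
Notation W := (cmap j @` cdom j).
Let O : set 'rV[R]_3 := bcv_region m `&` phi @^-1` cdom j.

Let OE : locdom (supp (bcv m l)) phi tt j = O.
Proof.
apply/seteqP; split => [x [p [[Op _] jp] <-] //|p [Op jp]].
by exists p.
Qed.

Let oO : open O.
Proof.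
apply: open_setI_preimage; [exact: open_bcv_region|exact: (rm_cdom hN)|].
by have [[_ + _] _ _] := hsub.
Qed.

Let sF : smooth O F.
Proof. by have [[_ _ /(_ tt j)]] := hsub; rewrite OE. Qed.

Let gram p : O p -> (bcv_frame m l p *m jac F p)^T *m (bcv_frame m l p *m jac F p)
  *m met j (F p) = 1%:M.
Proof.
move=> Op; have [_ _ /(_ tt j p)] := hsub; rewrite OE => /(_ Op) [sur iso].
have dE v : 'd F p v = v *m jac F p.
  by apply: diff_jac; exact: smooth_differentiable sF Op.
apply: (@submersion_gram _ _ _ _ (bcv_metric m l p)).
- by apply: frame_orthonormal; apply: lt0r_neq0; case: Op.
- by move=> w; have [v vE] := sur w; exists v; rewrite -dE.
- move=> v w vh wh; rewrite -!dE; apply: iso.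
    by move=> u; rewrite [X in X = _ -> _](dE u); exact: vh.
  by move=> u; rewrite [X in X = _ -> _](dE u); exact: wh.
Qed.

Lemma harmonic_submersion_form : factors_through_base m l O W F (met j) p0.
Proof.
have oW : open W by exact: rm_cimg.
have OW p : O p -> W (F p) by move=> [_ jp]; exists (phi p).
have O_reg : O `<=` bcv_region m by move=> p [].
have O0 p : O p -> bcv_factor m (p 0 0) (p 0 1) != 0 by move=> /O_reg; exact: lt0r_neq0.
have Op0 : O p0 by [].
have harm p : O p -> tension (bcv_metric m l) (met j) F p = 0.
  by have [_ /(_ tt j p)] := hharm; rewrite OE.
have [v [s [sv ss u1 vert frv]]] := vertical_field oO O0 oW OW sF
  (@met_entry_smooth _ _ N hN j) (@met_sym _ _ N hN j) (@met_det _ _ N hN j) gram harm.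
have str := vertical_field_straightens oO O_reg Op0 sv ss u1 frv.
exact: (local_form oO O_reg OW sF gram u1 vert str).
Qed.

Lemma curvature_at : gauss_curvature (met j) (F p0) = 4 * m.
Proof.
have [U [Phi [Phi' [D [G [G' [[_ _ Up0 _ _] _ [oD Dreg sG _ _] [_ DW iso] [UD FG _]]]]]]]]
  := harmonic_submersion_form.
rewrite FG//; have oW : open W by exact: rm_cimg.
have sub : D `<=` [set q : 'rV[R]_2 | 0 < bcv_factor m (q 0 0) (q 0 1)] by [].
apply: (isometry_gauss_curvature (U := D) oD oW DW sG (G := base_metric m)) => //.
- by move=> i k; apply: (smooth_sub sub); exact: smooth_base_metric.
- exact: met_entry_smooth.
- by move=> x /Dreg; exact: det_base_metric.
- by move=> x i k; exact: met_sym.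
- by move=> x; exact: met_det.
- exact: UD.
- by move=> i k; apply: base_riemann; apply: Dreg; exact: UD.
Qed.

End HarmonicSubmersion.

Section Isometries.
Context {R : realType}.

Lemma open_region_isometry {n} (D : set 'rV[R]_n) (g : 'rV[R]_n -> 'M[R]_n)
    (U : set 'rV[R]_n) (Phi Phi' : 'rV[R]_n -> 'rV[R]_n) :
  open U -> U `<=` D -> open (Phi @` U) -> Phi @` U `<=` D ->
  smooth U Phi -> smooth (Phi @` U) Phi' -> (forall p, U p -> Phi' (Phi p) = p) ->
  (forall p, U p -> jac Phi p *m g (Phi p) *m (jac Phi p)^T = g p) ->
  @is_isometry R n (open_region D g) (open_region D g) U (Phi @` U) Phi.
Proof.
move=> oU UD oV VD sP sP' PK iso.
have locU A f : @locdom R n n (open_region D g) (open_region D g) A f tt tt `<=` A.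
  by move=> x [p [[Ap _] _] <-].
have imV : Phi' @` (Phi @` U) = U.
  apply/seteqP; split => [x [q [p Up <-] <-]|p Up]; first by rewrite PK.
  by exists (Phi p); [exists p|exact: PK].
split => //.
- split => //; split => //; first by move=> p; exact: smooth_continuous sP.
  by move=> [] []; exact: smooth_sub (@locU U Phi) sP.
- exists Phi'; split => //; split => //; first by rewrite imV.
    by move=> p; exact: smooth_continuous sP'.
  by move=> [] []; exact: smooth_sub (@locU (Phi @` U) Phi') sP'.
move=> [] [] x /locU Ux v w.
have dE u : 'd Phi x u = u *m jac Phi x.
  by apply: diff_jac; exact: smooth_differentiable sP Ux.
rewrite /ip [X in X *m _ *m _](dE v) [X in _ *m X^T](dE w).
by rewrite ip_mulmx; congr ((_ *m _ *m _) 0 0); exact: iso.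
Qed.

Section ChartIsometry.
Variables (n : nat) (N : atlas_data R n) (hN : riemannian_manifold N) (j : idx N).
Variables (A D : set 'rV[R]_n) (g : 'rV[R]_n -> 'M[R]_n) (G G' : 'rV[R]_n -> 'rV[R]_n).
Hypotheses (oD : open D) (DA : D `<=` A) (sG : smooth D G) (oGD : open (G @` D)).
Hypotheses (sG' : smooth (G @` D) G') (GK : forall y, D y -> G' (G y) = y).
Hypothesis DW : forall y, D y -> (cmap j @` cdom j) (G y).
Hypothesis iso : forall y, D y -> g y = jac G y *m met j (G y) *m (jac G y)^T.
Notation N0 := (open_region A g).
Let P : set (pt N) := cdom j `&` cmap j @^-1` (G @` D).
Let Psi : pt N -> pt N0 := fun q => G' (cmap j q).
Let Psi' : pt N0 -> pt N := fun y => cinv j (G y).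

Let oP : open P.
Proof.
apply: open_setI_preimage => //; first exact: (rm_cdom hN).
by move=> p; exact: (rm_cmap hN).
Qed.

Let PS : P `<=` supp N.
Proof. by move=> p [jp _]; rewrite -(rm_cover hN); exists j. Qed.

Let PsiD q : P q -> D (Psi q).
Proof. by move=> [_ [y Dy yE]]; rewrite /Psi -yE GK. Qed.

Let Psi'P y : D y -> P (Psi' y).
Proof.
move=> Dy; have [jq qE] := chart_cinvK hN (DW Dy).
by split=> //; exists y; rewrite // /Psi' qE.
Qed.

Let PsiK q : P q -> Psi' (Psi q) = q.
Proof. by move=> [jq [y Dy yE]]; rewrite /Psi /Psi' -yE GK// yE (rm_cancel hN). Qed.

Let Psi'K y : D y -> Psi (Psi' y) = y.
Proof. by move=> Dy; have [_ qE] := chart_cinvK hN (DW Dy); rewrite /Psi qE GK. Qed.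

Let PsiP : Psi @` P = D.
Proof.
apply/seteqP; split => [y [q Pq <-]|y Dy]; first exact: PsiD.
by exists (Psi' y); [exact: Psi'P|exact: Psi'K].
Qed.

Let Psi'D : Psi' @` D = P.
Proof.
apply/seteqP; split => [q [y Dy <-]|q Pq]; first exact: Psi'P.
by exists (Psi q); [exact: PsiD|exact: PsiK].
Qed.

Let oPi i : open (cmap i @` (P `&` cdom i)). Proof. exact: open_chart_image. Qed.

Let smooth_change (i k : idx N) : smooth (cmap i @` (cdom k `&` cdom i)) (loc id i k).
Proof. by have [_ _ /(_ i k)] := rm_change hN; rewrite locdom_id. Qed.

Let locPsi i : smooth (cmap i @` (P `&` cdom i)) (loc Psi i tt).
Proof.
apply: (smooth_compose_mx (W := G @` D) (F := loc id i j) (g := G')) => //.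
  move=> x [q [[jq [y Dy yE]] iq] <-]; rewrite /loc (rm_cancel hN)// -yE.
  by exists y.
apply: smooth_sub (smooth_change i j) => x [q [[jq _] iq] <-].
by exists q.
Qed.

Let cPsi q : P q -> {for q, continuous Psi}.
Proof.
move=> [jq GDq]; apply: (@continuous_comp _ _ _ (cmap j) G').
  exact: (rm_cmap hN).
exact: smooth_continuous sG' GDq.
Qed.

Let cPsi' y : D y -> {for y, continuous Psi'}.
Proof.
move=> Dy; apply: (@continuous_comp _ _ _ G (cinv j)).
  exact: smooth_continuous sG Dy.
by apply: (rm_cinv hN); exact: DW.
Qed.

Let locPsi' i : smooth (@locdom R n n N0 N D Psi' tt i) (@loc R n n N0 N Psi' tt i).
Proof.
have oD' : open (D `&` Psi' @^-1` cdom i).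
  by apply: open_setI_preimage => //; exact: (rm_cdom hN).
apply: (@smooth_sub _ _ _ (D `&` Psi' @^-1` cdom i)).
  by move=> x [y [[Dy _] iy] <-].
apply: (smooth_compose_mx (W := cmap j @` (cdom i `&` cdom j)) (F := G) (g := loc id j i)) => //.
- by apply: open_chart_image => //; exact: (rm_cdom hN).
- move=> y [Dy iy]; have [jq qE] := chart_cinvK hN (DW Dy).
  by exists (Psi' y).
- by apply: smooth_sub sG => y [].
Qed.

(** Differentiating G' (G y) = y shows that the two Jacobians are inverse to each other, so the
    isometry identity for [G] can be inverted. *)
Let inverse_metric y : D y ->
  jac G' (G y) *m g y *m (jac G' (G y))^T = met j (G y).
Proof.
move=> Dy; have GDy : (G @` D) (G y) by exists y.
have JJ : jac G y *m jac G' (G y) = 1%:M.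
  rewrite -(jac_compose (F := id) oD Dy) => [|q Dq||].
  - apply/matrixP => i k; rewrite mxE; apply: derive_rule; first exact: is_derive_coord.
    by rewrite !mxE eqxx eq_sym.
  - by rewrite GK.
  - exact: smooth_differentiable sG Dy.
  - exact: smooth_differentiable sG' GDy.
have JJ' := mulmx1C JJ; have JT : (jac G y)^T *m (jac G' (G y))^T = 1%:M.
  by rewrite -trmx_mul JJ' trmx1.
by rewrite iso// !mulmxA JJ' mul1mx -mulmxA JT mulmx1.
Qed.

(** An isometry must be tested in every chart i of N, while [Psi] is defined through the chart j.
    The expression of [Psi] in i is the change of charts followed by [G']: the former preserves the
    metric by [rm_met_change], the latter by [inverse_metric]. *)
Lemma chart_isometry : @is_isometry R n N N0 P D Psi.
Proof.
split => //.
- split => //; split; [|by []|].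
    by rewrite PsiP.
  move=> i []; apply: smooth_sub (locPsi i) => x [q [[Pq iq] _] <-].
  by exists q.
- by exists Psi'; split => //; split; [rewrite Psi'D| |case].
move=> i [] x [q [[Pq iq] _] <-] v w.
have Ax : (cmap i @` (P `&` cdom i)) (cmap i q) by exists q.
have [jq [y Dy yE]] := Pq.
have Bx : (cmap i @` (cdom j `&` cdom i)) (cmap i q) by exists q.
have dT : differentiable (loc id i j) (cmap i q).
  exact: smooth_differentiable (smooth_change i j) Bx.
have TE : loc id i j (cmap i q) = G y by rewrite /loc (rm_cancel hN).
have dG' : differentiable G' (G y) by apply: smooth_differentiable sG' _; exists y.
have PE : loc Psi i tt (cmap i q) = y.
  by rewrite /loc (rm_cancel hN)// /= /Psi -yE GK.
have JE : jac (loc Psi i tt) (cmap i q) = jac (loc id i j) (cmap i q) *m jac G' (G y).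
  rewrite -TE; apply: (jac_compose (@oPi i) Ax) => //.
  by rewrite TE.
have dE u : 'd (loc Psi i tt) (cmap i q) u = u *m jac (loc Psi i tt) (cmap i q).
  by apply: diff_jac; exact: smooth_differentiable (locPsi i) Ax.
rewrite /ip [X in X *m _ *m _](dE v) [X in _ *m X^T](dE w) JE PE !mulmxA.
rewrite ip_mulmx inverse_metric// -TE.
have /(_ i j (cmap i q)) := rm_met_change hN; rewrite locdom_id// => /(_ Bx v w).
by rewrite /ip !diff_jac.
Qed.

End ChartIsometry.
End Isometries.

Theorem theorem3p1 (R : realType) (m l : R) (N : atlas_data R 2)
    (hN : riemannian_manifold N) (phi : pt (bcv m l) -> pt N)
    (hsub : riemannian_submersion phi) (hharm : harmonic_map phi) :
  constant_gauss_curvature N (4 * m)%R /\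
  locally_equivalent phi (@bcv_proj R m l).
Proof.
have [_ sur _] := hsub.
have cov q : supp N q -> exists j, cdom j q by rewrite -(rm_cover hN) => -[j _ jq]; exists j.
(* The curvature at a point of N is obtained from the local form at some point above it, which
   exists by surjectivity. *)
split=> [j _ [q jq <-]|p0 p0_reg].
  have : supp N q by rewrite -(rm_cover hN); exists j.
  rewrite -sur => -[p0 p0_reg pq].
  by move: jq; rewrite -pq => jp0; exact: (curvature_at hN hsub hharm p0_reg jp0).
have [j jp0] : exists j, cdom j (phi p0) by apply: cov; rewrite -sur; exists p0.
have [U [Phi [Phi' [D [G [G' [[oU UO Up0 sP oV] [sP' PK Preg iso]
  [oD Dreg sG oGD sG'] [GK DW isoG] [UD FG Dsur]]]]]]]] :=
  harmonic_submersion_form hN hsub hharm p0_reg jp0.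
(* The image of [U] is exactly the domain on which the chart followed by [G'] is an isometry: every
   y in [D] lies under a point of [U], and the chart is injective. *)
have PE : phi @` U = cdom j `&` cmap j @^-1` (G @` D).
  apply/seteqP; split => [_ [p Up <-]|q [jq [y Dy yE]]].
    have [_ jp] := UO _ Up; split => //; exists (proj32 (Phi p)); first exact: UD.
    by rewrite -FG.
  have [p Up pE] := Dsur y Dy; exists p => //; have [_ jp] := UO _ Up.
  by rewrite -(rm_cancel hN jp) -(rm_cancel hN jq) (FG _ Up) pE yE.
exists U, (Phi @` U), D, Phi, (fun q => G' (cmap j q)); split => //.
- apply: (open_region_isometry (Phi' := Phi')) => //; first by move=> p /UO[].
  by move=> _ [p Up <-]; exact: Preg.
- by rewrite PE; apply: (chart_isometry hN oD).
- by move=> p Up; rewrite (FG _ Up) GK//; exact: UD.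
Qed.
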